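(* Let $G$ be a countable group and $K$ a second countable compact group. Let $G \times K$ act on the standard probability space $(X,\mu)$, preserving $\mu$. Suppose that $G \curvearrowright (X,\mu)$ is essentially free, weakly mixing and has the property that every $1$-cocycle for $G\curvearrowright(X,\mu)$ with values in a Polish group of finite type $\mathcal{G}$ is cohomologous to a homomorphism $G\to\mathcal{G}$. Assume that $G \curvearrowright X^K$ remains essentially free. If $\Gamma$ is a countable group, $\Gamma \curvearrowright (Y,\eta)$ is any essentially free ergodic action and $\pi : X^K \to Y$ is a stable orbit equivalence, then there exist 1. a closed normal subgroup $K_1 \subset K$ with finite quotient $K_0 := K/K_1$; 2. a homomorphism $\theta : G \times K_0 \to \Gamma$ with image of finite index in $\Gamma$ and with finite kernel trivially intersecting $K_0$; 3. a conjugation of $\Gamma$-actions $\Delta : Y \to \mathrm{Ind}_\theta^\Gamma\bigl((G \times K_0) \curvearrowright X^{K_1}\bigr)$; such that $\Delta \circ \pi$ is the canonical stable orbit equivalence. In particular, the compression constant of $\pi$ is given by $$c(\pi) = \frac{|K_0|\,[\Gamma : \mathrm{Im}\,\theta]}{|\mathrm{Ker}\,\theta|}.$$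
   Context: All actions are probability measure preserving. Essentially free: a.e. point has trivial stabilizer. Weakly mixing: the diagonal action $G\curvearrowright(X\times X,\mu\times\mu)$ is ergodic. For a closed normal subgroup $K_1\subset K$, $(X^{K_1},\mu^{K_1})$ is the quotient of $X$ by $K_1$, i.e. $L^\infty(X^{K_1})=L^\infty(X)^{K_1}$; $G\times K/K_1$ acts on it. In particular $G$ acts on $X^K$. A Polish group is of finite type if it can be realized as a closed subgroup of the unitary group of a finite von Neumann algebra with separable predual. A $1$-cocycle for $G\curvearrowright(X,\mu)$ with values in $\mathcal{G}$ is a measurable map $\omega:G\times X\to\mathcal{G}$ with $\omega(gh,x)=\omega(g,h\cdot x)\,\omega(h,x)$ a.e.; $\omega_1,\omega_2$ are cohomologous if there is a measurable $\varphi:X\to\mathcal{G}$ with $\omega_2(g,x)=\varphi(g\cdot x)\,\omega_1(g,x)\,\varphi(x)^{-1}$ a.e.; homomorphisms $G\to\mathcal{G}$ are the cocycles not depending on $x$. A stable orbit equivalence $\pi$ between ergodic essentially free actions on probability spaces $(Z,\zeta)$ and $(Y,\eta)$ is a (measure scaling) nonsingular isomorphism $\pi:A\to B$ between non-negligible measurable subsets $A\subset Z$, $B\subset Y$, such that, almost everywhere on $A$, $z,z'$ lie in the same orbit if and only if $\pi(z),\pi(z')$ do. Its compression constant is $c(\pi)=\zeta(A)/\eta(B)$. Induced action: let $\theta:\Lambda\to\Gamma$ be a homomorphism with finite kernel and image of finite index, and $\Lambda\curvearrowright(Z,\zeta)$ an action (free on the kernel). $\mathrm{Ind}_\theta^\Gamma(\Lambda\curvearrowright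 Z)$ is the action of $\Gamma$ on the quotient $\Lambda\backslash(Z\times\Gamma)$ for $\lambda\cdot(z,s)=(\lambda\cdot z,\theta(\lambda)s)$, with normalized measure, where $t \in \Gamma$ acts by right translation by $t^{-1}$ on the second variable. The map $z\mapsto[(z,e)]$ sends $\Lambda$-orbits into $\Gamma$-orbits. With $\Lambda=G\times K_0$ and $Z=X^{K_1}$, it induces the canonical stable orbit equivalence from $G\curvearrowright X^K$ to the induced action, well defined up to moving points inside orbits. That $\Delta\circ\pi$ is the canonical stable orbit equivalence means that for a.e. $x\in X^{K_1}$ whose image $\overline{x}\in X^K$ lies in the domain of $\pi$, the point $\Delta(\pi(\overline{x}))$ lies in the $\Gamma$-orbit of $[(x,e)]$. A conjugation of $\Gamma$-actions is a $\Gamma$-equivariant measure space isomorphism. *)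

(* Defs.v *)
From HB Require Import structures.
From mathcomp Require Import all_boot all_order all_algebra.
From mathcomp Require Import finmap complex.
From mathcomp Require Import all_classical all_reals all_analysis.

Set Implicit Arguments.
Unset Strict Implicit.
Unset Printing Implicit Defensive.

Import Order.TTheory GRing.Theory Num.Theory.
Import numFieldNormedType.Exports.

Local Open Scope classical_set_scope.
Local Open Scope ring_scope.

HB.mixin Record isTopologicalGroup K & Group K & PointedTopological K := {
  mulg_continuous : continuous (fun p : K * K => (p.1 * p.2)%g);
  invg_continuous : continuous (fun k : K => k^-1%g)
}.

#[short(type="topGroupType")]
HB.structure Definition TopologicalGroup :=
  {K of Group K & PointedTopological K & isTopologicalGroup K}.

Notation borel K := (g_sigma_algebraType (@open K)).

(* Hausdorff completePseudoMetricTypes are complete metric spaces. *)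
Definition polish (R : realType) (T : topologicalType) : Prop :=
  exists (P : completePseudoMetricType R) (f : T -> P) (g : P -> T),
    [/\ hausdorff_space P,
        exists2 D : set P, countable D & dense D,
        cancel f g /\ cancel g f &
        continuous f /\ continuous g].

Definition standard_borel (R : realType) d (T : measurableType d) : Prop :=
  exists (P : ptopologicalType) (f : T -> borel P) (g : borel P -> T),
    [/\ polish R P,
        cancel f g /\ cancel g f,
        measurable_fun [set: T] f &
        measurable_fun [set: borel P] g].

Section FiniteType.
Variables (C : numClosedFieldType) (H : completeNormedModType C).
Implicit Types (T S U V : H -> H) (M : set (H -> H)) (phi : (H -> H) -> C).

(* Together with completeness, this makes H a Hilbert space: the norm of H is
   the one given by the inner product, which is linear on the left. *)
Definition inner_product (ip : H -> H -> C) : Prop :=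
  [/\ forall c x y z, ip (c *: x + y) z = c * ip x z + ip y z,
      forall x y, ip y x = (ip x y)^* &
      forall x, ip x x = `|x| ^+ 2].

Variable ip : H -> H -> C.

Definition bounded_operator : set (H -> H) :=
  [set T | linear T /\ continuous T].

Definition adjoint_of T S : Prop := forall x y, ip (T x) y = ip x (S y).

Definition commutant M : set (H -> H) :=
  [set T | bounded_operator T /\ forall S, M S -> T \o S = S \o T].

Definition von_neumann_algebra M : Prop :=
  [/\ M `<=` bounded_operator,
      forall T, M T -> exists2 S, M S & adjoint_of T S &
      commutant (commutant M) = M].

(* The identity is a finite projection: every isometry of M is unitary. *)
Definition finite_vN M : Prop :=
  forall V W, M V -> M W -> adjoint_of V W -> W \o V = id -> V \o W = id.

(* The predual of M is the space of its sigma-weakly continuous functionals,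
   phi T = \sum_n <T xi_n, eta_n> with square-summable xi and eta. *)
Definition in_predual M phi : Prop :=
  exists xi eta : nat -> H,
    [/\ cvgn (series (fun n => `|xi n| ^+ 2 : C)),
        cvgn (series (fun n => `|eta n| ^+ 2 : C)) &
        forall T, M T ->
          series (fun n => ip (T (xi n)) (eta n)) @ \oo --> phi T].

(* Separability for the norm of the dual of M; the condition on T says that
   the operator norm of T is at most 1. *)
Definition separable_predual M : Prop :=
  exists phi_ : nat -> (H -> H) -> C,
    (forall n, in_predual M (phi_ n)) /\
    forall phi, in_predual M phi -> forall e : C, 0 < e ->
      exists n, forall T, M T -> (forall x, `|T x| <= `|x|) ->
        `|phi T - phi_ n T| <= e.

Definition unitary_group M : set (H -> H) :=
  [set U | M U /\
    exists V, [/\ adjoint_of U V, U \o V = id & V \o U = id]].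

(* Isomorphism of the topological group Gr with a closed subgroup of U(M),
   for the strong operator topology, i.e. pointwise convergence on H. *)
Definition closed_unitary_embedding M (Gr : topGroupType)
    (j : Gr -> {ptws H -> H}) : Prop :=
  [/\ injective j /\ (forall g h, j (g * h)%g = (j g \o j h : H -> H)),
      range j `<=` unitary_group M,
      closure (range j) `&` unitary_group M `<=` range j &
      forall O : set Gr, open O <-> exists2 W, open W & O = j @^-1` W].

End FiniteType.

Definition polish_of_finite_type (R : realType) (Gr : topGroupType) : Prop :=
  polish R Gr /\
  exists (H : completeNormedModType R[i]) (ip : H -> H -> R[i])
      (M : set (H -> H)) (j : Gr -> {ptws H -> H}),
    [/\ inner_product ip, von_neumann_algebra ip M, finite_vN ip M,
        separable_predual ip M & closed_unitary_embedding ip M j].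

(* Actions are defined everywhere; only the properties of the action relative
   to the measure are up to null sets. *)
Definition pmp_action (R : realType) (H : groupType) d (T : measurableType d)
    (mu : set T -> \bar R) (a : H -> T -> T) : Prop :=
  [/\ forall x, a 1%g x = x,
      forall g h x, a (g * h)%g x = a g (a h x),
      forall h, measurable_fun [set: T] (a h) &
      forall h A, measurable A -> mu (a h @^-1` A) = mu A].

Definition jointly_measurable (G : groupType) (K : topGroupType)
    d (X : measurableType d) (a : G * K -> X -> X) : Prop :=
  forall g, measurable_fun [set: (borel K * X)%type]
    (fun p : (borel K * X)%type => a (g, p.1) p.2).

Definition essentially_free (R : realType) (H : groupType)
    d (T : measurableType d) (mu : set T -> \bar R) (a : H -> T -> T) : Prop :=
  \forall x \ae mu, forall h, a h x = x -> h = 1%g.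

Definition ergodic (R : realType) (H : groupType)
    d (T : measurableType d) (mu : set T -> \bar R) (a : H -> T -> T) : Prop :=
  forall A, measurable A -> (forall h, mu ((a h @^-1` A) `+` A) = 0%E) ->
    mu A = 0%E \/ mu A = 1%E.

Definition weakly_mixing (R : realType) (H : groupType)
    d (T : measurableType d) (mu : probability T R) (a : H -> T -> T) : Prop :=
  ergodic (mu \x mu)%E
    (fun h (p : (T * T)%type) => (a h p.1, a h p.2) : (T * T)%type).

Section Cocycles.
Variables (R : realType) (G : groupType) (d : measure_display).
Variables (X : measurableType d) (mu : probability X R) (a : G -> X -> X).
Variable Gr : topGroupType.

Definition is_cocycle (w : G -> X -> Gr) : Prop :=
  (forall g, measurable_fun [set: X] (w g : X -> borel Gr)) /\
  (forall g h, \forall x \ae mu, w (g * h)%g x = (w g (a h x) * w h x)%g).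

Definition cohomologous (w1 w2 : G -> X -> Gr) : Prop :=
  exists2 phi : X -> Gr, measurable_fun [set: X] (phi : X -> borel Gr) &
    forall g, \forall x \ae mu,
      w2 g x = (phi (a g x) * w1 g x * (phi x)^-1)%g.

End Cocycles.

Definition cocycle_superrigid (R : realType) (G : groupType)
    d (X : measurableType d) (mu : probability X R) (a : G -> X -> X) : Prop :=
  forall Gr : topGroupType, polish_of_finite_type R Gr ->
  forall w : G -> X -> Gr, is_cocycle mu a w ->
  exists rho : {multiplicative G -> Gr}, cohomologous mu a w (fun g _ => rho g).

Section OrbitSpace.
Variables (H : Type) (T : Type) (a : H -> T -> T) (S : set H).

Definition orbit_of (x : T) : set T := [set a h x | h in S].

Definition orbit_space : Type := {O : set T | exists x, O = orbit_of x}.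

Definition orbit_pi (x : T) : orbit_space :=
  exist _ (orbit_of x) (ex_intro _ x erefl).

Definition orbit_repr (O : orbit_space) : T := sval (cid (svalP O)).

Lemma orbit_reprK : cancel orbit_repr orbit_pi.
Proof.
by case=> O HO; apply/eq_exist; rewrite /orbit_repr; case: cid => x /= <-.
Qed.

HB.instance Definition _ := gen_eqMixin orbit_space.
HB.instance Definition _ := gen_choiceMixin orbit_space.

End OrbitSpace.

HB.instance Definition _ H (T : pointedType) (a : H -> T -> T) (S : set H) :=
  isPointed.Build (orbit_space a S) (orbit_pi a S point).

Section OrbitSpaceMeasurable.
Variables (H : Type) (d : measure_display) (T : measurableType d).
Variables (a : H -> T -> T) (S : set H).

Definition orbit_measurable : set (set (orbit_space a S)) :=
  [set B | measurable (orbit_pi a S @^-1` B)].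

Let orbit_measurable0 : orbit_measurable set0.
Proof. by rewrite /orbit_measurable/= preimage_set0. Qed.

Let orbit_measurableC B : orbit_measurable B -> orbit_measurable (~` B).
Proof. by rewrite /orbit_measurable/= preimage_setC; exact: measurableC. Qed.

Let orbit_measurable_bigcup (F : (set (orbit_space a S))^nat) :
  (forall i, orbit_measurable (F i)) -> orbit_measurable (\bigcup_i F i).
Proof.
move=> mF; rewrite /orbit_measurable/= preimage_bigcup.
by apply: bigcup_measurable => i _; exact: mF.
Qed.

HB.instance Definition _ := isMeasurable.Build default_measure_display
  (orbit_space a S) orbit_measurable0 orbit_measurableC
  orbit_measurable_bigcup.

End OrbitSpaceMeasurable.

Record normal_subgroup (K : groupType) := NormalSubgroup {
  normal_set :> set K;
  normal1 : normal_set 1%g;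
  normalM : forall h k, normal_set h -> normal_set k -> normal_set (h * k)%g;
  normalV : forall h, normal_set h -> normal_set h^-1%g;
  normalJ : forall h k, normal_set h -> normal_set (k * h * k^-1)%g
}.

Section QuotientGroup.
Local Open Scope group_scope.
Variables (K : groupType) (N : normal_subgroup K).

Definition quotient_group : Type :=
  {C : set K | exists k, C = [set k * h | h in N]}.

Definition coset_pi (k : K) : quotient_group :=
  exist _ [set k * h | h in N] (ex_intro _ k erefl).

Definition coset_repr (C : quotient_group) : K := sval (cid (svalP C)).

Lemma coset_reprK : cancel coset_repr coset_pi.
Proof.
by case=> C HC; apply/eq_exist; rewrite /coset_repr; case: cid => x /= <-.
Qed.

Lemma coset_piP k l : coset_pi k = coset_pi l <-> normal_set N (k^-1 * l).
Proof.
split=> [[/seteqP[_ /(_ l)]] | Nkl].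
  case; first by exists 1; [exact: normal1 | rewrite mulg1].
  by move=> h Nh <-; rewrite mulKg.
apply/eq_exist/seteqP; split=> x [h Nh <-].
  exists ((k^-1 * l)^-1 * h); first by apply: normalM => //; exact: normalV.
  by rewrite invgM invgK !mulgA mulgV mul1g.
by exists (k^-1 * l * h); [exact: normalM | rewrite !mulgA mulgV mul1g].
Qed.

Definition quotient_mul (C D : quotient_group) : quotient_group :=
  coset_pi (coset_repr C * coset_repr D).

Definition quotient_inv (C : quotient_group) : quotient_group :=
  coset_pi (coset_repr C)^-1.

Lemma coset_piM k l : coset_pi (k * l) = quotient_mul (coset_pi k) (coset_pi l).
Proof.
apply/coset_piP; set k' := coset_repr _; set l' := coset_repr _.
have /coset_piP Nk : coset_pi k = coset_pi k' by rewrite coset_reprK.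
have /coset_piP Nl : coset_pi l = coset_pi l' by rewrite coset_reprK.
have -> : (k * l)^-1 * (k' * l') = l^-1 * (k^-1 * k') * l^-1^-1 * (l^-1 * l').
  by rewrite invgM invgK !mulgA mulgK.
by apply: normalM => //; exact: normalJ.
Qed.

HB.instance Definition _ := gen_eqMixin quotient_group.
HB.instance Definition _ := gen_choiceMixin quotient_group.

Let quotient_mulA : associative quotient_mul.
Proof.
move=> C D E; rewrite -(coset_reprK C) -(coset_reprK D) -(coset_reprK E).
by rewrite -!coset_piM mulgA.
Qed.

Let quotient_mul1 : left_id (coset_pi 1) quotient_mul.
Proof. by move=> C; rewrite -(coset_reprK C) -coset_piM mul1g. Qed.

Let quotient_1mul : right_id (coset_pi 1) quotient_mul.
Proof. by move=> C; rewrite -(coset_reprK C) -coset_piM mulg1. Qed.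

Let quotient_mulV : left_inverse (coset_pi 1) quotient_inv quotient_mul.
Proof.
by move=> C; rewrite -{2}(coset_reprK C) /quotient_inv -coset_piM mulVg.
Qed.

Let quotient_Vmul : right_inverse (coset_pi 1) quotient_inv quotient_mul.
Proof.
by move=> C; rewrite -{1}(coset_reprK C) /quotient_inv -coset_piM mulgV.
Qed.

HB.instance Definition _ := isGroup.Build quotient_group
  quotient_mulA quotient_mul1 quotient_1mul quotient_mulV quotient_Vmul.

End QuotientGroup.

(* X^N is the orbit space X/N: since N is compact, the Borel functions on X/N
   are, up to null sets, the N-invariant elements of L^oo(X). The functions
   below are defined through representatives of the orbits and of the cosets;
   when N is a normal subgroup they do not depend on this choice. *)
Section FixedQuotient.
Variables (R : realType) (G K : groupType) (d : measure_display).
Variables (X : measurableType d) (mu : probability X R).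
Variable a : G * K -> X -> X.

Definition fixed_quotient (N : set K) : Type := orbit_space a ([set 1%g] `*` N).

HB.instance Definition _ (N : set K) := Measurable.on (fixed_quotient N).

Definition fixed_pi (N : set K) : X -> fixed_quotient N := @orbit_pi _ _ a _.

Definition fixed_repr (N : set K) : fixed_quotient N -> X :=
  @orbit_repr _ _ a _.

Definition fixed_measure (N : set K) : set (fixed_quotient N) -> \bar R :=
  pushforward mu (fixed_pi N).

Definition fixed_action (N : set K) (g : G) (z : fixed_quotient N) :
  fixed_quotient N := fixed_pi N (a (g, 1%g) (fixed_repr z)).

Definition fixed_quotient_action (N : normal_subgroup K)
    (l : G * quotient_group N) (z : fixed_quotient N) : fixed_quotient N :=
  fixed_pi N (a (l.1, coset_repr l.2) (fixed_repr z)).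

Definition fixed_map (N : set K) (z : fixed_quotient N) :
  fixed_quotient [set: K] := fixed_pi [set: K] (fixed_repr z).

End FixedQuotient.

Arguments fixed_quotient {G K d X} a N.
Arguments fixed_pi {G K d X} a N.
Arguments fixed_repr {G K d X a N}.
Arguments fixed_measure {R G K d X} mu a N.
Arguments fixed_action {G K d X} a N.
Arguments fixed_quotient_action {G K d X} a N.
Arguments fixed_map {G K d X a N}.

Definition discrete (Gamma : groupType) : Type := Gamma.
HB.instance Definition _ (Gamma : groupType) := Choice.on (discrete Gamma).
HB.instance Definition _ (Gamma : groupType) :=
  isPointed.Build (discrete Gamma) (1%g : Gamma).
HB.instance Definition _ (Gamma : groupType) :=
  isMeasurable.Build default_measure_display (discrete Gamma)
    (@discrete_measurable0 Gamma) (@discrete_measurableC Gamma)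
    (@discrete_measurableU Gamma).

Section Induced.
Variables (R : realType) (L Gamma : groupType) (d : measure_display).
Variables (Z : measurableType d) (zeta : set Z -> \bar R) (b : L -> Z -> Z).
Variable theta : L -> Gamma.

Definition induced_space : Type :=
  orbit_space (fun l (p : (Z * discrete Gamma)%type) =>
    (b l p.1, (theta l * p.2)%g) : (Z * discrete Gamma)%type) [set: L].

HB.instance Definition _ := Measurable.on induced_space.

Definition induced_pi : (Z * discrete Gamma)%type -> induced_space :=
  @orbit_pi _ _ _ _.

Definition induced_action (t : Gamma) (O : induced_space) : induced_space :=
  let p : (Z * discrete Gamma)%type := orbit_repr O in
  induced_pi (p.1, (p.2 * t^-1)%g).

(* The product of zeta and the counting measure of Gamma. *)
Definition product_counting (U : set (Z * discrete Gamma)%type) : \bar R :=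
  (\esum_(s in [set: Gamma]) zeta [set z | U (z, s)])%E.

(* nu is the normalization of the quotient of the measure product_counting:
   the projection to the quotient scales the measure by a constant on each
   measurable set that it embeds (partial fundamental domains). *)
Definition normalized_quotient_measure (nu : probability induced_space R) :
    Prop :=
  exists2 c : R, 0 < c &
    forall U : set (Z * discrete Gamma)%type, measurable U ->
      {in U &, injective induced_pi} ->
      nu (induced_pi @` U) = (c%:E * product_counting U)%E.

End Induced.

Arguments induced_space {L Gamma d Z} b theta.
Arguments induced_pi {L Gamma d Z} b theta.
Arguments induced_action {L Gamma d Z} b theta.
Arguments normalized_quotient_measure {R L Gamma d Z} zeta b theta.

Definition same_orbit (H : Type) (T : Type) (a : H -> T -> T) (x y : T) : Prop :=
  exists h, y = a h x.

(* pi : A -> B and its inverse pi' : B -> A are given by total functions whose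
   values outside A and B are irrelevant. The second clause and the scaling of
   the measures make pi a nonsingular isomorphism. *)
Definition stable_orbit_equivalence (R : realType) (G Gamma : groupType)
    d d' (Z : measurableType d) (Y : measurableType d')
    (zeta : set Z -> \bar R) (eta : set Y -> \bar R)
    (a : G -> Z -> Z) (b : Gamma -> Y -> Y)
    (A : set Z) (B : set Y) (pi : Z -> Y) : Prop :=
  [/\ [/\ measurable A, measurable B, (0 < zeta A)%E & (0 < eta B)%E],
      measurable_fun A pi /\ (exists pi' : Y -> Z,
        [/\ measurable_fun B pi',
            \forall z \ae zeta, A z -> B (pi z) /\ pi' (pi z) = z &
            \forall y \ae eta, B y -> A (pi' y) /\ pi (pi' y) = y]),
      (forall F, measurable F -> F `<=` B ->
        zeta (A `&` pi @^-1` F) * eta B = eta F * zeta A)%E &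
      exists A0, [/\ measurable A0, A0 `<=` A, zeta (A `\` A0) = 0%E &
        forall z z', A0 z -> A0 z' ->
          (same_orbit a z z' <-> same_orbit b (pi z) (pi z'))]].

Definition compression (R : realType) d d' (Z : measurableType d)
    (Y : measurableType d') (zeta : set Z -> \bar R) (eta : set Y -> \bar R)
    (A : set Z) (B : set Y) : R :=
  fine (zeta A) / fine (eta B).

Definition conjugation (R : realType) (Gamma : groupType)
    d d' (Y : measurableType d) (Z : measurableType d')
    (eta : set Y -> \bar R) (nu : set Z -> \bar R)
    (b : Gamma -> Y -> Y) (c : Gamma -> Z -> Z) (D : Y -> Z) : Prop :=
  [/\ measurable_fun [set: Y] D,
      forall E, measurable E -> eta (D @^-1` E) = nu E,
      exists D' : Z -> Y,
        [/\ measurable_fun [set: Z] D',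
            \forall y \ae eta, D' (D y) = y &
            \forall z \ae nu, D (D' z) = z] &
      forall t, \forall y \ae eta, D (b t y) = c t (D y)].

Section HomomorphismData.
Variables (L Gamma : groupType) (theta : L -> Gamma).

Definition group_kernel : set L := [set l | theta l = 1%g].

(* Right cosets of the image of theta; their number is its index. *)
Definition image_cosets : set (set Gamma) :=
  [set [set (i * s)%g | i in range theta] | s in [set: Gamma]].

End HomomorphismData.

Definition card_of (T : choiceType) (A : set T) : nat := #|` fset_set A|%fset.

(* Main.v *)
(* Let p : X -> Y be the lift of pi, extended to almost all of X along the orbits
   of G. Its Zimmer cocycle takes values in Gamma, which is of finite type since
   it is a closed subgroup of the unitary group of its group von Neumann algebra
   on l^2(Gamma). By superrigidity there are f : X -> Gamma and a homomorphism
   rho : G -> Gamma such that P(x) = f(x) p(x) satisfies P(g x) = rho(g) P(x), and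
   by weak mixing f(k x) f(x)^-1 is constant for each k in K. Hence P is
   equivariant for a homomorphism delta : G x K -> Gamma, and the kernel K1 of
   delta on K is measurable of countable index, hence open (Steinhaus). Since P
   factors through X^K1, is injective modulo orbits and scales the measure
   locally by a constant, [(x, s)] |-> s^-1 P(x) identifies the induced action
   with Y. Comparing the measures of a fundamental domain of Ker theta and of its
   image in Y gives the finiteness of Ker theta and of the index, and the
   compression constant. *)
Require Import Defs.
From HB Require Import structures.
From mathcomp Require Import all_boot all_order all_algebra.
From mathcomp Require Import finmap complex.
From mathcomp Require Import all_classical all_reals all_analysis.
From mathcomp Require Import ring lra.

Set Implicit Arguments.
Unset Strict Implicit.
Unset Printing Implicit Defensive.

Import Order.TTheory GRing.Theory Num.Theory.
Import numFieldNormedType.Exports.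

Local Open Scope classical_set_scope.
Local Open Scope ring_scope.

(** * Discrete groups are of finite type *)

(** The data come with one null set for each group element. For the countable groups [G] and [Gamma]
    these null sets can be united, for [K] they cannot; but points of X^K1 are orbits of an
    uncountable group, so equivariance must hold at every [k] on one invariant conull set. An
    essential value with respect to Haar measure, which is built here from covering numbers,
    provides such a version of [f]. The other obstacle is measurability of images. The measurable
    inverse of [pi] presents the image of a [K]-invariant set as an equalizer of two maps into the
    standard space [Y], and P is cut into countably many pieces on which it is [pi] composed with
    fixed elements of [G] and [Gamma]. In a piece, the [K]-saturation of a [K1]-invariant set is a
    disjoint union of |K0| translates, so that P scales the measure by c1 = |K0| / c(pi). A
    fundamental domain of measure v then satisfies |Ker theta| v = 1 and [Gamma : Im theta] c1 v =
    1. *)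

Section SquareSummable.
Variables (R : realType) (I : choiceType).
Implicit Types (f g h : I -> R[i]) (z w : R[i]).

(** The squared modulus, kept in [R] because the norm of [R[i]] takes its values in [R[i]]. *)
Definition sqrc z : R := complex.Re z ^+ 2 + complex.Im z ^+ 2.

Lemma sqrc_ge0 z : 0 <= sqrc z.
Proof. by rewrite addr_ge0// sqr_ge0. Qed.

Lemma sqrc0 : sqrc 0 = 0.
Proof. by rewrite /sqrc/= expr0n addr0. Qed.

Lemma sqrc_eq0 z : sqrc z = 0 -> z = 0.
Proof.
case: z => x y /eqP; rewrite /sqrc/= paddr_eq0 ?sqr_ge0// !sqrf_eq0.
by move=> /andP[/eqP-> /eqP->].
Qed.

Lemma sqrcM z w : sqrc (z * w) = sqrc z * sqrc w.
Proof. by case: z w => [x y] [u v]; rewrite /sqrc/=; ring. Qed.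

Lemma sqrcN z : sqrc (- z) = sqrc z.
Proof. by case: z => [x y]; rewrite /sqrc/=; ring. Qed.

Lemma sqrc_real (r : R) : sqrc r%:C%C = r ^+ 2.
Proof. by rewrite /sqrc/= expr0n addr0. Qed.

Lemma sqrc_i : sqrc 'i%C = 1.
Proof. by rewrite /sqrc/= expr0n add0r expr1n. Qed.

Lemma sqrc_parallelogram z w :
  sqrc (z + w) + sqrc (z - w) = 2 * sqrc z + 2 * sqrc w.
Proof. by case: z w => [x y] [u v]; rewrite /sqrc/=; ring. Qed.

(** One inequality, applied to [c] and to its inverse, gives both. *)
Lemma ge0_esumZl (c : R) (u : I -> \bar R) :
  0 <= c -> (forall i, 0 <= u i)%E ->
  (\esum_(i in [set: I]) (c%:E * u i) = c%:E * \esum_(i in [set: I]) u i)%E.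
Proof.
have le_esumZ (e : R) (v : I -> \bar R) : 0 <= e -> (forall i, 0 <= v i)%E ->
    (\esum_(i in [set: I]) (e%:E * v i) <= e%:E * \esum_(i in [set: I]) v i)%E.
  move=> e0 v0; apply: ge_ereal_sup => _ [F [finF _] <-].
  rewrite -ge0_mule_fsumr//; apply: lee_wpmul2l; rewrite ?lee_fin//.
  by apply: esum_ge; exists F.
move=> c0 u0; apply/eqP; rewrite eq_le le_esumZ//=.
have [->|c_neq0] := eqVneq c 0.
  by rewrite mul0e esum_ge0// => i _; rewrite mul0e.
have c_gt0 : 0 < c by rewrite lt_neqAle eq_sym c_neq0.
rewrite -lee_pdivlMl//; apply: le_trans (le_esumZ _ _ _ _).
- by apply: le_esum => i _; rewrite muleA -EFinM mulVf// mul1e.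
- by rewrite invr_ge0.
- by move=> i; rewrite mule_ge0.
Qed.

(** * The Hilbert space of square-summable functions *)

Definition esqr f : \bar R := (\esum_(i in [set: I]) (sqrc (f i))%:E)%E.
Arguments esqr f%_R.

Lemma esqr_ge0 f : (0 <= esqr f)%E.
Proof. by apply: esum_ge0 => i _; rewrite lee_fin sqrc_ge0. Qed.

Lemma esqrZ z f : esqr (z *: f) = ((sqrc z)%:E * esqr f)%E.
Proof.
rewrite -ge0_esumZl ?sqrc_ge0//; last by move=> i; rewrite lee_fin sqrc_ge0.
by apply: eq_esum => i _; rewrite -EFinM -sqrcM.
Qed.

(** Every identity between squared norms is derived from a pointwise one through this lemma.
    Extended sums cannot be subtracted, hence two terms on each side and nonnegative weights. *)
Lemma esqrD4 f g h k (a b c e : R) :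
  (forall i, a * sqrc (f i) + b * sqrc (g i) =
             c * sqrc (h i) + e * sqrc (k i)) ->
  0 <= a -> 0 <= b -> 0 <= c -> 0 <= e ->
  (a%:E * esqr f + b%:E * esqr g = c%:E * esqr h + e%:E * esqr k)%E.
Proof.
move=> E a0 b0 c0 e0.
have sq0 u i : (0 <= (sqrc (u i))%:E)%E by rewrite lee_fin sqrc_ge0.
rewrite -!ge0_esumZl//.
rewrite -!esumD => [||||]; do ?by move=> i _; rewrite mule_ge0// lee_fin.
by apply: eq_esum => i _; rewrite -!EFinM -!EFinD E.
Qed.

Definition l2_pred : {pred I -> R[i]} := fun f => (esqr f < +oo)%E.

Lemma l2_submod_closed : submod_closed l2_pred.
Proof.
split=> [|z f g]; rewrite /in_mem/= /l2_pred.
  rewrite [esqr _](_ : _ = 0%E) ?ltry// /esqr esum1// => i _.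
  by rewrite sqrc0.
move=> f2 g2.
(* The parallelogram identity bounds the squared norm of the sum by a finite quantity. *)
have E : (1%:E * esqr (z *: f + g) + 1%:E * esqr (z *: f - g) =
   (2 * sqrc z)%:E * esqr f + 2%:E * esqr g)%E.
  apply: esqrD4 => //; last by rewrite mulr_ge0// sqrc_ge0.
  by move=> i; rewrite !mul1r -mulrA -sqrcM -sqrc_parallelogram.
have : ((2 * sqrc z)%:E * esqr f + 2%:E * esqr g < +oo)%E.
  by rewrite lte_add_pinfty// lte_mul_pinfty// ?lee_fin ?mulr_ge0 ?sqrc_ge0.
by rewrite -E !mul1e; apply: le_lt_trans; rewrite leeDl// esqr_ge0.
Qed.

HB.instance Definition _ :=
  GRing.isSubmodClosed.Build R[i] (I -> R[i]) l2_pred l2_submod_closed.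

Record l2 := L2 { l2fun :> I -> R[i]; _ : l2fun \in l2_pred }.

HB.instance Definition _ := [isSub for l2fun].
HB.instance Definition _ := [Choice of l2 by <:].
HB.instance Definition _ := [SubChoice_isSubLmodule of l2 by <:].

Implicit Types x y u v : l2.

Definition sqn x : R := fine (esqr x).

Lemma sqnE x : (sqn x)%:E = esqr x.
Proof. by rewrite fineK// ge0_fin_numE ?esqr_ge0//; exact: (valP x). Qed.

Lemma sqn_ge0 x : 0 <= sqn x.
Proof. by rewrite fine_ge0// esqr_ge0. Qed.

Lemma sqnZ z x : sqn (z *: x) = sqrc z * sqn x.
Proof. by apply: EFin_inj; rewrite EFinM !sqnE -esqrZ. Qed.

Lemma sqnD4 x y u v (a b c e : R) :
  (forall i, a * sqrc (x i) + b * sqrc (y i) =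
             c * sqrc (u i) + e * sqrc (v i)) ->
  0 <= a -> 0 <= b -> 0 <= c -> 0 <= e ->
  a * sqn x + b * sqn y = c * sqn u + e * sqn v.
Proof.
move=> E a0 b0 c0 e0; apply: EFin_inj; rewrite !EFinD !EFinM !sqnE.
exact: esqrD4.
Qed.

Lemma l2D x y i : (x + y) i = x i + y i. Proof. by []. Qed.
Lemma l2N x i : (- x) i = - x i. Proof. by []. Qed.
Lemma l2Z z x i : (z *: x) i = z * x i. Proof. by []. Qed.
Lemma l2P x y : (forall i, x i = y i) -> x = y.
Proof. by move=> xy; apply/val_inj/funext. Qed.

Lemma sqn_parallelogram x y :
  sqn (x + y) + sqn (x - y) = 2 * sqn x + 2 * sqn y.
Proof.
rewrite -[sqn (x + y)]mul1r -[sqn (x - y)]mul1r; apply: sqnD4 => // i.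
by rewrite !mul1r !l2D l2N sqrc_parallelogram.
Qed.

Lemma sqr_le_sqn x i : sqrc (x i) <= sqn x.
Proof.
rewrite -lee_fin sqnE; apply: esum_ge; exists [set i] => //.
by rewrite fsbig_set1.
Qed.

Lemma sqn_eq0 x : sqn x = 0 -> x = 0.
Proof.
move=> x0; apply: l2P => i; apply: sqrc_eq0; apply/eqP.
by rewrite eq_le sqrc_ge0 -x0 sqr_le_sqn.
Qed.

Lemma sqn0 : sqn 0 = 0.
Proof. by rewrite -(scale0r (0 : l2)) sqnZ sqrc0 mul0r. Qed.

Lemma sqnN x : sqn (- x) = sqn x.
Proof. by rewrite -scaleN1r sqnZ sqrcN /sqrc/= expr1n expr0n addr0 mul1r. Qed.

(** The real part of the inner product, by polarization: the only sums taken are those of squared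
    moduli. *)
Definition rip x y : R := (sqn (x + y) - sqn (x - y)) / 4.

Lemma ripC x y : rip x y = rip y x.
Proof. by rewrite /rip (addrC y) -(opprB x y) sqnN. Qed.

Lemma ripxx x : rip x x = sqn x.
Proof.
rewrite /rip subrr sqn0 subr0 -mulr2n -scaler_nat sqnZ.
rewrite -(rmorph_nat (real_complex R)) sqrc_real.
by field.
Qed.

(** The argument of Jordan and von Neumann: additivity is a linear combination of four parallelogram
    identities. *)
Lemma ripDl x y u : rip (x + y) u = rip x u + rip y u.
Proof.
have := sqn_parallelogram (x + u) y; have := sqn_parallelogram (y + u) x.
have := sqn_parallelogram (x - u) y; have := sqn_parallelogram (y - u) x.
have -> : y - u + x = x + y - u by rewrite addrAC (addrC y).
have -> : x - u + y = x + y - u by rewrite addrAC.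
have -> : y + u + x = x + y + u by rewrite addrAC (addrC y).
have -> : x + u + y = x + y + u by rewrite addrAC.
have -> : x - u - y = - (y + u - x) by rewrite opprB opprD addrA addrAC.
have -> : y - u - x = - (x + u - y) by rewrite opprB opprD addrA addrAC.
by rewrite !sqnN /rip; lra.
Qed.

Lemma ripDr x y u : rip u (x + y) = rip u x + rip u y.
Proof. by rewrite !(ripC u) ripDl. Qed.

Lemma ripNl x u : rip (- x) u = - rip x u.
Proof.
rewrite /rip -opprD sqnN -(sqnN (- x + u)) opprD opprK -mulNr.
by congr (_ / _); rewrite opprB.
Qed.

Lemma ripNr x u : rip u (- x) = - rip u x.
Proof. by rewrite !(ripC u) ripNl. Qed.

(** With weights [1] and [r] the cross terms cancel at every coordinate. The sign of [r] is settled
    beforehand because [sqnD4] takes nonnegative weights. *)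
Lemma ripZl (r : R) x u : rip (r%:C%C *: x) u = r * rip x u.
Proof.
wlog r0 : r / 0 <= r => [H|].
  have [/H//|/ltW r0] := leP 0 r.
  have := H (- r); rewrite oppr_ge0 => /(_ r0).
  by rewrite rmorphN/= scaleNr ripNl mulNr => /oppr_inj.
suff : 1 * sqn (r%:C%C *: x + u) + r * sqn (x - u) =
       1 * sqn (r%:C%C *: x - u) + r * sqn (x + u) by rewrite /rip; lra.
apply: sqnD4 => // i; rewrite !l2D !l2N l2Z.
by case: (x i) (u i) => [a b] [c e]; rewrite /sqrc/=; ring.
Qed.

Lemma rip0l u : rip 0 u = 0.
Proof. by rewrite /rip add0r sub0r sqnN subrr mul0r. Qed.

Lemma rip_CS x y : rip x y ^+ 2 <= sqn x * sqn y.
Proof.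
have [y0|y0] := eqVneq (sqn y) 0.
  by rewrite (sqn_eq0 y0) ripC rip0l expr0n/= mulr_ge0// sqn_ge0.
have yp : 0 < sqn y by rewrite lt_neqAle eq_sym y0 sqn_ge0.
have := sqn_ge0 (x - (rip x y / sqn y)%:C%C *: y).
rewrite -ripxx ripDl !ripDr !ripNl !ripNr !ripZl (ripC _ (_ *: _)) ripZl !ripxx.
rewrite opprK (ripC y (_ *: _)) ripZl (ripC y x) ripxx => H.
have {H} : 0 <= sqn x - rip x y / sqn y * rip x y.
  by apply: le_trans H _; rewrite le_eqVlt; apply/orP; left; apply/eqP; field.
move=> /mulr_ge0 /(_ (sqn_ge0 y)).
by rewrite mulrBl subr_ge0 (mulrAC (rip x y / _)) divfK// expr2.
Qed.

Lemma rip_i x y : rip ('i%C *: x) ('i%C *: y) = rip x y.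
Proof. by rewrite /rip -scalerBr -scalerDr !sqnZ sqrc_i !mul1r. Qed.

Lemma rip_il x y : rip ('i%C *: x) y = - rip x ('i%C *: y).
Proof.
by rewrite -[in RHS]rip_i scalerA -expr2 sqr_i scaleN1r ripNr opprK.
Qed.

Definition l2norm x : R[i] := (Num.sqrt (sqn x))%:C%C.

Lemma sqr_l2norm x : l2norm x ^+ 2 = (sqn x)%:C%C.
Proof. by rewrite -rmorphXn/= sqr_sqrtr// sqn_ge0. Qed.

Let l2normD x y : l2norm (x + y) <= l2norm x + l2norm y.
Proof.
rewrite -rmorphD/= lecR -[leRHS]ger0_norm ?addr_ge0 ?sqrtr_ge0//.
rewrite -sqrtr_sqr ler_wsqrtr// sqrrD !sqr_sqrtr ?sqn_ge0//.
rewrite -ripxx ripDl !ripDr !ripxx (ripC y x).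
suff : rip x y <= Num.sqrt (sqn x) * Num.sqrt (sqn y) by lra.
rewrite -sqrtrM ?sqn_ge0//; apply: le_trans (ler_norm _) _.
by rewrite -sqrtr_sqr ler_wsqrtr// rip_CS.
Qed.

Let l2normZ z x : l2norm (z *: x) = `|z| * l2norm x.
Proof.
rewrite /l2norm sqnZ sqrtrM ?sqrc_ge0// rmorphM/=; congr (_ * _).
by case: z => a b; rewrite normc_def.
Qed.

Let l2norm_eq0 x : l2norm x = 0 -> x = 0.
Proof.
move=> /(congr1 (fun z => z ^+ 2)); rewrite sqr_l2norm expr0n/=.
by move=> /eqP; rewrite eq_complex/= eqxx andbT => /eqP/sqn_eq0.
Qed.

HB.instance Definition _ :=
  Lmodule_isNormed.Build R[i] l2 l2normD l2normZ l2norm_eq0.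

Lemma l2norm_ltE x (r : R) : 0 <= r -> (`|x| < r%:C%C) = (sqn x < r ^+ 2).
Proof.
move=> r0; rewrite ltcR -(ltr_pXn2r (_ : 0 < 2)%N)// ?nnegrE ?sqrtr_ge0//.
by rewrite sqr_sqrtr// sqn_ge0.
Qed.

Lemma gt0_complexE (e : R[i]) : 0 < e -> exists2 r : R, 0 < r & e = r%:C%C.
Proof.
by case: e => a b; rewrite ltcE/= => /andP[/eqP -> a0]; exists a.
Qed.

Let l2_cauchy_cvg (F : set_system l2) : ProperFilter F -> cauchy F -> cvg F.
Proof.
move=> FF /cauchy_ballP Fc.
have {}Fc (r : R) : 0 < r -> exists2 A, F A &
    forall x y, A x -> A y -> sqn (x - y) < r ^+ 2.
  move=> r0; have /Fc[[A B]/= [FA FB] AB] : 0 < r%:C%C :> R[i] by rewrite ltcR.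
  exists (A `&` B); first exact: filterI.
  move=> x y [Ax _] [_ By]; have := AB (x, y) (conj Ax By).
  by rewrite -ball_normE/= l2norm_ltE// ltW.
have coord_cvg (c : R[i] -> R) i : (forall z w, c (z - w) = c z - c w) ->
    (forall z, c z ^+ 2 <= sqrc z) -> cvg ((fun x : l2 => c (x i)) @ F).
  move=> cB cle; apply: R_complete; apply/cauchy_ballP => _/posnumP[e].
  have [A FA AP] := Fc e%:num (gt0 e).
  exists ((fun x : l2 => c (x i)) @` A, (fun x : l2 => c (x i)) @` A).
    by split; apply: (@filterS _ F _ A) => // x Ax; exists x.
  move=> [_ _] [/= [x Ax <-] [y Ay <-]]; rewrite -ball_normE/=.
  rewrite -(ltr_pXn2r (_ : 0 < 2)%N)// ?nnegrE// real_normK ?num_real//.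
  apply: le_lt_trans (AP _ _ Ax Ay); rewrite -cB.
  exact: le_trans (cle _) (sqr_le_sqn (x - y) i).
have cRe i : cvg ((fun x : l2 => complex.Re (x i)) @ F).
  apply: coord_cvg => [[a b] [a' b']//|[a b]].
  by rewrite /sqrc/= lerDl sqr_ge0.
have cIm i : cvg ((fun x : l2 => complex.Im (x i)) @ F).
  apply: coord_cvg => [[a b] [a' b']//|[a b]].
  by rewrite /sqrc/= lerDr sqr_ge0.
pose f i : R[i] := (lim ((fun x : l2 => complex.Re (x i)) @ F)
  +i* lim ((fun x : l2 => complex.Im (x i)) @ F))%C.
(* A lemma of Fatou type: the bound passes to the limit on each finite set of coordinates, and
   [esqr] is the supremum over these sets. *)
have key (r : R) (A : set l2) (g : l2) : 0 < r -> F A ->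
    (forall x y, A x -> A y -> sqn (x - y) < r ^+ 2) -> A g ->
    (esqr (l2fun g - f) <= (r ^+ 2)%:E)%E.
  move=> r0 FA AP Ag; apply: ge_ereal_sup => _ [J [finJ _] <-].
  rewrite fsbig_finite//= sumEFin lee_fin.
  have cv : (fun x : l2 => \sum_(i <- fset_set J) sqrc (g i - x i)) @ F -->
      \sum_(i <- fset_set J) sqrc ((l2fun g - f) i).
    apply: cvg_big => [|i _]; first exact: add_continuous.
    have E (x : l2) : sqrc (g i - x i) =
        (complex.Re (g i) - complex.Re (x i)) *
          (complex.Re (g i) - complex.Re (x i)) +
        (complex.Im (g i) - complex.Im (x i)) *
          (complex.Im (g i) - complex.Im (x i)).
      by case: (g i) (x i) => [a b] [a' b']; rewrite /sqrc/=; ring.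
    under eq_cvg do rewrite E.
    have -> : sqrc ((l2fun g - f) i) =
        (complex.Re (g i) - complex.Re (f i)) *
          (complex.Re (g i) - complex.Re (f i)) +
        (complex.Im (g i) - complex.Im (f i)) *
          (complex.Im (g i) - complex.Im (f i)).
      rewrite [(_ - f) i](_ : _ = g i - f i)//.
      by case: (g i) (f i) => [a b] [a' b']; rewrite /sqrc/=; ring.
    by apply: cvgD; apply: cvgM; apply: cvgB; [exact: cvg_cst|exact: cRe|
      exact: cvg_cst|exact: cRe|exact: cvg_cst|exact: cIm|exact: cvg_cst|
      exact: cIm].
  apply: (closed_cvg (fun t : R => t <= r ^+ 2)) cv => //.
  apply: filterS FA => x Ax /=; apply: le_trans (ltW (AP _ _ Ag Ax)).
  rewrite -lee_fin sqnE -sumEFin -fsbig_finite//; apply: esum_ge.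
  by exists J.
have [A FA AP] := Fc 1 ltr01.
have [g Ag] := filter_ex FA.
have f2 : f \in l2_pred.
  rewrite -[f](subKr (l2fun g)); apply: rpredB; first exact: (valP g).
  by apply: le_lt_trans (key _ _ _ _ FA AP Ag) _; rewrite ?ltry.
apply/cvg_ex; exists (L2 f2); apply/cvg_ballP => e /gt0_complexE[r r0 ->].
(* Half of the radius, since [key] only yields a weak inequality. *)
have r20 : 0 < r / 2 by rewrite divr_gt0.
have [A' FA' AP'] := Fc _ r20.
apply: filterS (FA') => x A'x; rewrite -ball_normE/= distrC l2norm_ltE ?ltW//.
apply: (@le_lt_trans _ _ ((r / 2) ^+ 2)); last first.
  by rewrite ltr_pXn2r ?nnegrE ?ltW// ltr_pdivrMr// ltr_pMr// ltr1n.
by rewrite -lee_fin sqnE; exact: key r20 FA' AP' A'x.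
Qed.

HB.instance Definition _ := Uniform_isComplete.Build l2 l2_cauchy_cvg.

(** The product is linear on the left, so multiplying [y] by i multiplies it by -i, and Re(-i z) =
    Im z gives the imaginary part. *)
Definition ip x y : R[i] := (rip x y +i* rip x ('i%C *: y))%C.

Lemma ipDl x y u : ip (x + y) u = ip x u + ip y u.
Proof. by rewrite /ip !ripDl. Qed.

Lemma ipZl z x u : ip (z *: x) u = z * ip x u.
Proof.
have -> : z *: x = (complex.Re z)%:C%C *: x + (complex.Im z)%:C%C *: ('i%C *: x).
  by rewrite scalerA -scalerDl; case: z => a b; congr (_ *: _);
    apply/eqP; rewrite eq_complex/=; apply/andP; split; apply/eqP; ring.
rewrite ipDl /ip !ripZl rip_il rip_i.
by case: z => a b; apply/eqP; rewrite eq_complex/=; apply/andP; split;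
  apply/eqP; ring.
Qed.

Lemma ipC x y : ip y x = (ip x y)^*.
Proof.
apply/eqP; rewrite eq_complex/= /ip/= ripC eqxx/=.
by rewrite ripC rip_il.
Qed.

Lemma ipxx x : ip x x = (sqn x)%:C%C.
Proof.
apply/eqP; rewrite eq_complex/= ripxx eqxx/=; apply/eqP.
have := rip_il x x; rewrite ripC; lra.
Qed.

Lemma ip_inner_product : inner_product ip.
Proof.
split=> [c x y z|x y|x]; first by rewrite ipDl ipZl.
- exact: ipC.
- by rewrite ipxx -sqr_l2norm.
Qed.

Lemma ipDr x y u : ip u (x + y) = ip u x + ip u y.
Proof. by rewrite ipC ipDl rmorphD/= -!ipC. Qed.

Lemma ipZr z x u : ip u (z *: x) = z^* * ip u x.
Proof. by rewrite ipC ipZl rmorphM/= -!ipC. Qed.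

Lemma ip0r u : ip u 0 = 0.
Proof. by rewrite -(scale0r (0 : l2)) ipZr rmorph0 mul0r. Qed.

Lemma ip0l u : ip 0 u = 0.
Proof. by rewrite -(scale0r (0 : l2)) ipZl mul0r. Qed.

Fact delta_l2 s : (fun i => (i == s)%:R : R[i]) \in l2_pred.
Proof.
rewrite /in_mem/= /l2_pred /esqr.
rewrite (esumID [set s]); last by move=> i _; rewrite lee_fin sqrc_ge0.
rewrite [X in (_ + X)%E]esum1 ?adde0; last first.
  move=> i [_ /=/eqP/negbTE ->].
  by rewrite sqrc0.
by rewrite setTI esum_set1 ?ltry// lee_fin; exact: sqrc_ge0.
Qed.

Definition delta s : l2 := L2 (delta_l2 s).

Lemma deltaE s i : delta s i = (i == s)%:R. Proof. by []. Qed.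

Lemma sqn_delta s : sqn (delta s) = 1.
Proof.
apply: EFin_inj; rewrite sqnE /esqr (esumID [set s])//; last first.
  by move=> i _; rewrite lee_fin sqrc_ge0.
rewrite [X in (_ + X)%E]esum1 ?adde0; last first.
  by move=> i [_ /=/eqP/negbTE ->]; rewrite sqrc0.
rewrite setTI esum_set1 ?lee_fin ?sqrc_ge0//= eqxx.
by rewrite (sqrc_real 1) expr1n.
Qed.

(** The weights [(1 - t) ^+ 2] and [(1 + t) ^+ 2] balance the coordinate [s]; at the other
    coordinates [delta s] vanishes. *)
Lemma rip_delta x s : rip x (delta s) = complex.Re (x s).
Proof.
set t := complex.Re _.
have : 1 * sqn (x + delta s) + (1 - t) ^+ 2 * sqn (delta s) =
       1 * sqn (x - delta s) + (1 + t) ^+ 2 * sqn (delta s).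
  apply: sqnD4; rewrite ?sqr_ge0// => i; rewrite !l2D l2N deltaE.
  have [->|_] := eqVneq i s; last by rewrite sqrc0 oppr0 addr0 !mulr0.
  by rewrite /t; case: (x s) => a b; rewrite /sqrc/=; ring.
rewrite /rip sqn_delta; move: (sqn _) (sqn _) => A B; lra.
Qed.

Lemma ip_delta x s : ip x (delta s) = x s.
Proof.
rewrite /ip rip_delta -[rip x _]opprK -rip_il rip_delta l2Z.
by case: (x s) => a b; rewrite /=; congr (_ +i* _)%C; ring.
Qed.

Lemma l2_sumE (J : seq I) (F : I -> l2) i :
  (\sum_(j <- J) F j) i = \sum_(j <- J) F j i.
Proof. exact: (big_morph (fun x : l2 => x i)). Qed.

Lemma sum_deltaE (J : {fset I}) (c : I -> R[i]) i :
  (\sum_(j <- J) c j *: delta j) i = if i \in J then c i else 0.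
Proof.
rewrite l2_sumE; case: ifPn => iJ.
  rewrite (big_fsetD1 i iJ) l2Z deltaE eqxx mulr1 big_seq big1 => [|j].
    exact: addr0.
  by rewrite !inE => /andP[ji _]; rewrite l2Z deltaE eq_sym (negbTE ji) mulr0.
rewrite big_seq big1// => j jJ; rewrite l2Z deltaE.
by case: eqP => [ij|_]; [rewrite ij jJ in iJ|rewrite mulr0].
Qed.

Lemma l2_finite_approx x (e : R) : 0 < e ->
  exists J : seq I, sqn (x - \sum_(j <- J) x j *: delta j) < e.
Proof.
move=> e0.
have : ((sqn x - e)%:E < esqr x)%E by rewrite -sqnE lte_fin ltrBlDr ltrDl.
move=> /ereal_sup_gt[_ [J [finJ _] <-]].
rewrite fsbig_finite// sumEFin lte_fin => xJ; exists (fset_set J).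
set y := \sum_(j <- _) _.
have yE i : y i = if i \in fset_set J then x i else 0 by exact: sum_deltaE.
have : 1 * sqn (x - y) + 1 * sqn y = 1 * sqn x + 0 * sqn x.
  apply: sqnD4 => // i; rewrite l2D l2N yE; case: ifP => _.
    by rewrite subrr sqrc0; ring.
  by rewrite subr0 sqrc0; ring.
have : sqn y >= \sum_(i <- fset_set J) sqrc (x i).
  rewrite -lee_fin sqnE -sumEFin -fsbig_finite//; apply: esum_ge.
  exists J => //; rewrite !fsbig_finite//= big_seq [leRHS]big_seq.
  by under [leRHS]eq_bigr => j jJ do rewrite yE jJ.
by move: (sqn y) (sqn (x - y)) xJ => a b; lra.
Qed.

Section LinearMaps.
Variable T : l2 -> l2.
Hypothesis Tlin : linear T.

Lemma lin0 : T 0 = 0.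
Proof.
by have := Tlin (- 1) 0 0; rewrite scaleN1r oppr0 addr0 => ->;
  rewrite scaleN1r addNr.
Qed.

Lemma linD x y : T (x + y) = T x + T y.
Proof. by have := Tlin 1 x y; rewrite !scale1r. Qed.

Lemma linZ z x : T (z *: x) = z *: T x.
Proof. by have := Tlin z x 0; rewrite lin0 !addr0. Qed.

Lemma linB x y : T (x - y) = T x - T y.
Proof. by rewrite linD -scaleN1r linZ scaleN1r. Qed.

Lemma lin_sum (J : seq I) (F : I -> l2) :
  T (\sum_(j <- J) F j) = \sum_(j <- J) T (F j).
Proof. exact: (big_morph _ linD lin0). Qed.

End LinearMaps.

Lemma bounded_operator_sqn (T : l2 -> l2) : bounded_operator T ->
  exists2 C : R, 0 <= C & forall x, sqn (T x) <= C * sqn x.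
Proof.
move=> [Tlin Tc].
have T0 := lin0 Tlin.
have /cvgrPdist_lt/(_ 1 ltr01) := Tc 0; rewrite T0.
move=> /nbhs_ballP[_ /gt0_complexE[r r0 ->] rT].
(* On the ball of radius [r] the image has norm less than 1; rescaling vectors to norm [r / 2] gives
   this constant for squared norms. *)
exists (4 / r ^+ 2); first by rewrite divr_ge0// exprn_ge0// ltW.
move=> x; have [/sqn_eq0 ->|x0] := eqVneq (sqn x) 0.
  by rewrite T0 sqn0 mulr0.
have {x0}xp : 0 < sqn x by rewrite lt_neqAle eq_sym x0 sqn_ge0.
have sp : 0 < Num.sqrt (sqn x) by rewrite sqrtr_gt0.
have /rT : ball (0 : l2) r%:C%C ((r / 2 / Num.sqrt (sqn x))%:C%C *: x).
  rewrite -ball_normE/= sub0r normrN l2norm_ltE ?ltW// sqnZ sqrc_real.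
  rewrite exprMn exprVn sqr_sqrtr ?ltW// divfK ?gt_eqF//.
  by rewrite ltr_pXn2r ?nnegrE ?ltW ?divr_gt0// ltr_pdivrMr// ltr_pMr// ltr1n.
rewrite /= sub0r normrN (linZ Tlin) (l2norm_ltE _ ler01) sqnZ sqrc_real expr1n.
rewrite exprMn exprVn (sqr_sqrtr (ltW xp)) mulrAC ltr_pdivrMr// mul1r => H.
have -> : 4 / r ^+ 2 * sqn x = sqn x / (r / 2) ^+ 2 by field; rewrite gt_eqF.
by rewrite ler_pdivlMr ?exprn_gt0 ?divr_gt0// mulrC ltW.
Qed.

Lemma bounded_operatorP (T : l2 -> l2) (C : R) : linear T -> 0 <= C ->
  (forall x, sqn (T x) <= C * sqn x) -> bounded_operator T.
Proof.
move=> Tlin C0 TC; split=> // x.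
apply/(@cvgrPdist_lt _ _ _ (nbhs (x : l2))) => e /gt0_complexE[r r0 ->].
have s0 : 0 < Num.sqrt (C + 1) by rewrite sqrtr_gt0 ltr_wpDl.
apply/nbhs_ballP; exists (r / Num.sqrt (C + 1))%:C%C => /=.
  by rewrite ltcR divr_gt0.
move=> y; rewrite -ball_normE/= -(linB Tlin) !l2norm_ltE ?divr_ge0 ?(ltW r0) ?(ltW s0)//.
rewrite exprMn exprVn sqr_sqrtr ?addr_ge0// ltr_pdivlMr ?ltr_wpDl// => H.
apply: le_lt_trans (TC _) _; apply: le_lt_trans H.
by rewrite mulrC ler_wpM2l ?sqn_ge0// lerDl.
Qed.

Lemma linear_of (T : l2 -> l2) : bounded_operator T -> linear T.
Proof. by case. Qed.

(* It suffices to compare S and T on a dense set: the finite linear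
   combinations of the delta s. *)
Lemma bounded_operator_ext S T : bounded_operator S -> bounded_operator T ->
  (forall s, S (delta s) = T (delta s)) -> S = T.
Proof.
move=> bS bT ST; apply/funext => x; apply/eqP; rewrite -subr_eq0; apply/eqP.
apply: sqn_eq0; apply/eqP; rewrite eq_le sqn_ge0 andbT; apply/ler_addgt0Pl => e e0.
have [C C0 SC] := bounded_operator_sqn bS.
have [D D0 TD] := bounded_operator_sqn bT.
(* By the parallelogram identity the difference of the operators has squared bound [2 * C + 2 * D];
   the summand 1 makes the divisor positive. *)
have Dp : 0 < 2 * C + 2 * D + 1 by rewrite ltr_wpDl// addr_ge0 ?mulr_ge0.
have [J Je] := l2_finite_approx x (divr_gt0 e0 Dp).
set y := \sum_(j <- J) _ in Je.
have STy : S y = T y.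
  rewrite (lin_sum (linear_of bS)) (lin_sum (linear_of bT)).
  apply: eq_bigr => j _.
  by rewrite (linZ (linear_of bS)) (linZ (linear_of bT)) ST.
have -> : S x - T x = S (x - y) - T (x - y).
  rewrite (linB (linear_of bS)) (linB (linear_of bT)) STy.
  by rewrite opprB addrA subrK.
rewrite addr0.
have := sqn_parallelogram (S (x - y)) (T (x - y)).
have := sqn_ge0 (S (x - y) + T (x - y)).
move: (SC (x - y)) (TD (x - y)); rewrite ltr_pdivlMr// in Je.
move: (sqn_ge0 (x - y)) Je.
move: (sqn _) (sqn _) (sqn _) (sqn _) (sqn _) => q a b p m q0 Je qa qb p0 E.
nra.
Qed.

(** Cauchy-Schwarz for the real and the imaginary parts separately, whence the factor 2. *)
Lemma sqrc_ip_le x y : sqrc (ip x y) <= 2 * (sqn x * sqn y).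
Proof.
have := rip_CS x y; have := rip_CS x ('i%C *: y).
by rewrite sqnZ sqrc_i mul1r /sqrc/ip/=; lra.
Qed.

Lemma ip_ext T (y w : l2) : bounded_operator T ->
  (forall s, ip (T (delta s)) y = ip (delta s) w) ->
  forall x, ip (T x) y = ip x w.
Proof.
move=> bT Tyw x; have [->|x0] := eqVneq x 0.
  by rewrite (lin0 (linear_of bT)) !ip0l.
(* Multiplying a functional by the fixed nonzero vector [x] turns it into an operator of rank one,
   to which [bounded_operator_ext] applies. *)
have rank1 (A : l2 -> l2) (u : l2) : bounded_operator A ->
    bounded_operator (fun z : l2 => ip (A z) u *: x).
  move=> bA; have [C C0 AC] := bounded_operator_sqn bA.
  apply: (@bounded_operatorP _ (2 * C * sqn u * sqn x)).
  - move=> a z1 z2 /=; rewrite (linD (linear_of bA)) (linZ (linear_of bA)).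
    by rewrite ipDl ipZl scalerDl scalerA.
  - by rewrite !mulr_ge0// sqn_ge0.
  - move=> z; rewrite sqnZ.
    apply: (@le_trans _ _ (2 * (C * sqn z * sqn u) * sqn x)).
      rewrite ler_wpM2r ?sqn_ge0//; apply: le_trans (sqrc_ip_le _ _) _.
      by rewrite ler_wpM2l// ler_wpM2r ?sqn_ge0.
    by rewrite le_eqVlt; apply/orP; left; apply/eqP; ring.
have bid : bounded_operator (@id l2).
  by apply: (@bounded_operatorP _ 1) => // z; rewrite mul1r.
have /(congr1 (fun f : l2 -> l2 => f x))/eqP := bounded_operator_ext (rank1 T y bT)
  (rank1 id w bid) (fun s => congr1 (fun a : R[i] => a *: x) (Tyw s)).
by rewrite -subr_eq0 -scalerBl scaler_eq0 (negbTE x0) orbF subr_eq0 => /eqP.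
Qed.

Lemma ip_sumDl (J : seq I) (F : I -> l2) y :
  ip (\sum_(j <- J) F j) y = \sum_(j <- J) ip (F j) y.
Proof.
exact: (big_morph (fun x => ip x y) (fun a b => ipDl a b y) (ip0l y)).
Qed.

Lemma ip_sumDr (J : seq I) (F : I -> l2) y :
  ip y (\sum_(j <- J) F j) = \sum_(j <- J) ip y (F j).
Proof.
exact: (big_morph (fun x => ip y x) (fun a b => ipDr a b y) (ip0r y)).
Qed.

(** The test vector [z] with coordinates [c j] satisfies <y, T z> = |z|^2; Cauchy-Schwarz and the
    bound on [T] then bound |z|^2, which is the sum. *)
Lemma sum_sqrc_ip_le T (C : R) y (J : {fset I}) : linear T -> 0 <= C ->
  (forall x, sqn (T x) <= C * sqn x) ->
  \sum_(j <- J) sqrc (ip y (T (delta j))) <= C * sqn y.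
Proof.
move=> Tlin C0 TC; pose c j := ip y (T (delta j)).
pose z := \sum_(j <- J) c j *: delta j.
have zE j : j \in J -> z j = c j by move=> jJ; rewrite /z sum_deltaE jJ.
have normE w : w * w^* = (sqrc w)%:C%C.
  by case: w => p q; apply/eqP; rewrite eq_complex/=; apply/andP; split;
    apply/eqP; rewrite /sqrc/=; ring.
have z2 : sqn z = \sum_(j <- J) sqrc (c j).
  apply: (@complexI R); rewrite -ipxx {1}/z ip_sumDl rmorph_sum/=.
  rewrite big_seq [RHS]big_seq; apply: eq_bigr => j jJ.
  by rewrite ipZl ipC ip_delta zE// normE.
have yTz : rip y (T z) = sqn z.
  have : ip y (T z) = (sqn z)%:C%C.
    rewrite z2 (lin_sum Tlin) ip_sumDr rmorph_sum/=; apply: eq_bigr => j _.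
    by rewrite (linZ Tlin) ipZr mulrC normE.
  by move=> /(congr1 (@complex.Re R)).
rewrite -z2; have := rip_CS y (T z); rewrite yTz => H.
have {}H : sqn z ^+ 2 <= sqn y * (C * sqn z).
  by apply: le_trans H _; rewrite ler_wpM2l// sqn_ge0.
have [->|z0] := eqVneq (sqn z) 0; first by rewrite mulr_ge0// sqn_ge0.
have zp : 0 < sqn z by rewrite lt_neqAle eq_sym z0 sqn_ge0.
by rewrite expr2 mulrA ler_pM2r// mulrC in H.
Qed.

(** The coordinates of [S y] are forced to be [ip y (T (delta j))], and [sum_sqrc_ip_le] makes them
    square-summable. *)
Lemma adjoint_exists T : bounded_operator T ->
  exists2 S, bounded_operator S & adjoint_of ip T S.
Proof.
move=> bT; have [C C0 TC] := bounded_operator_sqn bT.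
have sle y : (esqr (fun j => ip y (T (delta j))) <= (C * sqn y)%:E)%E.
  apply: ge_ereal_sup => _ [J [finJ _] <-].
  rewrite fsbig_finite// sumEFin lee_fin.
  exact: sum_sqrc_ip_le (linear_of bT) C0 TC.
have s2 y : (fun j => ip y (T (delta j))) \in l2_pred.
  by apply: le_lt_trans (sle y) _; rewrite ltry.
pose S y := L2 (s2 y).
have bS : bounded_operator S.
  apply: (@bounded_operatorP _ C) => //.
    by move=> z x y; apply: l2P => i; rewrite l2D l2Z /= ipDl ipZl.
  by move=> y; rewrite -lee_fin sqnE; exact: sle.
exists S => // x y; apply: ip_ext => // s.
by rewrite ipC [RHS]ipC ip_delta.
Qed.

End SquareSummable.

Arguments delta {R I}.
Arguments ip {R I}.

(** * Commutants *)

Section Commutant.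
Variables (C : numClosedFieldType) (H : completeNormedModType C).
Implicit Types M N : set (H -> H).

Lemma commutant_subset M N : M `<=` N -> commutant N `<=` commutant M.
Proof. by move=> MN T [bT TN]; split=> // S /MN; exact: TN. Qed.

Lemma subset_commutant2 M : M `<=` @bounded_operator C H ->
  M `<=` commutant (commutant M).
Proof.
move=> Mb T MT; split; first exact: Mb.
by move=> S [_ /(_ _ MT)].
Qed.

(** Taking commutants reverses inclusions and [M] lies in its bicommutant; this is what makes
    [group_vN] below equal to its own bicommutant. *)
Lemma commutant3 M : M `<=` @bounded_operator C H ->
  commutant (commutant (commutant M)) = commutant M.
Proof.
move=> Mb; apply/seteqP; split; first exact/commutant_subset/subset_commutant2.
by apply: subset_commutant2 => T [].
Qed.

End Commutant.

Section Series.
Variable C : numClosedFieldType.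
Implicit Type u : nat -> C.

Lemma series_tail u (e : C) : cvgn (series u) -> 0 < e ->
  exists N, forall m, (N <= m)%N -> `|\sum_(N <= i < m) u i| < e.
Proof.
move=> cu e0; have e20 : 0 < e / 2 by rewrite divr_gt0.
have [N _ NP] : \forall n \near \oo,
    `|lim (series u @ \oo) - series u n| < e / 2.
  by move/cvgrPdist_lt : cu => /(_ _ e20).
exists N => m Nm; rewrite -sub_series_geq//.
have := NP N (leqnn N); have := NP m Nm; rewrite /= => H1 H2.
rewrite [e]splitr; apply: le_lt_trans (ltrD H1 H2).
by rewrite (distrC _ (series u m)); exact: ler_distD.
Qed.

Lemma cvg_seriesD (u v : nat -> C) : cvgn (series u) -> cvgn (series v) ->
  cvgn (series (u + v)).
Proof. by move=> cu cv; rewrite seriesD; exact: is_cvgD. Qed.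

Lemma eventually0_series u N : (forall n, (N <= n)%N -> u n = 0) ->
  series u @ \oo --> series u N.
Proof.
move=> uN; apply: cvg_near_cst; exists N => // n /= Nn.
apply/eqP; rewrite -subr_eq0 sub_series_geq// big_nat_cond big1// => i.
by rewrite andbT => /andP[/uN].
Qed.

Lemma eventually0_cvg_series u N : (forall n, (N <= n)%N -> u n = 0) ->
  cvgn (series u).
Proof. by move=> /eventually0_series cu; apply/cvg_ex; eexists; exact: cu. Qed.

End Series.

(** * The group von Neumann algebra on l^2(Gamma) *)

Section LeftRegular.
Variables (R : realType) (Gamma : groupType).
Local Notation H := (l2 R Gamma).
Local Notation delta := (@delta R Gamma).
Implicit Types (x y : H) (g h s t : Gamma).

Section Permutation.
Variables (p q : Gamma -> Gamma).
Hypotheses (pK : cancel p q) (qK : cancel q p).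

Lemma esqr_perm (f : Gamma -> R[i]) : esqr (f \o p) = esqr f.
Proof.
rewrite /esqr [RHS](reindex_esum [set: Gamma] [set: Gamma] p)//; split.
- by [].
- by move=> s t _ _ /(can_inj pK).
- by move=> s _; exists (q s).
Qed.

Lemma perm_l2_subproof x : (x \o p) \in @l2_pred R Gamma.
Proof. by rewrite /in_mem/= /l2_pred esqr_perm; exact: (valP x). Qed.

Definition perm_l2 x : H := L2 (perm_l2_subproof x).

Lemma perm_l2E x s : perm_l2 x s = x (p s). Proof. by []. Qed.

Lemma perm_l2_linear : linear perm_l2.
Proof. by move=> a x y; apply: l2P => i. Qed.

Lemma sqn_perm x : sqn (perm_l2 x) = sqn x.
Proof. by congr fine; exact: esqr_perm. Qed.

Lemma rip_perm x y : rip (perm_l2 x) (perm_l2 y) = rip x y.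
Proof.
by rewrite /rip -(linD perm_l2_linear) -(linB perm_l2_linear) !sqn_perm.
Qed.

Lemma ip_perm x y : ip (perm_l2 x) (perm_l2 y) = ip x y.
Proof. by rewrite /ip -(linZ perm_l2_linear) !rip_perm. Qed.

Lemma perm_delta s : perm_l2 (delta s) = delta (q s).
Proof. by apply: l2P => i; rewrite !deltaE /= (can2_eq pK qK). Qed.

Lemma bounded_perm : bounded_operator perm_l2.
Proof.
apply: (@bounded_operatorP _ _ _ 1) => //; first exact: perm_l2_linear.
by move=> x; rewrite sqn_perm mul1r.
Qed.

End Permutation.

Definition lreg g : H -> H := perm_l2 (mulVKg g) (mulKg g).
Definition rreg g : H -> H := perm_l2 (mulgK g) (mulgVK g).

Lemma lregE g x s : lreg g x s = x (g^-1 * s)%g. Proof. by []. Qed.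
Lemma rregE g x s : rreg g x s = x (s * g)%g. Proof. by []. Qed.

Lemma lreg_delta g s : lreg g (delta s) = delta (g * s)%g.
Proof. exact: perm_delta. Qed.

Lemma rreg_delta g s : rreg g (delta s) = delta (s * g^-1)%g.
Proof. exact: perm_delta. Qed.

Lemma lregM g h : lreg (g * h)%g = lreg g \o lreg h.
Proof. by apply/funext => x; apply: l2P => s; rewrite /comp !lregE invgM mulgA. Qed.

Lemma lreg1 : lreg 1%g = id.
Proof. by apply/funext => x; apply: l2P => s; rewrite lregE invg1 mul1g. Qed.

Lemma rregK g : cancel (rreg g) (rreg g^-1%g).
Proof. by move=> x; apply: l2P => s; rewrite !rregE mulgVK. Qed.

Lemma ip_rreg g x y : ip (rreg g x) y = ip x (rreg g^-1%g y).
Proof.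
by rewrite -[y in LHS](rregK g^-1%g) invgK ip_perm.
Qed.

Lemma ip_lreg g x y : ip (lreg g x) y = ip x (lreg g^-1%g y).
Proof.
rewrite -[y in LHS](_ : lreg g (lreg g^-1%g y) = y) ?ip_perm//.
by apply: l2P => s; rewrite !lregE invgK mulVKg.
Qed.

Lemma ipBl x y (z : H) : ip (x - y) z = ip x z - ip y z.
Proof. by rewrite ipDl -scaleN1r ipZl mulN1r. Qed.

Lemma ipBr x y (z : H) : ip z (x - y) = ip z x - ip z y.
Proof. by rewrite ipDr -scaleN1r ipZr rmorphN1 mulN1r. Qed.

Lemma ip_inj x y : (forall z, ip z x = ip z y) -> x = y.
Proof.
move=> E; apply: l2P => s.
by rewrite -!ip_delta ipC [RHS]ipC E.
Qed.

(** The algebra generated by the left translations, presented as the commutant of the right ones: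
    its elements are then visibly determined by their value at [delta 1]. *)
Definition group_vN : set (H -> H) := commutant (range rreg).

Lemma rreg_bounded : range rreg `<=` @bounded_operator _ H.
Proof. by move=> _ [g _ <-]; exact: bounded_perm. Qed.

Lemma group_vN_rreg T g x : group_vN T -> T (rreg g x) = rreg g (T x).
Proof.
move=> [_ /(_ (rreg g))]; move=> /(_ (ex_intro2 _ _ g I erefl)) E.
by have := congr1 (fun f : H -> H => f x) E.
Qed.

Lemma group_vN_von_neumann : von_neumann_algebra ip group_vN.
Proof.
split; first by move=> T [].
- move=> T MT; have [bT _] := MT; have [S bS TS] := adjoint_exists bT.
  exists S => //; split=> // _ [g _ <-]; apply/funext => y /=.
  apply: ip_inj => z; rewrite -TS -[g]invgK -ip_rreg -group_vN_rreg// TS.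
  by rewrite ip_rreg.
- exact/commutant3/rreg_bounded.
Qed.

(* V and W have the same matrix coefficients at the unit up to conjugation and
   inversion, which is the trace property of the vector state at delta 1. *)
Lemma group_vN_finite : finite_vN ip group_vN.
Proof.
move=> V W MV MW VW WV.
have sqnV x : sqn (V x) = sqn x.
  apply: (@complexI R); rewrite -!ipxx VW.
  by have /= -> := congr1 (fun f : H -> H => f x) WV.
have W1 : sqn (W (delta 1%g)) = 1.
  transitivity (sqn (perm_l2 (@invgK Gamma) (@invgK Gamma) (V (delta 1%g))));
    last by rewrite sqn_perm sqnV sqn_delta.
  rewrite /sqn /esqr; congr fine; apply: eq_esum => s _; congr EFin.
  rewrite -ip_delta ipC -VW -[s in delta s]mul1g -{1}[s]invgK -rreg_delta.
  rewrite group_vN_rreg// ip_delta rregE mul1g.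
  by rewrite perm_l2E; case: (V _ _) => p q; rewrite /sqrc/= sqrrN.
(* Both sides are unit vectors and their inner product is 1, since [W] is adjoint to [V]. *)
have VW1 : V (W (delta 1%g)) = delta 1%g.
  apply/eqP; rewrite -subr_eq0; apply/eqP/sqn_eq0.
  have E : rip (V (W (delta 1%g))) (delta 1%g) = 1.
    have : ip (V (W (delta 1%g))) (delta 1%g) = (1%R)%:C%C.
      by rewrite VW ipxx W1.
    by move=> /(congr1 (@complex.Re R)).
  rewrite -ripxx ripDl !ripDr ripNl !ripNr !ripNl E (ripC (delta _)) E.
  by rewrite !ripxx sqnV W1 sqn_delta; ring.
have bVW : bounded_operator (V \o W).
  have [[VL Vc] _] := MV; have [[WL Wc] _] := MW.
  split; last by move=> x; apply: continuous_comp; [exact: Wc|exact: Vc].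
  by move=> a x y /=; rewrite (linD WL) (linZ WL) (linD VL) (linZ VL).
apply: bounded_operator_ext => //.
  apply: (@bounded_operatorP _ _ _ 1) => // z; by rewrite mul1r.
move=> s /=; rewrite -[s]mul1g -[s]invgK -rreg_delta.
by rewrite !group_vN_rreg// VW1.
Qed.

Lemma lreg_group_vN g : group_vN (lreg g).
Proof.
split; first exact: bounded_perm.
move=> _ [h _ <-]; apply/funext => x; apply: l2P => s; rewrite /comp.
by rewrite !(lregE, rregE) mulgA.
Qed.

Lemma lreg_inj : injective lreg.
Proof.
move=> g h /(congr1 (fun f : H -> H => f (delta 1%g) g)).
rewrite !lreg_delta !mulg1 !deltaE eqxx; case: eqP => // _ /eqP.
by rewrite oner_eq0.
Qed.

Lemma sqn_delta_dist s t : sqn (delta s - delta t) < 1 -> s = t.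
Proof.
move=> st; apply/eqP; apply: contraTT st => st; rewrite -leNgt.
apply: le_trans (sqr_le_sqn _ s).
rewrite l2D l2N !deltaE eqxx (negbTE st) subr0.
by rewrite (sqrc_real 1) expr1n.
Qed.

Lemma group_vN_lreg U g : group_vN U -> U (delta 1%g) = delta g -> U = lreg g.
Proof.
move=> MU U1; apply: bounded_operator_ext.
- by case: MU.
- exact: bounded_perm.
- move=> s; rewrite -[s]mul1g -[s]invgK -rreg_delta !group_vN_rreg ?U1//.
    by rewrite lreg_delta mulg1.
  exact: lreg_group_vN.
Qed.

Lemma lreg_unitary g : unitary_group ip group_vN (lreg g).
Proof.
split; first exact: lreg_group_vN.
exists (lreg g^-1%g); split; first by move=> x y; exact: ip_lreg.
- by rewrite -lregM mulgV lreg1.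
- by rewrite -lregM mulVg lreg1.
Qed.

Lemma open_eval x y (r : R) : 0 < r ->
  open [set h : {ptws H -> H} | sqn (h x - y) < r].
Proof.
move=> r0.
have -> : [set h : {ptws H -> H} | sqn (h x - y) < r] =
    (@proj H (fun _ => H) x) @^-1` ball y (Num.sqrt r)%:C%C.
  apply/seteqP; split=> h; rewrite /= -ball_normE/= distrC l2norm_ltE ?sqrtr_ge0//;
  by rewrite sqr_sqrtr// ltW.
apply: open_comp; first by move=> f _; exact: proj_continuous.
exact: ball_open.
Qed.

Lemma near_eval (f : {ptws H -> H}) x (r : R) : 0 < r ->
  nbhs f [set h : {ptws H -> H} | sqn (h x - f x) < r].
Proof.
move=> r0; apply: open_nbhs_nbhs; split; first exact: open_eval.
by rewrite /= subrr sqn0.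
Qed.

(** The weighted inequality between arithmetic and geometric means. The weight [t] lets the
    smallness of one vector absorb the size of the other, in terms linear in the squared norms. *)
Lemma norm_ip_le (t : R) x y : 0 < t ->
  `|ip x y| <= (t * sqn x + t^-1 * sqn y)%:C%C.
Proof.
move=> t0; have b0 : 0 <= t * sqn x + t^-1 * sqn y.
  by rewrite addr_ge0// mulr_ge0 ?sqn_ge0 ?invr_ge0 ?(ltW t0).
rewrite normc_def lecR -[leRHS]ger0_norm// -sqrtr_sqr ler_wsqrtr//.
apply: le_trans (sqrc_ip_le x y) _.
have -> : 2 * (sqn x * sqn y) = 2 * (t * sqn x) * (t^-1 * sqn y).
  by field; rewrite gt_eqF.
have : 0 <= t * sqn x by rewrite mulr_ge0 ?sqn_ge0 ?(ltW t0).
have : 0 <= t^-1 * sqn y by rewrite mulr_ge0 ?sqn_ge0 ?invr_ge0 ?(ltW t0).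
by move: (t * sqn x) (t^-1 * sqn y) => p q q0 p0; nra.
Qed.

Lemma exists_rat_approx (c : R[i]) (e : R) : 0 < e ->
  exists q : rat * rat, sqrc (c - (ratr q.1 +i* ratr q.2)%C) < e.
Proof.
move=> e0; set t := Num.sqrt (e / 2).
have t0 : 0 < t by rewrite sqrtr_gt0 divr_gt0.
have approx (p : R) : exists q : rat, (p - ratr q) ^+ 2 < e / 2.
  have [q] : exists q, ratr q \in `]p, (p + t)[ by apply: rat_in_itvoo; rewrite ltrDl.
  rewrite in_itv/= => /andP[pq qt]; exists q.
  rewrite -[ltRHS]sqr_sqrtr ?divr_ge0 ?ltW// -/t -sqrrN opprB.
  by rewrite ltr_pXn2r ?nnegrE ?ltW// ?subr_gt0// ltrBlDl.
case: c => p p'; have [q qP] := approx p; have [q' q'P] := approx p'.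
by exists (q, q'); rewrite /sqrc/= [ltRHS]splitr ltrD.
Qed.

Lemma sqnD_le x y : sqn (x + y) <= 2 * sqn x + 2 * sqn y.
Proof. by rewrite -sqn_parallelogram lerDl sqn_ge0. Qed.

Hypothesis Gamma_countable : countable [set: Gamma].

Lemma l2_separable : exists D : nat -> H,
  forall x (e : R), 0 < e -> exists n, sqn (x - D n) < e.
Proof.
have /countable_injP[f finj] := Gamma_countable.
(* [en] is a left inverse of the injection [f], with value 1 at the integers outside of its
   range. *)
have /choice[en enP] : forall n, exists s, forall t, f t = n -> t = s.
  move=> n; have [[s sn]|ns] := pselect (exists s, f s = n).
    by exists s => t tn; apply: finj; rewrite ?inE// tn sn.
  by exists 1%g => t tn; exfalso; apply: ns; exists t.
have {enP}enK s : en (f s) = s by rewrite -(enP (f s) s).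
pose vec (c : seq (nat * (rat * rat))) : H :=
  \sum_(p <- c) (ratr p.2.1 +i* ratr p.2.2)%C *: delta (en p.1).
have vecP (J : seq Gamma) (c : Gamma -> R[i]) (e : R) : 0 < e ->
    exists w, sqn (\sum_(j <- J) c j *: delta j - vec w) < e.
  elim: J e => [|j J IH] e e0.
    by exists [::]; rewrite /vec !big_nil subrr sqn0.
  have e40 : 0 < e / 4 by rewrite divr_gt0.
  have [w wP] := IH _ e40; have [q qP] := exists_rat_approx (c j) e40.
  exists ((f j, q) :: w); rewrite /vec !big_cons/= enK -/(vec w).
  rewrite opprD addrACA -scalerBl.
  apply: le_lt_trans (sqnD_le _ _) _; rewrite sqnZ sqn_delta mulr1.
  by move: (sqn _) (sqrc _) wP qP => A B; lra.
exists (fun n => oapp vec 0 (choice.unpickle n)) => x e e0.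
have e40 : 0 < e / 4 by rewrite divr_gt0.
have [J JP] := l2_finite_approx x e40; have [w wP] := vecP J x _ e40.
exists (choice.pickle w); rewrite choice.pickleK /=.
rewrite -[x](subrK (\sum_(j <- J) x j *: delta j)) -addrA.
apply: le_lt_trans (sqnD_le _ _) _.
by move: (sqn _) (sqn _) JP wP => A B; lra.
Qed.

(** The functionals are finite sums of T -> <T (D m), D k> over a dense sequence [D], indexed by
    finite lists of pairs. A functional of the predual is truncated uniformly on the unit ball, and
    then its finitely many vectors are moved into [D]. *)
Lemma group_vN_separable_predual : separable_predual ip group_vN.
Proof.
have [D DP] := l2_separable.
pose psi (c : seq (nat * nat)) (T : H -> H) : R[i] :=
  \sum_(p <- c) ip (T (D p.1)) (D p.2).
exists (fun n => psi (odflt [::] (choice.unpickle n))).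
split=> [n|phi [xi [eta [cxi ceta phiE]]] e e0].
  have psi_predual c : in_predual ip group_vN (psi c).
    (* A finite sum is made into a series by padding with zero vectors. *)
    pose xi (a : nat * nat -> nat) i :=
      if (i < size c)%N then D (a (nth (0, 0)%N c i)) else 0.
    have xi0 a i : (size c <= i)%N -> xi a i = 0.
      by rewrite /xi ltnNge => ->.
    have xi_sqr0 a i : (size c <= i)%N -> `|xi a i| ^+ 2 = 0.
      by move=> ci; rewrite xi0// normr0 expr0n.
    exists (xi fst), (xi snd); split=> [||T _].
    - exact: eventually0_cvg_series (xi_sqr0 _).
    - exact: eventually0_cvg_series (xi_sqr0 _).
    have -> : psi c T =
        series (fun i => ip (T (xi fst i)) (xi snd i)) (size c).
      rewrite /series/= /psi (big_nth (0, 0)%N) big_nat_cond [RHS]big_nat_cond.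
      by apply: eq_bigr => i /andP[/andP[_ ic] _]; rewrite /xi ic.
    by apply: eventually0_series => i ci; rewrite !xi0// ip0r.
  exact: psi_predual.
have [r r0 eE] := gt0_complexE e0.
(* Three errors occur: convergence of the series, its tail, and the replacement of the vectors. The
   fourth quarter is slack. *)
have r40 : 0 < r / 4 by rewrite divr_gt0.
have contr (T : H -> H) : (forall x, `|T x| <= `|x|) ->
    forall x, sqn (T x) <= sqn x.
  move=> TC x; move: (TC x); rewrite lecR.
  by rewrite -(ler_pXn2r (_ : 0 < 2)%N) ?nnegrE ?sqrtr_ge0// !sqr_sqrtr ?sqn_ge0.
(* The order of choices matters: [t] depends on [y], [m] on [t], [t'] on [D m], and [k] on [t'].
   Nothing depends on [T]. *)
have pairP x y (d : R) : 0 < d -> exists p : nat * nat, forall T : H -> H,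
    group_vN T -> (forall z, `|T z| <= `|z|) ->
    `|ip (T x) y - ip (T (D p.1)) (D p.2)| <= d%:C%C.
  move=> d0; have d40 : 0 < d / 4 by rewrite divr_gt0.
  have large (z : H) : exists2 t : R, 0 < t & t^-1 * sqn z <= d / 4.
    have zd : 0 < sqn z / (d / 4) + 1.
      by rewrite ltr_wpDl// divr_ge0 ?sqn_ge0// ltW.
    exists (sqn z / (d / 4) + 1) => //.
    by rewrite mulrC ler_pdivrMr// mulrDr mulrC divfK ?lt0r_neq0// mulr1 lerDl ltW.
  have [t t0 tP] := large y.
  have [m mP] := DP x _ (divr_gt0 d40 t0).
  have [t' t'0 t'P] := large (D m).
  have [k kP] := DP y _ (divr_gt0 d40 t'0).
  have t'i0 : 0 < t'^-1 by rewrite invr_gt0.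
  exists (m, k) => T MT /contr TC /=.
  have lT : linear T by case: MT => -[].
  have -> : ip (T x) y - ip (T (D m)) (D k) =
      ip (T (x - D m)) y + ip (T (D m)) (y - D k).
    by rewrite (linB lT) ipBl ipBr addrA subrK.
  apply: le_trans (ler_normD _ _) _.
  apply: le_trans (lerD (norm_ip_le _ _ t0) (norm_ip_le _ _ t'i0)) _.
  rewrite -rmorphD/= lecR invrK.
  have := TC (x - D m); have := TC (D m).
  rewrite ltr_pdivlMr// mulrC in mP; rewrite ltr_pdivlMr// mulrC in kP.
  have : t'^-1 * sqn (T (D m)) <= t'^-1 * sqn (D m) by rewrite ler_wpM2l// ltW.
  have : t * sqn (T (x - D m)) <= t * sqn (x - D m) by rewrite ler_wpM2l// ltW.
  lra.
have sumP N (d : R) : 0 < d -> exists c, forall T : H -> H,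
    group_vN T -> (forall z, `|T z| <= `|z|) ->
    `|\sum_(0 <= i < N) ip (T (xi i)) (eta i) - psi c T| <= d%:C%C.
  elim: N d => [|N IH] d d0.
    exists [::] => T _ _; rewrite /psi big_geq// big_nil subrr normr0.
    by rewrite lecR ltW.
  have d20 : 0 < d / 2 by rewrite divr_gt0.
  have [c cP] := IH _ d20; have [p pP] := pairP (xi N) (eta N) _ d20.
  exists (p :: c) => T MT TC; rewrite big_nat_recr//= /psi big_cons.
  rewrite (addrC (ip _ _)) opprD addrACA.
  rewrite (splitr d) rmorphD/=; apply: le_trans (ler_normD _ _) _.
  by apply: lerD; [exact: cP|exact: pP].
have r40C : 0 < (r / 4)%:C%C :> R[i] by rewrite ltcR.
have [N NP] := series_tail (cvg_seriesD cxi ceta) r40C.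
have [c cP] := sumP N _ r40.
exists (choice.pickle c) => T MT TC; rewrite choice.pickleK /=.
have /cvgrPdist_lt/(_ _ r40C)[M _ MP] := phiE T MT.
pose m := maxn N M; have := MP m (leq_maxr _ _); have := NP m (leq_maxl _ _).
pose S n := \sum_(0 <= i < n) ip (T (xi i)) (eta i).
rewrite -/(S m) => tail phim.
have Sm : `|S m - S N| <= (r / 4)%:C%C.
  rewrite (sub_series_geq (fun i => ip (T (xi i)) (eta i)) (leq_maxl N M)).
  apply: le_trans (ltW tail); rewrite [leRHS]ger0_norm; last first.
    by apply: sumr_ge0 => i _; rewrite addr_ge0// exprn_ge0.
  apply: le_trans (ler_norm_sum _ _ _) _; apply: ler_sum => i _ /=.
  apply: le_trans (norm_ip_le _ _ (ltr01 : 0 < 1 :> R)) _.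
  rewrite invr1 !mul1r rmorphD/= -!sqr_l2norm lerD2r.
  by rewrite !sqr_l2norm lecR; exact: contr.
have -> : phi T - psi c T =
    (phi T - S m) + (S m - S N) + (S N - psi c T).
  by rewrite !addrA !subrK.
rewrite eE (_ : r = r / 4 + r / 4 + r / 4 + r / 4); last by field.
rewrite !rmorphD/=.
apply: le_trans (ler_normD _ _) _; apply: le_trans (lerD (ler_normD _ _) (lexx _)) _.
apply: (@le_trans _ _ ((r / 4)%:C%C + (r / 4)%:C%C + (r / 4)%:C%C)).
  by apply: lerD; [apply: lerD => //; exact: ltW phim|exact: cP].
by rewrite -[leLHS]addr0 lerD2l ltW.
Qed.

End LeftRegular.

(** * Countable groups with the discrete topology *)

Definition discrete_group (Gamma : groupType) : Type := Gamma.

HB.instance Definition _ (Gamma : groupType) := Group.on (discrete_group Gamma).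
HB.instance Definition _ (Gamma : groupType) :=
  isPointed.Build (discrete_group Gamma) (1%g : Gamma).
HB.instance Definition _ (Gamma : groupType) :=
  hasNbhs.Build (discrete_group Gamma) principal_filter.
HB.instance Definition _ (Gamma : groupType) :=
  Discrete_ofNbhs.Build (discrete_group Gamma) erefl.
HB.instance Definition _ (Gamma : groupType) :=
  DiscreteUniform_ofNbhs.Build (discrete_group Gamma).

Lemma open_discrete (D : discreteTopologicalType) (A : set D) : open A.
Proof.
by rewrite openE => x Ax; rewrite /interior nbhs_principalE; exact/principal_filterP.
Qed.

Lemma continuous_discrete (D : discreteTopologicalType) (T : topologicalType)
  (f : D -> T) : continuous f.
Proof. by apply/continuousP => A _; exact: open_discrete. Qed.

Section DiscreteGroup.
Variable Gamma : groupType.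
Local Notation D := (discrete_group Gamma).

Lemma discrete_mulg_continuous : continuous (fun p : D * D => (p.1 * p.2)%g).
Proof.
move=> [x y] A /nbhs_singleton/= Axy; exists ([set x], [set y]).
  by split; rewrite nbhs_principalE; exact/principal_filterP.
by move=> [_ _] [/= -> ->].
Qed.

HB.instance Definition _ := isTopologicalGroup.Build D
  discrete_mulg_continuous (@continuous_discrete D D _).

End DiscreteGroup.

(** [polish] asks for a metric with values in [R], hence a copy of the group that depends on [R]. *)
Definition discrete_metric (R : realType) (Gamma : groupType) : Type :=
  discrete_group Gamma.

HB.instance Definition _ (R : realType) (Gamma : groupType) :=
  DiscreteUniform.on (discrete_metric R Gamma).
HB.instance Definition _ (R : realType) (Gamma : groupType) :=
  Pointed.on (discrete_metric R Gamma).
HB.instance Definition _ (R : realType) (Gamma : groupType) :=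
  DiscretePseudoMetric_ofUniform.Build R (discrete_metric R Gamma).

Lemma discrete_cauchy_cvg (R : realType) (Gamma : groupType)
  (F : set_system (discrete_metric R Gamma)) :
  ProperFilter F -> cauchy F -> cvg F.
Proof.
move=> FF cF.
pose T := discrete_metric R Gamma.
have /cF[[A B] [/= FA FB] AB] : entourage (range (fun x : T => (x, x))).
  by rewrite uniform_discrete => p.
have [x [Ax Bx]] : A `&` B !=set0 by apply: (@filter_ex _ F); exact: (@filterI _ F).
apply/cvg_ex; exists x => U; rewrite nbhs_principalE => /principal_filterP Ux.
apply: (@filterS _ F _ B) => // y By.
by have [z _ [zx zy]] := AB (x, y) (conj Ax By); rewrite -zy zx.
Qed.

HB.instance Definition _ (R : realType) (Gamma : groupType) :=
  Uniform_isComplete.Build (discrete_metric R Gamma)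
    (@discrete_cauchy_cvg R Gamma).

Lemma discrete_group_polish (R : realType) (Gamma : groupType) :
  countable [set: Gamma] -> polish R (discrete_group Gamma).
Proof.
move=> cG; exists (discrete_metric R Gamma), id, id; split=> //.
- exact: discrete_hausdorff.
- exists setT; first exact: cG.
  by rewrite /dense => O [x Ox] _; exists x.
- split.
    exact: (@continuous_discrete (discrete_group Gamma)).
  exact: (@continuous_discrete (discrete_metric R Gamma)).
Qed.

(* Countable discrete groups act by left translations on l2, and the closed
   subgroup of unitaries that they form is discrete: the vectors delta s are
   at mutual distance sqrt 2. *)
Theorem discrete_group_finite_type (R : realType) (Gamma : groupType) :
  countable [set: Gamma] ->
  polish_of_finite_type R (discrete_group Gamma).
Proof.
move=> cG; split; first exact: discrete_group_polish.
exists (l2 R Gamma), ip, (@group_vN R Gamma), (@lreg R Gamma).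
split.
- exact: ip_inner_product.
- exact: group_vN_von_neumann.
- exact: group_vN_finite.
- exact: group_vN_separable_predual.
split.
- split; first exact: lreg_inj.
  by move=> g h; exact: (lregM R (g : Gamma) (h : Gamma)).
- by move=> _ [g _ <-]; exact: lreg_unitary.
- move=> U [clU [MU _]].
  have close (r : R) : 0 < r ->
      exists g, sqn (delta g - U (delta (1%g : Gamma))) < r.
    move=> r0; have [_ [[g _ <-]]] := clU _ (near_eval U (delta 1%g) r0).
    by rewrite /= lreg_delta mulg1; exists g.
  (* Two basis vectors at squared distance less than 1/4 from [U (delta 1)] are at squared distance
     less than 1 from each other by [sqnD_le], hence equal. So this [g] serves every precision. *)
  have [g gU] := close (1 / 4) (divr_gt0 ltr01 (ltr0n _ 4)).
  exists g => //; apply/esym/group_vN_lreg => //.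
  apply/eqP; rewrite -subr_eq0; apply/eqP/sqn_eq0/eqP.
  rewrite eq_le sqn_ge0 andbT; apply/ler_addgt0Pl => r r0; rewrite addr0.
  have m0 : 0 < Num.min r (1 / 4) by rewrite lt_min r0 divr_gt0.
  have [h] := close _ m0; rewrite lt_min => /andP[hr h4].
  have /sqn_delta_dist gh : sqn (delta g - delta h : l2 R Gamma) < 1.
    rewrite -(subrKA (U (delta 1%g))) -(opprB (delta h)).
    apply: le_lt_trans (sqnD_le _ _) _; rewrite sqnN.
    by move: (sqn _) (sqn _) gU h4 => A B; lra.
  by rewrite -sqnN opprB gh ltW.
- move=> O; split=> [_|_]; last exact: open_discrete.
  exists (\bigcup_(g in O) [set h : {ptws l2 R Gamma -> l2 R Gamma} |
      sqn (h (delta 1%g) - delta g) < 1]).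
    by apply: bigcup_open => g _; exact: open_eval.
  apply/seteqP; split=> g /=.
    by move=> Og; exists g => //=; rewrite lreg_delta mulg1 subrr sqn0.
  by move=> [h Oh /=]; rewrite lreg_delta mulg1 => /sqn_delta_dist ->.
Qed.

(** * Haar measure on compact groups *)

Section UltraLimit.
Variables (R : realType) (T : Type) (G : set_system T).
Hypothesis GU : UltraFilter G.

(** Compactness provides a cluster point, and an ultrafilter converges to its cluster points. *)
Lemma ultra_cvg_bounded (u : T -> R) (a b : R) :
  (forall t, a <= u t <= b) -> exists l : R, u @ G --> l.
Proof.
move=> uab.
have uI : (u @ G) `[a, b]%classic.
  by apply: nearW => t /=; rewrite in_itv/= uab.
have [l [_ cl]] := @segment_compact R a b (u @ G) _ uI.
exists l => V Vl.
have [//|GV] := in_ultra_setVsetC (u @^-1` V) GU.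
by have [x [/= nVx Vx]] := cl (~` V) V GV Vl.
Qed.

End UltraLimit.

Section TopologicalGroupTheory.
Variable K : topGroupType.
Implicit Types (C D U V O : set K) (g k : K).

Lemma mulgl_continuous g : continuous (fun k : K => (g * k)%g).
Proof.
move=> k.
exact: (cvg_comp2 (cvg_cst g) cvg_id (@mulg_continuous K (g, k))).
Qed.

Lemma open_mulgl g O : open O -> open ((fun k : K => (g * k)%g) @^-1` O).
Proof. by apply: open_comp => k _; exact: mulgl_continuous. Qed.

Lemma closed_mulgl g C : closed C -> closed ((fun k : K => (g * k)%g) @^-1` C).
Proof. by apply: preimage_closed => k _; exact: mulgl_continuous. Qed.

Lemma divg_continuous : continuous (fun p : K * K => (p.1^-1 * p.2)%g).
Proof.
move=> p; have c1 : (fun q : K * K => (q.1^-1)%g) @ p --> (p.1^-1)%g.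
  by apply: (@cvg_comp _ _ _ fst (fun k : K => k^-1%g)); [exact: cvg_fst|exact: invg_continuous].
exact: (cvg_comp2 c1 cvg_snd (@mulg_continuous K (p.1^-1%g, p.2))).
Qed.

Definition divset C D : set K := [set (c^-1 * d)%g | c in C & d in D].

Lemma compact_divset C D : compact C -> compact D -> compact (divset C D).
Proof.
move=> cC cD.
have -> : divset C D = (fun p : K * K => (p.1^-1 * p.2)%g) @` (C `*` D).
  apply/seteqP; split=> [_ [c Cc [d Dd <-]]|_ [[c d] [/= Cc Dd] <-]].
    by exists (c, d).
  by exists c => //; exists d.
apply: continuous_compact; last exact: compact_setX.
apply: continuous_subspaceT => p.
exact: divg_continuous.
Qed.

Lemma nbhs1_div V : nbhs 1%g V ->
  exists2 U, nbhs 1%g U & forall u v, U u -> U v -> V (u^-1 * v)%g.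
Proof.
move=> V1.
have := @divg_continuous (1%g, 1%g); rewrite /continuous_at/=.
rewrite invg1 mulg1 => /(_ _ V1) [[A B] /= [A1 B1] AB].
exists (A `&` B); first exact: filterI.
by move=> u v [Au _] [_ Bv]; exact: (AB (u, v)).
Qed.

End TopologicalGroupTheory.

(** * Covering numbers *)

Section CoveringNumber.
Variable K : topGroupType.
Hypotheses (K_compact : compact [set: K]) (K_hausdorff : hausdorff_space K).
Implicit Types (C D U V O : set K) (g k : K) (s : seq K).

Definition covered U C s := forall c, C c -> exists2 g, g \in s & U (g^-1 * c)%g.

Definition covering_number_pred U C (n : nat) : bool :=
  `[< exists2 s, size s = n & covered U C s >].

Lemma exists_covered U C : nbhs 1%g U -> exists s, covered U C s.
Proof.
move=> U1; have [V [oV V1] VU] : exists2 V, open_nbhs (1%g : K) V & V `<=` U.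
  by move: U1; rewrite nbhsE.
have := K_compact; rewrite compact_cover.
move=> /(_ K [set: K] (fun g => (fun k : K => (g^-1 * k)%g) @^-1` V)) [].
- by move=> g _; exact: open_mulgl.
- by move=> k _; exists k => //=; rewrite mulVg.
move=> F _ FP; exists F => c _.
by have [g gF /= gc] := FP c I; exists g => //; exact: VU.
Qed.

Lemma exists_covering_number U C : nbhs 1%g U ->
  exists n, covering_number_pred U C n.
Proof.
by move=> /(exists_covered C)[s sP]; exists (size s); apply/asboolP; exists s.
Qed.

(** Haar's index (C : U), the least number of left translates of [U] covering [C], set to 0 when
    there is no finite cover. *)
Definition covering_number U C : nat :=
  if pselect (exists n, covering_number_pred U C n) is left e
  then ex_minn e else 0.

Lemma covering_numberP U C : nbhs 1%g U ->
  exists2 s, size s = covering_number U C & covered U C s.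
Proof.
move=> /(exists_covering_number C) ex; rewrite /covering_number.
case: pselect => // e; case: ex_minnP => n /asboolP[s sn sP] _.
by exists s.
Qed.

Lemma covering_number_min U C s : covered U C s ->
  (covering_number U C <= size s)%N.
Proof.
move=> sP; rewrite /covering_number; case: pselect => // e.
by case: ex_minnP => n _; apply; apply/asboolP; exists s.
Qed.

Lemma covering_number_le U C D : nbhs 1%g U -> C `<=` D ->
  (covering_number U C <= covering_number U D)%N.
Proof.
move=> /(covering_numberP D)[s <- sP] CD.
by apply: covering_number_min => c /CD /sP.
Qed.

Lemma covering_numberU_le U C D : nbhs 1%g U ->
  (covering_number U (C `|` D) <= covering_number U C + covering_number U D)%N.
Proof.
move=> U1; have [s <- sP] := covering_numberP C U1.
have [t <- tP] := covering_numberP D U1.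
rewrite -size_cat; apply: covering_number_min => c [/sP|/tP] [g gs gc];
  by exists g => //; rewrite mem_cat gs ?orbT.
Qed.

Lemma covering_number0 U : covering_number U set0 = 0.
Proof. by apply/eqP; rewrite -leqn0; exact: (@covering_number_min _ _ [::]). Qed.

Lemma covering_number_gt0 U : nbhs 1%g U -> (0 < covering_number U setT)%N.
Proof.
move=> /(covering_numberP setT)[[|g s] <- //].
by move=> /(_ 1%g I)[].
Qed.

Lemma covering_number_mulgl U C g : nbhs 1%g U ->
  (covering_number U ((fun k => (g * k)%g) @^-1` C) <= covering_number U C)%N.
Proof.
move=> /(covering_numberP C)[s <- sP].
rewrite -(size_map (fun h : K => (g^-1 * h)%g)).
apply: covering_number_min => c /= /sP[h hs Uh].
exists (g^-1 * h)%g; first exact: map_f.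
by rewrite invgM invgK -mulgA.
Qed.

(** Under this hypothesis no translate of [U] meets both [C] and [D], so the translates of an
    optimal cover of the union split into a cover of each. *)
Lemma covering_numberU U C D : nbhs 1%g U ->
  (forall c d u v, C c -> D d -> U u -> U v -> (c^-1 * d <> u^-1 * v)%g) ->
  (covering_number U C + covering_number U D <= covering_number U (C `|` D))%N.
Proof.
move=> U1 CD; have [s <- sP] := covering_numberP (C `|` D) U1.
pose meetsC g := `[< exists2 c, C c & U (g^-1 * c)%g >].
rewrite -(count_predC meetsC) -!size_filter; apply: leq_add;
  apply: covering_number_min => d Dd.
  have [g gs gd] := sP d (or_introl Dd); exists g => //.
  by rewrite mem_filter gs andbT; apply/asboolP; exists d.
have [g gs gd] := sP d (or_intror Dd); exists g => //.
rewrite mem_filter gs andbT; apply/asboolPn => -[c Cc gc].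
apply: (CD c d _ _ Cc Dd gc gd).
by rewrite invgM invgK -mulgA mulVKg.
Qed.

End CoveringNumber.

(** * The Haar content *)

Section HaarContent.
Variables (R : realType) (K : topGroupType).
Hypotheses (K_compact : compact [set: K]) (K_hausdorff : hausdorff_space K).

(** [lam C] is the limit of (C : U) / (K : U) as [U] shrinks to 1, along an ultrafilter so that all
    these limits exist at once. Each clause is an inequality between covering numbers;
    superadditivity holds only for [U] small with respect to [C] and [D], which the filter
    permits. *)
Lemma haar_content : exists lam : set K -> R,
  [/\ lam set0 = 0 /\ lam setT = 1,
      forall C, 0 <= lam C,
      forall C D, C `<=` D -> lam C <= lam D,
      forall C D, lam (C `|` D) <= lam C + lam D &
      (forall C D, closed C -> closed D -> C `&` D = set0 ->
        lam C + lam D <= lam (C `|` D)) /\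
      (forall C g, lam ((fun k => (g * k)%g) @^-1` C) <= lam C)].
Proof.
pose F : set_system (set K) := filter_from [set V | nbhs 1%g V]
  (fun V => [set U | nbhs 1%g U /\ U `<=` V]).
have FF : ProperFilter F.
  apply: filter_from_proper; last by move=> V V1; exists V; split.
  apply: filter_from_filter; first by exists setT; exact: filterT.
  move=> V W V1 W1; exists (V `&` W); first exact: filterI.
  by move=> U [U1 UVW]; split; split=> // x /UVW[].
have [G [GU FG]] := ultraFilterLemma FF.
have GP V : nbhs 1%g V -> G [set U | nbhs 1%g U /\ U `<=` V].
  by move=> V1; apply: FG; exists V.
have GF : ProperFilter G by exact: ultra_proper.
(* The value 0 at sets that are not neighborhoods of 1 keeps [u C] in [0, 1] everywhere, as
   [ultra_cvg_bounded] asks. *)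
pose u C U : R := if `[< nbhs (1%g : K) U >] then
  (covering_number U C)%:R / (covering_number U setT)%:R else 0.
have u01 C U : 0 <= u C U <= 1.
  rewrite /u; case: asboolP => [U1|_]; last by rewrite lexx ler01.
  have N0 := covering_number_gt0 K_compact U1.
  rewrite divr_ge0//= ler_pdivrMr ?ltr0n// mul1r ler_nat.
  exact: covering_number_le.
have /choice[lam lamP] : forall C, exists l : R, u C @ G --> l.
  by move=> C; exact: ultra_cvg_bounded (u01 C).
have near_le (v w : set K -> R) (a b : R) V : nbhs (1%g : K) V ->
    v @ G --> a -> w @ G --> b ->
    (forall U, nbhs (1%g : K) U -> U `<=` V -> v U <= w U) -> a <= b.
  move=> V1 va wb vw; rewrite -subr_ge0.
  apply: (@cvgr_to_ge _ G _ _ _ _ _ (cvgB wb va)).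
  by apply: filterS (GP V V1) => U [U1 UV] /=; rewrite subr_ge0; exact: vw.
have uE C U : nbhs (1%g : K) U ->
    u C U = (covering_number U C)%:R / (covering_number U setT)%:R.
  by move=> U1; rewrite /u asboolT.
have div_le (m n p : nat) : (m <= n)%N -> m%:R / p%:R <= n%:R / p%:R :> R.
  by move=> mn; rewrite ler_wpM2r ?invr_ge0// ler_nat.
exists lam; split.
- split; apply/eqP; rewrite eq_le; apply/andP; split.
  + apply: (near_le _ (fun=> 0) _ _ setT filterT (lamP set0) (cvg_cst _)) => U U1 _.
    by rewrite uE// covering_number0 mul0r.
  + apply: (near_le (fun=> 0) _ _ _ setT filterT (cvg_cst _) (lamP set0)) => U U1 _.
    by rewrite uE// covering_number0 mul0r.
  + apply: (near_le _ (fun=> 1) _ _ setT filterT (lamP setT) (cvg_cst _)) => U U1 _.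
    by have /andP[] := u01 setT U.
  + apply: (near_le (fun=> 1) _ _ _ setT filterT (cvg_cst _) (lamP setT)) => U U1 _.
    by rewrite uE// divff// pnatr_eq0 -lt0n covering_number_gt0.
- move=> C; apply: (near_le (fun=> 0) _ _ _ setT filterT (cvg_cst _) (lamP C)) => U _ _.
  by have /andP[] := u01 C U.
- move=> C D CD; apply: (near_le _ _ _ _ setT filterT (lamP C) (lamP D)).
  by move=> U U1 _; rewrite !uE// div_le// covering_number_le.
- move=> C D; apply: (near_le _ _ _ _ setT filterT (lamP (C `|` D))
    (cvgD (lamP C) (lamP D))) => U U1 _ /=.
  rewrite [leRHS](_ : _ = u C U + u D U)//.
  by rewrite !uE// -mulrDl -natrD div_le// covering_numberU_le.
split=> [C D cC cD CD0|C g]; last first.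
  apply: (near_le _ _ _ _ setT filterT (lamP _) (lamP C)) => U U1 _.
  by rewrite !uE// div_le// covering_number_mulgl.
have closed_cpt (E : set K) : closed E -> compact E.
  by move=> cE; exact: (subclosed_compact cE K_compact).
(* For disjoint [C] and [D] the compact set of quotients c^-1 d misses 1, so its complement contains
   all quotients of some neighborhood of 1. *)
have [V V1 VP] : exists2 V, nbhs (1%g : K) V &
    forall u v, V u -> V v -> (~` divset C D) (u^-1 * v)%g.
  apply/nbhs1_div/open_nbhs_nbhs; split.
    apply/closed_openC; apply: compact_closed => //.
    by apply: compact_divset; exact: closed_cpt.
  move=> [c Cc [d Dd cd1]].
  suff cd : c = d by move: CD0; apply/eqP/set0P; exists c; split=> //; rewrite cd.
  by rewrite -[c]mulg1 -cd1 mulVKg.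
apply: (near_le _ _ _ _ V V1 (cvgD (lamP C) (lamP D)) (lamP _)) => U U1 UV.
rewrite [leLHS](_ : _ = u C U + u D U)//.
rewrite !uE// -mulrDl -natrD div_le// covering_numberU// => c d v w Cc Dd Uv Uw.
move=> cdE; apply: (VP v w (UV _ Uv) (UV _ Uw)); rewrite -cdE.
by exists c => //; exists d.
Qed.

End HaarContent.

(** * From the content to a regular Borel measure *)

Section HaarOuter.
Variables (R : realType) (K : topGroupType).
Hypotheses (K_compact : compact [set: K]) (K_hausdorff : hausdorff_space K).
Variable lam : set K -> R.
Hypotheses (lam0 : lam set0 = 0) (lamT : lam setT = 1).
Hypothesis lam_ge0 : forall C, 0 <= lam C.
Hypothesis lam_le : forall C D, C `<=` D -> lam C <= lam D.
Hypothesis lamU_le : forall C D, lam (C `|` D) <= lam C + lam D.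
Hypothesis lamU : forall C D, closed C -> closed D -> C `&` D = set0 ->
  lam C + lam D <= lam (C `|` D).
Hypothesis lam_mulgl : forall C g,
  lam ((fun k => (g * k)%g) @^-1` C) <= lam C.
Local Open Scope ereal_scope.

Definition inner_content (V : set K) : \bar R :=
  ereal_sup [set (lam C)%:E | C in [set C | closed C /\ C `<=` V]].

(** The classical two-step regularization of a content: open sets from inside by closed sets,
    arbitrary sets from outside by open sets. *)
Definition haar_outer (S : set K) : \bar R :=
  ereal_inf [set inner_content V | V in [set V | open V /\ S `<=` V]].

Lemma inner_content_ub C V : closed C -> C `<=` V ->
  (lam C)%:E <= inner_content V.
Proof. by move=> cC CV; apply: ereal_sup_ubound; exists C. Qed.

Lemma inner_content_ge0 V : 0 <= inner_content V.
Proof.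
have := @inner_content_ub set0 V; rewrite lam0; apply; [exact: closed0|exact: sub0set].
Qed.

Lemma inner_content_le V W : V `<=` W -> inner_content V <= inner_content W.
Proof.
move=> VW; apply: ge_ereal_sup => _ [C [cC CV] <-].
by apply: inner_content_ub => //; exact: subset_trans VW.
Qed.

Lemma inner_content_le1 V : inner_content V <= 1.
Proof.
by apply: ge_ereal_sup => _ [C _ <-]; rewrite lee_fin -lamT lam_le.
Qed.

Lemma haar_outer_open V : open V -> haar_outer V = inner_content V.
Proof.
move=> oV; apply/eqP; rewrite eq_le; apply/andP; split.
  by apply: ereal_inf_lbound; exists V => //; split.
by apply: le_ereal_inf_tmp => _ [W [_ VW] <-]; exact: inner_content_le.
Qed.

Lemma haar_outer_le S V : open V -> S `<=` V -> haar_outer S <= inner_content V.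
Proof. by move=> oV SV; apply: ereal_inf_lbound; exists V. Qed.

Lemma haar_outer_ge0 S : 0 <= haar_outer S.
Proof.
by apply: le_ereal_inf_tmp => _ [V _ <-]; exact: inner_content_ge0.
Qed.

Lemma haar_outer_le1 S : haar_outer S <= 1.
Proof.
exact: le_trans (haar_outer_le openT (@subsetT _ S)) (inner_content_le1 _).
Qed.

Lemma haar_outer_fin S : haar_outer S \is a fin_num.
Proof.
rewrite ge0_fin_numE ?haar_outer_ge0//.
by apply: le_lt_trans (haar_outer_le1 S) _; rewrite ltry.
Qed.

Lemma haar_outer_mono : {homo haar_outer : A B / A `<=` B >-> A <= B}.
Proof.
move=> A B AB; apply: le_ereal_inf_tmp => _ [V [oV BV] <-].
by apply: haar_outer_le => //; exact: subset_trans BV.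
Qed.

Lemma haar_outer0 : haar_outer set0 = 0.
Proof.
apply/eqP; rewrite eq_le haar_outer_ge0 andbT haar_outer_open; last exact: open0.
apply: ge_ereal_sup => _ [C [_ C0] <-].
by rewrite lee_fin -lam0 lam_le.
Qed.

Lemma haar_outer_approx S (e : R) : (0 < e)%R ->
  exists V, [/\ open V, S `<=` V & inner_content V < haar_outer S + e%:E].
Proof.
move=> e0; have [_ [V [oV SV] <-] VS] := lb_ereal_inf_adherent e0 (haar_outer_fin S).
by exists V.
Qed.

(* Normality splits a closed subset of V `|` W. *)
Lemma lam_leU C V W : closed C -> open V -> open W -> C `<=` V `|` W ->
  (lam C)%:E <= inner_content V + inner_content W.
Proof.
move=> cC oV oW CVW.
have /normal_openP := compact_normal K_hausdorff K_compact.
move=> /(_ R (C `\` V) (C `\` W)) [].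
- by apply: closedI => //; exact: open_closedC.
- by apply: closedI => //; exact: open_closedC.
- by apply/seteqP; split=> // x [[/CVW[Vx|Wx] nVx] [_ nWx]].
move=> P [Q [oP oQ CP CQ PQ]].
have CE : C `<=` (C `\` P) `|` (C `\` Q).
  move=> x Cx; have [Px|nPx] := pselect (P x); last by left.
  right; split=> // Qx; have : (P `&` Q) x by [].
  by rewrite PQ.
apply: (@le_trans _ _ (lam (C `\` P) + lam (C `\` Q))%:E).
  by rewrite lee_fin; apply: le_trans (lam_le CE) (lamU_le _ _).
rewrite EFinD; apply: leeD; apply: inner_content_ub.
- by apply: closedI => //; exact: open_closedC.
- by move=> x [Cx nPx]; apply: contrapT => nVx; exact/nPx/CP.
- by apply: closedI => //; exact: open_closedC.
- by move=> x [Cx nQx]; apply: contrapT => nWx; exact/nQx/CQ.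
Qed.

Lemma inner_contentU_le V W : open V -> open W ->
  inner_content (V `|` W) <= inner_content V + inner_content W.
Proof.
by move=> oV oW; apply: ge_ereal_sup => _ [C [cC CVW] <-]; exact: lam_leU.
Qed.

(** A closed subset of the union is compact, so finitely many [V n] cover it and finite
    subadditivity applies. *)
Lemma inner_content_bigcup_le (V : (set K)^nat) : (forall n, open (V n)) ->
  inner_content (\bigcup_n V n) <= \sum_(n <oo) inner_content (V n).
Proof.
move=> oV; apply: ge_ereal_sup => _ [C [cC CV] <-].
have : compact C by exact: (subclosed_compact cC K_compact).
rewrite compact_cover => /(_ nat setT V) [] // F _ CF.
have [N FN] : exists N, forall i, i \in F -> (i < N)%N.
  exists (\max_(i <- F) i).+1 => i iF; rewrite ltnS.
  by apply: (@leq_bigmax_seq _ _ xpredT id).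
have CN : C `<=` \big[setU/set0]_(i < N) V i.
  by move=> x /CF[i /= iF Vx]; rewrite -bigcup_mkord; exists i => //=; exact: FN.
have oN n : open (\big[setU/set0]_(i < n) V i).
  by rewrite -bigcup_mkord; apply: bigcup_open.
have sumN n : inner_content (\big[setU/set0]_(i < n) V i) <=
    \sum_(i < n) inner_content (V i).
  elim: n => [|n IH]; last first.
    rewrite !big_ord_recr/=.
    apply: le_trans (inner_contentU_le (oN n) (oV n)) _.
    exact: leeD.
  by rewrite !big_ord0 -haar_outer_open ?haar_outer0//; exact: open0.
apply: le_trans (inner_content_ub cC CN) _; apply: le_trans (sumN N) _.
rewrite -(big_mkord xpredT (fun i => inner_content (V i))).
apply: nneseries_lim_ge => i _ _; exact: inner_content_ge0.
Qed.

Lemma haar_outer_sigma_subadditive : sigma_subadditive haar_outer.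
Proof.
move=> S; apply/lee_addgt0Pr => e e0.
have /choice[V VP] : forall n, exists V, [/\ open V, S n `<=` V &
    inner_content V < haar_outer (S n) + (e / (2 ^ n.+1)%:R)%:E].
  by move=> n; apply: haar_outer_approx; rewrite divr_gt0// ltr0n expn_gt0.
apply: le_trans (epsilon_trick xpredT (fun n => haar_outer_ge0 (S n)) (ltW e0)).
apply: (@le_trans _ _ (inner_content (\bigcup_n V n))).
  apply: haar_outer_le; first by apply: bigcup_open => n _; have [] := VP n.
  by apply: subset_bigcup => n _; have [] := VP n.
apply: le_trans (inner_content_bigcup_le _) _; first by move=> n; have [] := VP n.
apply: lee_nneseries => [n *|n *]; first exact: inner_content_ge0.
by have [_ _ /ltW] := VP n.
Qed.

HB.instance Definition _ := isOuterMeasure.Build R K haar_outer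
  haar_outer0 haar_outer_ge0 haar_outer_mono haar_outer_sigma_subadditive.

(** If [C] is closed in the intersection of [W] and [V], and [D] is closed in [W] minus [C], then
    [lamU] bounds the sum of their contents by that of [W]. The supremum over [D], then over [C],
    gives the splitting inequality. *)
Lemma haar_outer_open_caratheodory V : open V -> haar_outer.-caratheodory V.
Proof.
move=> oV; apply: le_caratheodory_measurable => S.
apply: le_ereal_inf_tmp => _ [W [oW SW] <-].
have oWV : open (W `&` V) by exact: openI.
apply: (@le_trans _ _ (inner_content (W `&` V) + haar_outer (W `&` ~` V))).
  apply: leeD; last exact: (haar_outer_mono (setSI SW)).
  by apply: haar_outer_le => //; exact: setSI.
rewrite -leeBrDr ?haar_outer_fin//; apply: ge_ereal_sup => _ [C [cC CWV] <-].
rewrite leeBrDr ?haar_outer_fin// -leeBrDl//.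
apply: (@le_trans _ _ (inner_content (W `&` ~` C))).
  apply: haar_outer_le; first by apply: openI => //; exact: closed_openC.
  by move=> x [Wx nVx]; split=> // /CWV[].
apply: ge_ereal_sup => _ [D [cD DWC] <-].
rewrite leeBrDl// -EFinD.
apply: (@le_trans _ _ (lam (C `|` D))%:E).
  rewrite lee_fin lamU//; apply/seteqP; split=> // x [Cx /DWC[_ /(_ Cx)]]//.
apply: inner_content_ub; first exact: closedU.
by move=> x [/CWV[]|/DWC[]].
Qed.

Lemma borel_caratheodory (A : set (borel K)) :
  measurable A -> haar_outer.-caratheodory A.
Proof.
move: A; apply: smallest_sub; last exact: haar_outer_open_caratheodory.
split.
- exact: caratheodory_measurable_set0.
- by move=> A mA; rewrite setTD; exact: caratheodory_measurable_setC.
- by move=> F mF; exact: caratheodory_measurable_bigcup.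
Qed.

Lemma haar_outer_sigma_additive :
  semi_sigma_additive (haar_outer : set (borel K) -> \bar R).
Proof.
move=> F mF tF mUF.
apply: (@caratheodory_measure_sigma_additive R K haar_outer) => //.
- by move=> i; apply: borel_caratheodory; exact: mF.
- exact: borel_caratheodory.
Qed.

Definition haar_measure_of : set (borel K) -> \bar R := haar_outer.

HB.instance Definition _ := isMeasure.Build _ _ _ haar_measure_of
  haar_outer0 haar_outer_ge0 haar_outer_sigma_additive.

Lemma haar_measureT : haar_measure_of setT = 1.
Proof.
apply/eqP; rewrite eq_le haar_outer_le1/= [haar_measure_of _]haar_outer_open.
  by have := @inner_content_ub setT setT closedT (@subset_refl _ _); rewrite lamT.
exact: openT.
Qed.

HB.instance Definition _ :=
  Measure_isProbability.Build _ _ _ haar_measure_of haar_measureT.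

Lemma haar_outer_mulgl_le g (A : set K) :
  haar_outer ((fun k => (g * k)%g) @^-1` A) <= haar_outer A.
Proof.
apply: le_ereal_inf_tmp => _ [V [oV AV] <-].
apply: (@le_trans _ _ (inner_content ((fun k => (g * k)%g) @^-1` V))).
  by apply: haar_outer_le; [exact: open_mulgl|exact: preimage_subset].
apply: ge_ereal_sup => _ [C [cC CV] <-].
apply: (@le_trans _ _ (lam ((fun k => (g^-1 * k)%g) @^-1` C))%:E); last first.
  apply: inner_content_ub; first exact: closed_mulgl.
  by move=> k /= /CV /=; rewrite mulVKg.
rewrite lee_fin; have := lam_mulgl ((fun k => (g^-1 * k)%g) @^-1` C) g.
by congr (lam _ <= _)%R; apply/seteqP; split=> k /=; rewrite mulKg.
Qed.

End HaarOuter.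

(** The underlying function is an outer measure, so both clauses are stated for arbitrary subsets.
    The outer regularity in the second one feeds the Steinhaus argument. *)
Theorem exists_haar_measure (R : realType) (K : topGroupType) :
  compact [set: K] -> hausdorff_space K ->
  exists m : probability (borel K) R,
    (forall g (A : set K), (m ((fun k => (g * k)%g) @^-1` A) = m A)%E) /\
    (forall (A : set K) (e : R), 0 < e ->
      exists V : set K, [/\ open V, A `<=` V & (m V < m A + e%:E)%E]).
Proof.
move=> Kc Kh; have [lam [[l0 lT] lge0 lle lUle [lU lM]]] := haar_content R Kc Kh.
exists (haar_measure_of lam).
split=> [g A|A e e0].
  apply/eqP; rewrite eq_le haar_outer_mulgl_le//=.
  have E : A = (fun k => (g^-1 * k)%g) @^-1` ((fun k => (g * k)%g) @^-1` A).
    by apply/seteqP; split=> k /=; rewrite mulVKg.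
  by rewrite {1}E; exact: haar_outer_mulgl_le.
have [V [oV AV VA]] := haar_outer_approx l0 lT lle A e0.
by exists V; split=> //; rewrite [X in (X < _)%E]haar_outer_open.
Unshelve. all: by [].
Qed.

(** * Measurable homomorphisms from a compact group to a countable group *)

Section CountableIndex.
Variables (R : realType) (K : topGroupType) (Gamma : groupType).
Hypothesis K_compact : compact [set: K].
Hypothesis Gamma_countable : countable [set: Gamma].
Variable f : K -> Gamma.
Hypothesis fM : forall k l, f (k * l)%g = (f k * f l)%g.
Hypothesis mf : forall s : Gamma, measurable (f @^-1` [set s] : set (borel K)).

Let N : set (borel K) := f @^-1` [set 1%g].

Let f1 : f 1%g = 1%g.
Proof. by apply: (mulgI (f 1%g)); rewrite -fM !mulg1. Qed.

Let fV k : f k^-1%g = (f k)^-1%g.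
Proof. by apply: (mulgI (f k)); rewrite -fM !mulgV. Qed.

Let fiber_translate g : f @^-1` [set f g] = (fun k => (g^-1 * k)%g) @^-1` N.
Proof.
apply/seteqP; split=> k; rewrite /N /= fM fV => fk; first by rewrite fk mulVg.
by apply: (mulgI (f g)^-1%g); rewrite fk mulVg.
Qed.

Variable m : probability (borel K) R.
Hypothesis m_mulgl : forall g (A : set K),
  (m ((fun k => (g * k)%g) @^-1` A) = m A)%E.
Hypothesis m_outer : forall (A : set K) (e : R), 0 < e ->
  exists V : set K, [/\ open V, A `<=` V & (m V < m A + e%:E)%E].

Let fiber_measure g : (m (f @^-1` [set f g]) = m N)%E.
Proof. by rewrite fiber_translate m_mulgl. Qed.

(** The nonempty fibers are translates of [N], hence of equal measure, and countably many of them
    cover a space of measure 1. *)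
Lemma kernel_measure_gt0 : (0 < m N)%E.
Proof.
rewrite lt0e measure_ge0 andbT; apply/eqP => mN.
have /countable_injP[e einj] := Gamma_countable.
have : m setT = 1%E by exact: probability_setT.
have -> : [set: borel K] = \bigcup_n (f @^-1` [set s | e s = n]).
  by apply/seteqP; split=> // k _; exists (e (f k)).
have null n : (m (f @^-1` [set s | e s = n]) = 0)%E.
  have [[k fk]|nk] := pselect (exists k, e (f k) = n); last first.
    rewrite [X in m X](_ : _ = set0) ?measure0//.
    by apply/seteqP; split=> // k fk; apply: nk; exists k.
  rewrite -mN -(fiber_measure k); congr (m _).
  apply/seteqP; split=> l /=; last by move=> ->.
  by move=> el; apply: einj; rewrite ?inE// el fk.
rewrite [X in X = _ -> _](_ : _ = 0%E); first by move=> /eqP; rewrite eq_sym onee_eq0.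
apply/eqP; rewrite eq_le measure_ge0 andbT.
have mn n : measurable (f @^-1` [set s | e s = n] : set (borel K)).
  have [[s es]|ns] := pselect (exists s, e s = n).
    rewrite [X in measurable X](_ : _ = f @^-1` [set s])//.
    apply/seteqP; split=> k /=; last by move=> ->.
    by move=> ek; apply: einj; rewrite ?inE// ek es.
  rewrite [X in measurable X](_ : _ = set0)//.
  by apply/seteqP; split=> // k ek; apply: ns; exists (f k).
apply: le_trans (measure_sigma_subadditive m mn _ (@subset_refl _ _)) _.
  exact: bigcup_measurable.
by rewrite eseries0// => n _ _; exact: null.
Qed.

(** The fibers are disjoint and of the same positive measure, so there are at most 1 / m(N) of
    them. *)
Lemma finite_range_of_measurable : finite_set (range f).
Proof.
apply: contrapT => infinite_f.
have mN0 := kernel_measure_gt0.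
have mNfin : (m N \is a fin_num)%E by apply: fin_num_measure; exact: mf.
have p0 : 0 < fine (m N) by rewrite fine_gt0// mN0 ltey_eq mNfin.
set n := (Num.truncn (fine (m N))^-1).+1.
have nP : 1 < fine (m N) * n%:R.
  by rewrite mulrC -ltr_pdivrMr// div1r Num.Theory.truncnS_gt.
have [F Ff Fn] := infinite_set_fset n infinite_f.
have : (m (\big[setU/set0]_(s <- F) (f @^-1` [set s])) <= 1)%E.
  by apply: probability_le1; apply: bigsetU_measurable => s _; exact: mf.
rewrite measure_fbigsetU//; last by move=> s t _ _ [k [/= <- <-]].
rewrite [X in (X <= _)%E](_ : _ = \sum_(s <- F) (fine (m N))%:E); last first.
  rewrite big_seq [RHS]big_seq; apply: eq_bigr => s /Ff[g _ <-].
  by rewrite fineK//; exact: fiber_measure.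
rewrite sumEFin lee_fin big_const_seq count_predT iter_addr_0 leNgt.
rewrite -mulr_natr (lt_le_trans nP)// ler_wpM2l ?(ltW p0)//.
by rewrite ler_nat.
Qed.

(* Steinhaus: if a compact set of positive measure lies in the kernel and its
   translates by a neighborhood of 1 meet it, then the neighborhood lies in
   the kernel. *)
Lemma kernel_nbhs1 : nbhs (1%g : K) N.
Proof.
have mN0 := kernel_measure_gt0.
have mN : measurable N by exact: mf.
have mNfin : (m N \is a fin_num)%E by apply: fin_num_measure; exact: mf.
have p0 : 0 < fine (m N) by rewrite fine_gt0// mN0 ltey_eq mNfin.
(* The precision m(N) gives m(V) < 1, so the complement of [V] is a compact subset of [N] of
   positive measure. *)
have [V [oV NV VN]] := m_outer (~` N) p0.
have mV : measurable (V : set (borel K)) by exact: sub_sigma_algebra.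
rewrite fineK// probability_setC// subeK// in VN.
pose C : set (borel K) := ~` V.
have mC : measurable C by exact: measurableC.
have CN : C `<=` N by move=> x nVx; apply: contrapT => /NV.
have mC0 : (0 < m C)%E by rewrite probability_setC// sube_gt0.
have mCfin : (m C \is a fin_num)%E by apply: fin_num_measure.
have q0 : 0 < fine (m C) by rewrite fine_gt0// mC0 ltey_eq mCfin.
(* Here m(W) < 2 m(C), so [W] has no room for two disjoint translates of [C]. *)
have [W [oW CW WC]] := m_outer C q0.
have mW : measurable (W : set (borel K)) by exact: sub_sigma_algebra.
rewrite fineK// in WC.
have cC : compact (C : set K).
  by apply: subclosed_compact K_compact _ => //; exact: open_closedC.
have : \forall u \near (1%g : K), (C : set K) `<=` (fun c : K => W (u * c)%g).
  move/compact_near_coveringP : cC; apply => c Cc.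
  have := @mulg_continuous K (1%g, c) W; rewrite /= mul1g => /(_ _)[].
    by apply: open_nbhs_nbhs; split=> //; exact: CW.
  move=> [P Q] /= [P1 Qc] PQ; exists (Q, P) => //= -[c' u] /= [Qc' Pu].
  exact: (PQ (u, c')).
apply: filterS => u uCW.
have [c [Cc Cuc]] : exists c, C c /\ C (u * c)%g.
  apply: contrapT => nC.
  pose uC : set (borel K) := (fun k : K => (u^-1 * k)%g) @^-1` C.
  have muC : measurable uC.
    rewrite /uC /C preimage_setC; apply: measurableC.
    by apply: sub_sigma_algebra; exact: open_mulgl.
  have CuC : C `&` uC = set0.
    apply/seteqP; split=> // k [Ck uCk]; apply: nC; exists (u^-1 * k)%g.
    by rewrite mulVKg.
  have : (m (C `|` uC) <= m W)%E.
    apply: le_measure; rewrite ?inE//; first exact: measurableU.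
    move=> k [/CW//|uCk]; rewrite -[k](mulVKg u).
    exact: uCW.
  rewrite measureU// [X in (_ + X)%E](_ : _ = m C); last exact: m_mulgl.
  by move=> /le_lt_trans /(_ WC); rewrite ltxx.
by move: (CN _ Cuc) (CN _ Cc); rewrite /N /= fM => + fc; rewrite fc mulg1.
Qed.

(** A subgroup containing a neighborhood of 1 is closed: each coset other than the subgroup is a
    neighborhood of its points. *)
Lemma kernel_closed : closed (N : set K).
Proof.
rewrite -[X in closed X]setCK; apply: open_closedC; rewrite openE => k nNk.
have : nbhs k ((fun l : K => (k^-1 * l)%g) @^-1` N).
  have := @mulgl_continuous K k^-1%g k N; rewrite /= mulVg; apply.
  exact: kernel_nbhs1.
apply: filterS => l Nkl Nl; apply: nNk; move: Nkl Nl.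
by rewrite /N /= fM fV => kl l1; move: kl;
  rewrite l1 mulg1 => /(congr1 (fun x => x^-1%g)); rewrite invgK invg1.
Qed.

End CountableIndex.

(** * Quotients by compact subgroups *)

Section MeasurabilityTools.
Variable R : realType.

Lemma standard_borel_separating d (Y : measurableType d) :
  standard_borel R Y -> exists B : nat -> set Y,
    (forall n, measurable (B n)) /\
    (forall y z, (forall n, B n y <-> B n z) -> y = z).
Proof.
move=> [P [f [g [[M [u [v [Mh [D cD dD] [uK vK] [cu cv]]]]] [fK gK] mf mg]]]].
have /countable_injP[e einj] := cD.
pose rad (n : nat) : R := n.+1%:R^-1.
have rad0 n : 0 < rad n by rewrite invr_gt0.
(* [e] is injective on [D], so this is at most one ball. The interior is taken because balls need
   not be open, and the doubled radius makes all points within [rad] of the center interior. *)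
pose U (q : nat * nat) : set M :=
  \bigcup_(z in [set z | D z /\ e z = q.1]) (ball z (rad q.2 + rad q.2))°.
pose B n : set Y := (u \o f) @^-1` odflt set0 (omap U (choice.unpickle n)).
exists B; split=> [n|y z BE].
  have oU : open (odflt set0 (omap U (choice.unpickle n))).
    case: (choice.unpickle n) => [q|]; last exact: open0.
    by apply: bigcup_open => z _; exact: open_interior.
  have : measurable (u @^-1` odflt set0 (omap U (choice.unpickle n)) :
      set (borel P)).
    by apply: sub_sigma_algebra; apply: open_comp => // x _; exact: cu.
  by move=> /(mf measurableT); rewrite setTI.
apply: (can_inj fK); apply: (can_inj uK).
have close_yz n : ball (u (f y)) (rad n + (rad n + rad n)) (u (f z)).
  have [w [/= yw Dw]] : (ball (u (f y)) (rad n))° `&` D !=set0.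
    apply: dD; last exact: open_interior.
    by exists (u (f y)); exact: nbhsx_ballx.
  have yw' : ball (u (f y)) (rad n) w by exact: interior_subset.
  have Uy : U (e w, n) (u (f y)).
    exists w => //; apply/nbhs_ballP; exists (rad n) => //= t yt.
    by apply: ball_triangle yt; exact: ball_sym.
  have := (BE (choice.pickle (e w, n))).1; rewrite /B /= choice.pickleK /=.
  move=> /(_ Uy) [w' [Dw' ew'] /interior_subset w'z].
  have ww' : w = w' by apply: einj; rewrite ?inE.
  by apply: ball_triangle yw' _; rewrite ww'.
apply: Mh => // A C Ay Cz.
have [r /= r0 rA] := (nbhs_ballP _ _).1 Ay.
pose n := Num.truncn (3 / r).
exists (u (f z)); split; last exact: nbhs_singleton.
apply: rA; apply: le_ball (close_yz n).
have : 3 / r < n.+1%:R by exact: Num.Theory.truncnS_gt.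
rewrite ltr_pdivrMr// mulrC -ltr_pdivrMr ?ltr0n// => /ltW; apply: le_trans.
by rewrite [leRHS](_ : _ = 3 * rad n)//; move: (rad n) => q; lra.
Qed.

(** Two points are equal when they lie in the same members of a countable separating family, so the
    equalizer is a countable intersection of measurable sets. *)
Lemma measurable_equalizer d d' (T : measurableType d) (Y : measurableType d')
    (D : set T) (f g : T -> Y) : standard_borel R Y -> measurable D ->
  measurable_fun D f -> measurable_fun D g ->
  measurable [set t | D t /\ f t = g t].
Proof.
move=> /standard_borel_separating[B [mB sepB]] mD mf mg.
have -> : [set t | D t /\ f t = g t] = D `&` \bigcap_n
    (((D `&` f @^-1` B n) `&` (D `&` g @^-1` B n)) `|`
     ((D `&` f @^-1` ~` B n) `&` (D `&` g @^-1` ~` B n))).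
  apply/seteqP; split=> t /=.
    move=> [Dt fg]; split=> // n _ /=; rewrite fg.
    by have [Bt|nBt] := pselect (B n (g t)); [left|right].
  move=> [Dt H]; split=> //; apply: sepB => n.
  by have [[[_ ft] [_ gt]]|[[_ ft] [_ gt]]] := H n I; split.
apply: measurableI => //; apply: bigcapT_measurable => n.
by apply: measurableU; apply: measurableI; (apply: mf || apply: mg) => //;
  exact: measurableC.
Qed.

End MeasurabilityTools.

Section CountableTools.
Variables (d : measure_display) (T : measurableType d).

Lemma countable_enum (G : groupType) : countable [set: G] ->
  exists en : nat -> G, forall g, exists n, en n = g.
Proof.
move=> /countable_injP[f finj].
have /choice[en enP] : forall n, exists s, forall t, f t = n -> t = s.
  move=> n; have [[s sn]|ns] := pselect (exists s, f s = n).
    by exists s => t tn; apply: finj; rewrite ?inE// tn sn.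
  by exists 1%g => t tn; exfalso; apply: ns; exists t.
by exists en => g; exists (f g); rewrite -(enP (f g) g).
Qed.

Lemma countable_bigcup_measurable (S : groupType) (F : S -> set T) :
  countable [set: S] -> (forall s, measurable (F s)) ->
  measurable (\bigcup_s F s).
Proof.
move=> cS mF; have [en enP] := countable_enum cS.
have -> : \bigcup_s F s = \bigcup_n F (en n).
  apply/seteqP; split=> x [s _ Fs]; last by exists (en s).
  by have [n ns] := enP s; exists n => //; rewrite ns.
exact: bigcupT_measurable.
Qed.

Lemma countable_bigcap_measurable (S : groupType) (F : S -> set T) :
  countable [set: S] -> (forall s, measurable (F s)) ->
  measurable (\bigcap_s F s).
Proof.
move=> cS mF; rewrite -[X in measurable X]setCK setC_bigcap; apply: measurableC.
by apply: countable_bigcup_measurable => // s; exact: measurableC.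
Qed.

Variables (R : realType) (mu : probability T R).

Lemma ae_setT_measurable (P : set T) : (\forall x \ae mu, P x) ->
  exists2 E, measurable E & mu E = 1%E /\ E `<=` P.
Proof.
move=> [N [mN N0 PN]]; exists (~` N); first exact: measurableC.
split; last by move=> x nNx; apply: contrapT => /PN.
by rewrite probability_setC// N0 sube0.
Qed.

Lemma measure1_ae (E : set T) : measurable E -> mu E = 1%E -> \forall x \ae mu, E x.
Proof.
move=> mE E1; exists (~` E); split=> //; first exact: measurableC.
by rewrite probability_setC// E1 subee.
Qed.

Lemma ae_forall_group (S : groupType) (P : S -> T -> Prop) :
  countable [set: S] -> (forall s, \forall x \ae mu, P s x) ->
  \forall x \ae mu, forall s, P s x.
Proof.
move=> cS aeP; have [en enP] := countable_enum cS.
have : \forall x \ae mu, forall n, P (en n) x by apply: ae_foralln => n.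
by apply: filterS => x H s; have [n <-] := enP s.
Qed.

Lemma ae_ex (P : set T) : (\forall x \ae mu, P x) -> exists x, P x.
Proof.
move=> /ae_setT_measurable[E mE [E1 EP]].
have /set0P[x Ex] : E != set0.
  by apply/eqP => E0; move: E1; rewrite E0 measure0 => /eqP; rewrite eq_sym onee_eq0.
by exists x; exact: EP.
Qed.

Lemma ae_preimage (f : T -> T) (P : set T) : measurable_fun setT f ->
  (forall A, measurable A -> mu (f @^-1` A) = mu A) ->
  (\forall x \ae mu, P x) -> \forall x \ae mu, P (f x).
Proof.
move=> mf muf [N [mN N0 PN]]; exists (f @^-1` N); split.
- by rewrite -[X in measurable X]setTI; exact: mf.
- by rewrite muf.
- by move=> x /= Pfx; exact: PN.
Qed.

End CountableTools.

(** * Orbit spaces and the quotients X^N *)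

Section OrbitSpaceTheory.
Variables (H : groupType) (T : Type) (a : H -> T -> T) (S : set H).
Hypotheses (a1 : forall x, a 1%g x = x)
  (aM : forall g h x, a (g * h)%g x = a g (a h x)).
Hypotheses (S1 : S 1%g) (SM : forall g h, S g -> S h -> S (g * h)%g)
  (SV : forall g, S g -> S g^-1%g).

Lemma orbit_piP x y :
  orbit_pi a S x = orbit_pi a S y <-> exists2 h, S h & y = a h x.
Proof.
split=> [/(congr1 sval)/= E|[h Sh ->]].
  have : orbit_of a S y y by exists 1%g.
  by rewrite -E => -[h Sh <-]; exists h.
apply/eq_exist/seteqP; split=> _ [g Sg <-].
  by exists (g * h^-1)%g; [exact/SM/SV|rewrite -aM mulgVK].
by exists (g * h)%g; [exact: SM|rewrite aM].
Qed.

End OrbitSpaceTheory.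

Section FixedQuotientTheory.
Variables (G K : groupType) (d : measure_display) (X : measurableType d).
Variable a : G * K -> X -> X.
Hypotheses (a1 : forall x, a 1%g x = x)
  (aM : forall g h x, a (g * h)%g x = a g (a h x)).

Lemma act_pairM g k g' k' x : a (g, k) (a (g', k') x) = a (g * g', k * k')%g x.
Proof. by rewrite -aM. Qed.

Lemma act_pair g k x : a (g, k) x = a (1%g, k) (a (g, 1%g) x).
Proof. by rewrite act_pairM mul1g mulg1. Qed.

Lemma act_comm g k x : a (1%g, k) (a (g, 1%g) x) = a (g, 1%g) (a (1%g, k) x).
Proof. by rewrite !act_pairM !mul1g !mulg1. Qed.

Section Subgroup.
Variable N : set K.
Hypotheses (N1 : N 1%g) (NM : forall k l, N k -> N l -> N (k * l)%g)
  (NV : forall k, N k -> N k^-1%g).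

Lemma fixed_piP x y :
  fixed_pi a N x = fixed_pi a N y <-> exists2 k, N k & y = a (1%g, k) x.
Proof.
have P := @orbit_piP (G * K)%type X a ([set 1%g] `*` N) a1 aM.
split=> [/P[]|[k Nk ->]].
- by split.
- by move=> [g k] [g' l] [/= -> Nk] [-> Nl]; split; rewrite /= ?mulg1//; exact: NM.
- by move=> [g k] [/= -> Nk]; split; rewrite /= ?invg1//; exact: NV.
- by move=> [g k] [/= -> Nk] ->; exists k.
apply/P.
- by split.
- by move=> [g l] [g' l'] [/= -> Nl] [-> Nl']; split; rewrite /= ?mulg1//; exact: NM.
- by move=> [g l] [/= -> Nl]; split; rewrite /= ?invg1//; exact: NV.
- by exists (1%g, k).
Qed.

Lemma fixed_reprP x : exists2 k, N k & fixed_repr (fixed_pi a N x) = a (1%g, k) x.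
Proof. by apply/fixed_piP; rewrite /fixed_repr /fixed_pi orbit_reprK. Qed.

End Subgroup.

Lemma fixed_piT x y :
  fixed_pi a setT x = fixed_pi a setT y <-> exists k, y = a (1%g, k) x.
Proof.
by split=> [/fixed_piP[]// k _ ->|[k ->]]; [exists k|apply/fixed_piP => //; exists k].
Qed.

Lemma fixed_actionE g x :
  fixed_action a setT g (fixed_pi a setT x) = fixed_pi a setT (a (g, 1%g) x).
Proof.
have [//|//|//|k _ E] := @fixed_reprP setT _ _ _ x.
by apply/esym/fixed_piT; exists k; rewrite E act_comm.
Qed.

Lemma fixed_quotient_actionE (N : normal_subgroup K) g k x :
  fixed_quotient_action a N (g, coset_pi N k) (fixed_pi a N x) =
  fixed_pi a N (a (g, k) x).
Proof.
have [n Nn E] := fixed_reprP (@normal1 _ N) (@normalM _ N) (@normalV _ N) x.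
rewrite /fixed_quotient_action E /=.
have /coset_piP Nk : coset_pi N k = coset_pi N (coset_repr (coset_pi N k)).
  by rewrite coset_reprK.
apply/esym/fixed_piP; [exact: normal1|exact: normalM|exact: normalV|].
move: Nk; set k' := coset_repr _ => Nk.
exists (k * (k^-1 * k' * n) * k^-1)%g.
  by apply: normalJ; exact: normalM.
by rewrite !act_pairM !mul1g !mulg1 !mulgA mulgV mul1g mulgVK.
Qed.

Lemma measurable_fixed_pi (N : set K) : measurable_fun setT (fixed_pi a N).
Proof. by move=> _ B mB; rewrite setTI. Qed.

End FixedQuotientTheory.

(** * The lift of the stable orbit equivalence *)

Section LiftedEquivalence.
Variables (R : realType) (G : groupType) (K : groupType).
Variables (d : measure_display) (X : measurableType d) (mu : probability X R).
Variable a : G * K -> X -> X.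
Hypothesis a_pmp : pmp_action mu a.
Hypothesis GK_free : essentially_free (fixed_measure mu a [set: K])
  (fixed_action a [set: K]).
Variables (Gamma : groupType) (d' : measure_display) (Y : measurableType d').
Variables (eta : probability Y R) (b : Gamma -> Y -> Y).
Hypotheses (Y_standard : standard_borel R Y) (b_free : essentially_free eta b).
Variables (A : set (fixed_quotient a [set: K])) (B : set Y).
Variable pi : fixed_quotient a [set: K] -> Y.
Hypothesis pi_soe : stable_orbit_equivalence (fixed_measure mu a [set: K]) eta
  (fixed_action a [set: K]) b A B pi.

Let q := fixed_pi a [set: K].
Let zeta := fixed_measure mu a [set: K].
Let a1 : forall x, a 1%g x = x. Proof. by case: a_pmp. Qed.
Let aM : forall g h x, a (g * h)%g x = a g (a h x). Proof. by case: a_pmp. Qed.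

(** All properties become exact after removing from [A] a null set: where orbits do not match, where
    [pi'] does not invert [pi], and where one of the two actions is not free. [Ah] is the preimage
    of the rest, hence [K]-invariant. *)
Lemma lifted_equivalence : exists (Ah : set X) (ph : X -> Y),
  [/\ [/\ measurable Ah, (0 < mu Ah)%E, mu (q @^-1` A `\` Ah) = 0%E,
          Ah `<=` q @^-1` A & forall k x, Ah x -> Ah (a (1%g, k) x)],
      measurable_fun Ah ph /\ (forall x, ph x = pi (q x)),
      (forall x s, Ah x -> b s (ph x) = ph x -> s = 1%g) /\
      (forall x g, Ah x -> (exists k, a (g, k) x = x) -> g = 1%g),
      (forall x x', Ah x -> Ah x' ->
        (exists t, ph x' = b t (ph x)) <-> (exists h, x' = a h x)) /\
      (forall x x', Ah x -> Ah x' -> ph x = ph x' ->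
        exists k, x' = a (1%g, k) x) &
      forall E, measurable E -> E `<=` Ah ->
        (forall k x, E x -> E (a (1%g, k) x)) ->
        measurable (ph @` E) /\ (eta (ph @` E) * zeta A = mu E * eta B)%E].
Proof.
have [[mA mB A0 B0] [mpi [pi' [mpi' piK pi'K]]] pi_scale
  [A0' [mA0 A0A nullA0 soe]]] := pi_soe.
have qK k x : q (a (1%g, k) x) = q x by apply/esym/fixed_piT => //; exists k.
have zetaE E : zeta E = mu (q @^-1` E) by [].
have etaB_fin : (eta B \is a fin_num)%E by apply: fin_num_measure.
have [N1 [mN1 N10 N1P]] := piK; have [N2 [mN2 N20 N2P]] := b_free.
have [N3 [mN3 N30 N3P]] := GK_free.
have mpiN2 : measurable (A `&` pi @^-1` (N2 `&` B)).
  by apply: mpi => //; exact: measurableI.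
(* Freeness is known outside of a null set of [Y]; the scaling of measures pulls that set back to a
   null set of [A]. *)
have piN2 : zeta (A `&` pi @^-1` (N2 `&` B)) = 0%E.
  have := pi_scale (N2 `&` B) (measurableI _ _ mN2 mB) (@subIsetr _ _ _).
  have -> : eta (N2 `&` B) = 0%E.
    by apply: (subset_measure0 _ mN2 _ N20); [exact: measurableI|exact: subIsetl].
  rewrite mul0e => /eqP; rewrite mule_eq0 => /orP[/eqP//|/eqP B0'].
  by rewrite B0' ltxx in B0.
pose A1 := A0' `\` N1 `\` (A `&` pi @^-1` (N2 `&` B)) `\` N3.
have mA1 : measurable A1 by do 3 (apply: measurableD => //).
have A1A : A1 `<=` A by move=> z [[[/A0A]]].
have A1P z : A1 z -> [/\ A0' z, B (pi z), pi' (pi z) = z,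
    (forall s, b s (pi z) = pi z -> s = 1%g) &
    (forall g, fixed_action a setT g z = z -> g = 1%g)].
  move=> [[[A0z nN1] nN2] nN3].
  have [Bz zK] : B (pi z) /\ pi' (pi z) = z.
    by apply: contrapT => nz; apply: nN1; apply: N1P => /= H; exact/nz/H/A0A.
  split=> //.
  - move=> s bs; apply: contrapT => s1; apply: nN2; split; first exact: A0A.
    by split=> //; apply: N2P => /= H; exact/s1/H.
  - move=> g gz; apply: contrapT => g1; apply: nN3; apply: N3P => /= H.
    exact/g1/H.
have mq E : measurable E -> measurable (q @^-1` E : set X) by [].
have zeta_nullU E F : measurable E -> measurable F -> zeta E = 0%E ->
    zeta F = 0%E -> zeta (E `|` F) = 0%E.
  move=> mE mF E0 F0; rewrite zetaE preimage_setU.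
  exact: null_set_setU.
have A1null : zeta (A `\` A1) = 0%E.
  pose Nn := (A `\` A0') `|` N1 `|` (A `&` pi @^-1` (N2 `&` B)) `|` N3.
  have mNn : measurable Nn.
    by do 3 (apply: measurableU => //); exact: measurableD.
  have Nn0 : zeta Nn = 0%E.
    have m1 : measurable (A `\` A0') by exact: measurableD.
    apply: (zeta_nullU) => //; first by do 2 (apply: measurableU => //).
    apply: (zeta_nullU) => //; first by apply: measurableU.
    exact: zeta_nullU.
  rewrite zetaE; apply: (subset_measure0 _ (mq _ mNn) _ Nn0).
    by apply: mq; exact: measurableD.
  move=> x [Ax nA1]; apply: contrapT => nNn; apply: nA1.
  split; [split; [split|]|] => //.
  - by apply: contrapT => nA0; apply: nNn; left; left; left.
  - by move=> H; apply: nNn; left; left; right.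
  - by move=> H; apply: nNn; left; right.
  - by move=> H; apply: nNn; right.
have zeta_A1 E : measurable E -> E `<=` A -> zeta (E `&` A1) = zeta E.
  move=> mE EA; rewrite !zetaE; apply/eqP; rewrite eq_le; apply/andP; split.
    apply: le_measure; rewrite ?inE; [|exact: mq|by move=> x []].
    by apply: mq; exact: measurableI.
  rewrite -[leRHS]adde0 -A1null zetaE.
  apply: le_trans (measureU2 _ _ _); last 2 first.
  - by apply: mq; exact: measurableI.
  - by apply: mq; exact: measurableD.
  apply: le_measure; rewrite ?inE; [exact: mq| |].
    by apply: measurableU; apply: mq; [exact: measurableI|exact: measurableD].
  move=> x Ex; have [A1x|nA1x] := pselect (A1 (q x)); [left|right] => //.
  by split=> //; exact: EA.
exists (q @^-1` A1), (pi \o q); split.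
- split; first exact: mq.
  + rewrite -zetaE (_ : zeta A1 = zeta A)// -(zeta_A1 A)//; congr (zeta _).
    by apply/seteqP; split=> [z A1z|z []//]; split=> //; exact: A1A.
  + exact: A1null.
  + by move=> x /A1A.
  + by move=> k x; rewrite /= qK.
- split=> // mA1' F mF.
  have -> : q @^-1` A1 `&` (pi \o q) @^-1` F =
      q @^-1` (A1 `&` (A `&` pi @^-1` F)).
    by apply/seteqP; split=> x /= [A1x]; [split=> //; split=> //; exact: A1A|case].
  by apply: mq; apply: measurableI => //; exact: mpi.
- split=> [x s /A1P[_ _ _ + _]|x g /A1P[_ _ _ _ gf] [k gk]]; first exact.
  by apply: gf; rewrite fixed_actionE// -[in RHS]gk -[LHS](qK k) -act_pair.
- split=> [x x' /A1P[Ax _ _ _ _] /A1P[Ax' _ _ _ _]|x x' /A1P[_ _ xK _ _]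
    /A1P[_ _ x'K _ _] /= E].
    have [so so'] := soe _ _ Ax Ax'; split=> [[t tE]|[[g k] x'E]].
      have [g] := so' (ex_intro _ t tE); rewrite fixed_actionE// => /fixed_piT.
      move=> /(_ a1 aM)[k kE]; exists (g, k^-1)%g.
      have := congr1 (a (1%g, k^-1%g)) kE.
      rewrite !(act_pairM aM) !mulg1 !mulVg !mul1g => ->.
      by rewrite -[LHS]a1.
    have [|t tE] := so; last by exists t.
    by exists g; rewrite fixed_actionE// x'E (act_pair aM) qK.
  by apply/(fixed_piT a1 aM); rewrite -/q -xK E x'K.
- move=> E mE EA1 EK; pose Eb := q @` E.
  have qEb : q @^-1` Eb = E.
    apply/seteqP; split=> x; last by move=> Ex; exists x.
    by move=> [x' Ex' /(fixed_piT a1 aM)[k ->]]; exact: EK.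
  have mEb : measurable Eb by rewrite /measurable/= /orbit_measurable/= qEb.
  have EbA1 : Eb `<=` A1 by move=> _ [x Ex <-]; exact: EA1.
  (* The image of [E] consists of the [y] in [B] with [pi' y] in [Eb] and [pi (pi' y) = y], a
     measurable equalizer. *)
  pose D' := B `&` pi' @^-1` Eb.
  have mD' : measurable D' by exact: mpi'.
  pose F := [set y | D' y /\ (pi \o pi') y = id y].
  have mF : measurable F.
    apply: measurable_equalizer Y_standard mD' _ (@measurable_id _ _ _).
    apply: (measurable_comp mA) mpi _.
      by move=> _ [y [_ Ey] <-]; exact/A1A/EbA1.
    by apply: measurable_funS mpi' => // y [].
  have phE : (pi \o q) @` E = F.
    apply/seteqP; split=> [_ [x Ex <-]|y [[By Ey] /= yE]].
      have [_ Bx xK _ _] := A1P _ (EA1 _ Ex).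
      by split; [split=> //|]; rewrite /= xK//; exists x.
    by have [x Ex xE] := Ey; exists x; rewrite //= xE.
  rewrite phE; split=> //; rewrite -pi_scale//; last by move=> y [[]].
  congr (_ * _)%E; rewrite -/zeta -(zeta_A1 (A `&` pi @^-1` F)); last 2 first.
  - exact: mpi.
  - by move=> z [].
  rewrite zetaE; congr (mu _); rewrite -[in RHS]qEb; congr (_ @^-1` _).
  apply/seteqP; split=> [z [[Az [[_ Ez] _]] /A1P[_ _ zK _ _]]|z Ez].
    by rewrite -zK.
  have A1z := EbA1 _ Ez; have [_ Bz zK _ _] := A1P _ A1z.
  split=> //; split; first exact: A1A.
  by split; [split=> //|]; rewrite /= zK.
Qed.

End LiftedEquivalence.

(** * Weak mixing and the orbit cocycle *)

Lemma ae_measure1 (R : realType) d (T : measurableType d)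
    (mu : probability T R) (P : set T) : measurable P ->
  (\forall x \ae mu, P x) -> mu P = 1%E.
Proof.
move=> mP /ae_setT_measurable[E mE [E1 EP]].
apply/eqP; rewrite eq_le probability_le1//= -E1.
by apply: le_measure; rewrite ?inE.
Qed.

Section WeakMixingTheory.
Variables (R : realType) (G : groupType) (d : measure_display).
Variables (X : measurableType d) (mu : probability X R) (a : G -> X -> X).
Hypothesis ma : forall g, measurable_fun setT (a g).
Hypothesis wm : weakly_mixing mu a.

(** The square of an invariant set is invariant under the diagonal action, so mu(E)^2 is 0 or 1. *)
Lemma weakly_mixing_ergodic (E : set X) : measurable E ->
  (forall g x, E (a g x) <-> E x) -> (0 < mu E)%E -> mu E = 1%E.
Proof.
move=> mE EG E0.
have EEG g : ((fun p : X * X => (a g p.1, a g p.2)) @^-1` (E `*` E)) `+` (E `*` E)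
    = set0.
  rewrite (_ : _ @^-1` _ = E `*` E) ?setYK//.
  by apply/seteqP; split=> -[x y] /= [/EG Ex /EG Ey].
have [||H|H] := wm (A := E `*` E).
- exact: measurableX.
- by move=> g; rewrite EEG measure0.
- move: H; rewrite product_measure1E// => /eqP; rewrite mule_eq0 orbb => /eqP E00.
  by rewrite E00 ltxx in E0.
move: H; rewrite product_measure1E// => EE1.
apply/eqP; rewrite eq_le probability_le1//= -EE1.
by rewrite -[leRHS]mule1; apply: lee_wpmul2l => //; exact: probability_le1.
Qed.

Variables (S : groupType) (F : X -> S) (c : G -> S -> S).
Hypothesis S_countable : countable [set: S].
Hypothesis mF : forall s, measurable (F @^-1` [set s]).
Hypothesis c_inj : forall g, injective (c g).
Hypothesis FG : forall g, \forall x \ae mu, F (a g x) = c g (F x).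

Lemma exists_fiber_gt0 : exists s, (0 < mu (F @^-1` [set s]))%E.
Proof.
apply: contrapT => H.
have F0 s : mu (F @^-1` [set s]) = 0%E.
  apply/eqP; rewrite eq_le measure_ge0 andbT leNgt; apply/negP => s0.
  by apply: H; exists s.
have : \forall x \ae mu, forall s, F x <> s.
  apply: (ae_forall_group S_countable) => s; exists (F @^-1` [set s]).
  by split=> // x /= /contrapT.
by move=> /ae_ex[x /(_ (F x))].
Qed.

(** Injectivity of [c g] makes the set [D] of pairs with equal values of [F] invariant under the
    diagonal action. It contains the square of a non-null fiber, hence is conull, and then the
    complement of that fiber is null. *)
Lemma weakly_mixing_constant : exists s, \forall x \ae mu, F x = s.
Proof.
have [s s0] := exists_fiber_gt0; exists s.
pose D := \bigcup_t ((F @^-1` [set t]) `*` (F @^-1` [set t])).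
have mD : measurable D.
  by apply: countable_bigcup_measurable => // t; exact: measurableX.
have DE p : D p <-> F p.1 = F p.2.
  by split=> [[t _ [/= -> ->]]|E]//; exists (F p.2).
have Dinv g : (mu \x mu)%E
    (((fun p : X * X => (a g p.1, a g p.2)) @^-1` D) `+` D) = 0%E.
  have [N [mN N0 NP]] := FG g.
  have mag : measurable_fun setT (fun p : X * X => (a g p.1, a g p.2)).
    apply/measurable_fun_pair => /=.
      by apply: (measurableT_comp (ma g)); exact: measurable_fst.
    by apply: (measurableT_comp (ma g)); exact: measurable_snd.
  have mpre : measurable ((fun p : X * X => (a g p.1, a g p.2)) @^-1` D).
    by rewrite -[X in measurable X]setTI; exact: mag.
  apply: (@subset_measure0 _ _ _ _ _ ((N `*` setT) `|` (setT `*` N))).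
  - by apply: measurableU; exact: measurableD.
  - by apply: measurableU; exact: measurableX.
  - move=> -[x y] H; apply: contrapT => nN.
    have Fx : F (a g x) = c g (F x).
      by apply: contrapT => nx; apply: nN; left; split=> //; exact: NP.
    have Fy : F (a g y) = c g (F y).
      by apply: contrapT => ny; apply: nN; right; split=> //; exact: NP.
    case: H => -[]; rewrite /= !DE /= Fx Fy; first by move=> /c_inj.
    by move=> -> /(_ erefl).
  - apply: null_set_setU; do ?exact: measurableX.
      by rewrite [LHS]product_measure1E// [X in (X * _)%E]N0 mul0e.
    by rewrite [LHS]product_measure1E// [X in (_ * X)%E]N0 mule0.
have mFs := mF s.
have D1 : (mu \x mu)%E D = 1%E.
  have [D0|//] := wm mD Dinv.
  have : ((mu \x mu)%E ((F @^-1` [set s]) `*` (F @^-1` [set s])) <= (mu \x mu)%E D)%E.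
    by apply: le_measure; rewrite ?inE//; [exact: measurableX|move=> p Fp; exists s].
  rewrite D0 product_measure1E//; rewrite leNgt; case/negP.
  exact: mule_gt0.
have : (mu \x mu)%E ((F @^-1` [set s]) `*` ~` (F @^-1` [set s])) = 0%E.
  apply: (@subset_measure0 _ _ _ _ _ (~` D)).
  - by apply: measurableX => //; exact: measurableC.
  - exact: measurableC.
  - by move=> [x y] [/= Fx Fy] /DE /= xy; apply: Fy; rewrite /= -xy.
  - have := @probability_setC _ _ _ (mu \x mu)%E D mD.
    by rewrite [X in (1 - X)%E]D1 subee.
rewrite product_measure1E//; last exact: measurableC.
move=> /eqP; rewrite mule_eq0 => /orP[/eqP s00|/eqP sC].
  by rewrite s00 ltxx in s0.
by exists (~` (F @^-1` [set s])); split=> //; exact: measurableC.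
Qed.

End WeakMixingTheory.

Definition first (P : nat -> Prop) : nat :=
  if pselect (exists n, `[< P n >]) is left e then ex_minn e else 0.

Lemma firstP (P : nat -> Prop) : (exists n, P n) ->
  P (first P) /\ forall n, P n -> (first P <= n)%N.
Proof.
move=> [n Pn]; rewrite /first; case: pselect => [e|[]]; last first.
  by exists n; apply/asboolP.
case: ex_minnP => m /asboolP Pm mmin; split=> // k Pk.
by apply: mmin; apply/asboolP.
Qed.

Lemma first_eqP (P : nat -> Prop) n : (exists n, P n) ->
  first P = n <-> P n /\ forall i, (i < n)%N -> ~ P i.
Proof.
move=> /firstP[PP Pmin]; split=> [<-|[Pn nP]].
  by split=> // i iP /Pmin; rewrite leqNgt iP.
apply/eqP; rewrite eqn_leq Pmin//= leqNgt; apply/negP => /nP; exact.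
Qed.

(** * The Zimmer cocycle and its untwisting *)

Section Untwisting.
Variables (R : realType) (G : groupType) (K : topGroupType).
Variables (d : measure_display) (X : measurableType d) (mu : probability X R).
Variable a : G * K -> X -> X.
Hypothesis a_pmp : pmp_action mu a.
Hypothesis G_mixing : weakly_mixing mu (fun g => a (g, 1%g)).
Hypothesis G_superrigid : cocycle_superrigid mu (fun g => a (g, 1%g)).
Variables (Gamma : groupType) (d' : measure_display) (Y : measurableType d').
Variables (eta : probability Y R) (b : Gamma -> Y -> Y).
Hypotheses (Gamma_countable : countable [set: Gamma])
  (G_countable : countable [set: G]).
Hypotheses (Y_standard : standard_borel R Y) (b_pmp : pmp_action eta b).
Variables (Ah : set X) (ph : X -> Y).
Hypotheses (mAh : measurable Ah) (Ah_gt0 : (0 < mu Ah)%E)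
  (AhK : forall k x, Ah x -> Ah (a (1%g, k) x))
  (mph : measurable_fun Ah ph)
  (phK : forall k x, ph (a (1%g, k) x) = ph x)
  (ph_free : forall x s, Ah x -> b s (ph x) = ph x -> s = 1%g)
  (ph_orbit : forall x x', Ah x -> Ah x' ->
    (exists t, ph x' = b t (ph x)) <-> (exists h, x' = a h x)).
Variable en : nat -> G.
Hypothesis enP : forall g, exists n, en n = g.

Let a1 : forall x, a 1%g x = x. Proof. by case: a_pmp. Qed.
Let aM : forall g h x, a (g * h)%g x = a g (a h x). Proof. by case: a_pmp. Qed.
Let ma : forall h, measurable_fun setT (a h). Proof. by case: a_pmp. Qed.
Let mua : forall h A, measurable A -> mu (a h @^-1` A) = mu A.
Proof. by case: a_pmp. Qed.
Let b1 : forall y, b 1%g y = y. Proof. by case: b_pmp. Qed.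
Let bM : forall s t y, b (s * t)%g y = b s (b t y). Proof. by case: b_pmp. Qed.
Let mb : forall s, measurable_fun setT (b s). Proof. by case: b_pmp. Qed.

Lemma act_inj h : injective (a h).
Proof. by move=> x y /(congr1 (a h^-1%g)); rewrite -!aM mulVg !a1. Qed.

Lemma AhKE k x : Ah (a (1%g, k) x) <-> Ah x.
Proof.
split=> [|]; last exact: AhK.
move=> /(AhK k^-1%g); rewrite (act_pairM aM) mulVg mul1g.
by rewrite [a _ _]a1.
Qed.

(* transversal_map extends ph from Ah to sweep, up to orbits: it moves x into Ah
   by the first possible element of G. Its cocycle is the Zimmer cocycle. *)
Definition visits x n : Prop := Ah (a (en n, 1%g) x).
Definition sweep : set X := [set x | exists n, visits x n].
Definition visit_time x : nat := first (visits x).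
Definition transversal_map x : Y := ph (a (en (visit_time x), 1%g) x).

Local Notation X0 := sweep.
Local Notation p := transversal_map.

Lemma mact_preimage h E : measurable E -> measurable (a h @^-1` E).
Proof. by move=> mE; rewrite -[X in measurable X]setTI; exact: ma. Qed.

Lemma sweepE x : X0 x <-> exists g, Ah (a (g, 1%g) x).
Proof.
split=> [[n xn]|[g xg]]; first by exists (en n).
by have [n ng] := enP g; exists n; rewrite /visits ng.
Qed.

Lemma measurable_sweep : measurable X0.
Proof.
rewrite [X in measurable X](_ : _ = \bigcup_n (a (en n, 1%g) @^-1` Ah)).
  by apply: bigcupT_measurable => n; exact: mact_preimage.
by apply/seteqP; split=> x [n]; [exists n|move=> _; exists n].
Qed.

Lemma visits_act k x : visits (a (1%g, k) x) = visits x.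
Proof.
apply/funext => n; apply/propext.
by rewrite /visits -(act_comm aM); exact: AhKE.
Qed.

Lemma sweep_act h x : X0 (a h x) <-> X0 x.
Proof.
case: h => g k; rewrite (act_pair aM) /sweep /= visits_act.
split=> /sweepE[g' xg']; apply/sweepE.
  by exists (g' * g)%g; rewrite (act_pairM aM) mulg1 in xg'.
by exists (g' * g^-1)%g; rewrite (act_pairM aM) mulg1 mulgVK.
Qed.

(** [sweep] is the [G]-saturation of the non-null set [Ah], so ergodicity applies. *)
Lemma sweep_full : mu X0 = 1%E.
Proof.
apply: (weakly_mixing_ergodic (a := fun g => a (g, 1%g))) => //.
- exact: measurable_sweep.
- by move=> g x; exact: sweep_act.
- apply: lt_le_trans Ah_gt0 _; apply: le_measure; rewrite ?inE//.
    exact: measurable_sweep.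
  by move=> x Ax; apply/sweepE; exists 1%g; rewrite [a _ _]a1.
Qed.

Lemma visit_time_act k x : visit_time (a (1%g, k) x) = visit_time x.
Proof. by rewrite /visit_time visits_act. Qed.

Lemma transversal_map_act k x : p (a (1%g, k) x) = p x.
Proof. by rewrite /p visit_time_act -(act_comm aM) phK. Qed.

Lemma visit_timeP x : X0 x -> Ah (a (en (visit_time x), 1%g) x).
Proof. by move=> /firstP[]. Qed.

Lemma transversal_map_free x s t : X0 x -> b s (p x) = b t (p x) -> s = t.
Proof.
move=> /visit_timeP/ph_free xfree st; apply: (mulgI t^-1%g); rewrite mulVg.
by apply: xfree; rewrite bM st -bM mulVg b1.
Qed.

Lemma transversal_map_orbit x x' : X0 x -> X0 x' ->
  (exists t, p x' = b t (p x)) <-> (exists h, x' = a h x).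
Proof.
move=> /visit_timeP Ax /visit_timeP Ax'; rewrite (ph_orbit Ax Ax').
set g := en _; set g' := en _; split=> -[h hE].
  exists ((g, 1)^-1 * (h * (g', 1)))%g.
  by rewrite !aM -hE -aM mulVg a1.
exists ((g, 1) * (h * (g', 1)^-1))%g.
by rewrite hE -!aM -!mulgA mulVg mulg1.
Qed.

Lemma measurable_visit n : measurable [set x | X0 x /\ visit_time x = n].
Proof.
rewrite [X in measurable X](_ : _ = (a (en n, 1%g) @^-1` Ah) `&`
    \bigcap_i (if (i < n)%N then ~` (a (en i, 1%g) @^-1` Ah) else setT)).
  apply: measurableI; first exact: mact_preimage.
  apply: bigcapT_measurable => i; case: ifP => // _.
  by apply: measurableC; exact: mact_preimage.
apply/seteqP; split=> x /=.
  move=> [X0x /(first_eqP _ X0x)[xn nx]]; split=> // i _.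
  by case: ifP => // /nx.
move=> [xn nx]; have X0x : X0 x by exists n.
split=> //; apply/(first_eqP _ X0x); split=> // i ilt.
by have := nx i I; rewrite ilt.
Qed.

Lemma measurable_transversal_map : measurable_fun X0 p.
Proof.
move=> _ F mF.
rewrite [X in measurable X](_ : _ = \bigcup_n ([set x | X0 x /\ visit_time x = n]
    `&` a (en n, 1%g) @^-1` (Ah `&` ph @^-1` F))).
  apply: bigcupT_measurable => n; apply: measurableI; first exact: measurable_visit.
  by apply: mact_preimage; exact: mph.
apply/seteqP; split=> x /=.
  by move=> [X0x Fx]; exists (visit_time x) => //; split=> //; split=> //; exact: visit_timeP.
by move=> [n _ [[X0x <-] [_ Fx]]].
Qed.

(** On [sweep] the chosen [s] is unique by freeness. The default 1 is the source of the complement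
    of [sweep] in [measurable_orbit_cocycle]. *)
Definition orbit_cocycle (g : G) (x : X) : Gamma :=
  if pselect (X0 x /\ exists s, p (a (g, 1%g) x) = b s (p x)) is left e
  then sval (cid e.2) else 1%g.

Local Notation w := orbit_cocycle.

Lemma orbit_cocycleP g x : X0 x -> p (a (g, 1%g) x) = b (w g x) (p x).
Proof.
move=> X0x; rewrite /w; case: pselect => [e|[]]; first by case: cid.
split=> //; apply/transversal_map_orbit => //; first exact/sweep_act.
by exists (g, 1%g).
Qed.

Lemma measurable_orbit_cocycle g s : measurable (w g @^-1` [set s]).
Proof.
have mE : measurable [set x | X0 x /\ (p \o a (g, 1%g)) x = (b s \o p) x].
  apply: measurable_equalizer Y_standard measurable_sweep _ _.
    apply: (measurable_comp measurable_sweep) measurable_transversal_map _.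
      by move=> _ [x X0x <-]; exact/sweep_act.
    exact: measurable_funS (ma _).
  exact: measurableT_comp measurable_transversal_map.
have -> : w g @^-1` [set s] =
    [set x | X0 x /\ (p \o a (g, 1%g)) x = (b s \o p) x] `|`
    (if `[< s = 1%g >] then ~` X0 else set0).
  apply/seteqP; split=> x /=.
    have [X0x <-|nX0x] := pselect (X0 x).
      by left; split=> //; exact: orbit_cocycleP.
    rewrite /w; case: pselect => [[]//|_ <-]; right.
    by rewrite asboolT.
  move=> [[X0x E]|].
    apply: (transversal_map_free X0x); rewrite -orbit_cocycleP//.
  case: asboolP => // -> nX0x; rewrite /w.
  by case: pselect => // -[].
apply: measurableU => //; case: ifP => _ //.
by apply: measurableC; exact: measurable_sweep.
Qed.

Lemma measurable_discrete_group (F : X -> discrete_group Gamma) :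
  (forall s, measurable (F @^-1` [set s])) ->
  measurable_fun setT (F : X -> borel (discrete_group Gamma)).
Proof.
move=> mF _ B _; rewrite setTI.
rewrite [X in measurable X](_ : _ = \bigcup_(s : Gamma)
    (if `[< B s >] then F @^-1` [set s] else set0)).
  by apply: countable_bigcup_measurable => // s; case: ifP.
apply/seteqP; split=> x /=; first by move=> Bx; exists (F x) => //; rewrite asboolT.
move=> [s _]; have [Bs|nBs] := pselect (B s); last by rewrite asboolF.
by rewrite asboolT//= => ->.
Qed.

Lemma ae_sweep : \forall x \ae mu, X0 x.
Proof. exact: measure1_ae measurable_sweep sweep_full. Qed.

Lemma superrigid_untwist : exists (f : X -> Gamma) (rho : G -> Gamma),
  [/\ forall s, measurable (f @^-1` [set s]),
      forall g h, rho (g * h)%g = (rho g * rho h)%g &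
      forall g, \forall x \ae mu, rho g = (f (a (g, 1%g) x) * w g x * (f x)^-1)%g].
Proof.
have coc : is_cocycle mu (fun g => a (g, 1%g))
    (w : G -> X -> discrete_group Gamma).
  split=> [g|g h].
    apply: measurable_discrete_group => s; exact: measurable_orbit_cocycle.
  have := ae_sweep; apply: filterS => x X0x.
  apply: (transversal_map_free X0x).
  have X0hx : X0 (a (h, 1%g) x) by exact/sweep_act.
  rewrite -orbit_cocycleP// bM -orbit_cocycleP// -orbit_cocycleP//.
  by rewrite (act_pairM aM) mulg1.
have [rho [phi mphi phiP]] :=
  G_superrigid (discrete_group_finite_type R Gamma_countable) coc.
exists phi, rho; split=> [s|g h|//]; last exact: gmulfM.
have := mphi measurableT [set s]; rewrite setTI; apply.
by apply: sub_sigma_algebra; exact: open_discrete.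
Qed.

Section Equivariance.
Variables (f : X -> Gamma) (rho : G -> Gamma).
Hypothesis mf : forall s, measurable (f @^-1` [set s]).
Hypothesis rhoP : forall g, \forall x \ae mu,
  rho g = (f (a (g, 1%g) x) * w g x * (f x)^-1)%g.

(** This map is equivariant only almost everywhere, for each group element separately; [P] below is
    its strict version. *)
Let Q x : Y := b (f x) (p x).

Let Q_free x s t : X0 x -> b s (Q x) = b t (Q x) -> s = t.
Proof.
by move=> X0x; rewrite /Q -!bM => /(transversal_map_free X0x)/mulIg.
Qed.

Let Q_G g : \forall x \ae mu, Q (a (g, 1%g) x) = b (rho g) (Q x).
Proof.
apply: filterS2 ae_sweep (rhoP g) => x X0x rg.
by rewrite /Q orbit_cocycleP// -!bM rg mulgVK.
Qed.

Let Q_K k x : Q (a (1%g, k) x) = b (f (a (1%g, k) x) * (f x)^-1)%g (Q x).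
Proof. by rewrite /Q transversal_map_act -bM mulgVK. Qed.

(* x |-> f (k x) (f x)^-1 is equivariant for an action of G on the countable set
   Gamma, hence almost surely constant by weak mixing. *)
Lemma untwist_act k : exists s,
  (\forall x \ae mu, f (a (1%g, k) x) = (s * f x)%g) /\
  forall g, (rho g * s = s * rho g)%g.
Proof.
pose F x := (f (a (1%g, k) x) * (f x)^-1)%g.
pose c g s := (rho g * s * (rho g)^-1)%g.
have FG g : \forall x \ae mu, F (a (g, 1%g) x) = c g (F x).
  have gk := ae_preimage (ma (1%g, k)) (mua (1%g, k)) (Q_G g).
  apply: filterS3 ae_sweep (Q_G g) gk => x X0x gx gkx.
  (* Moving by [g] and [k] in the two orders gives two expressions of the same value of [Q];
     freeness then shows that [F] is conjugated by [rho g]. *)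
  have {}gx : b (F (a (g, 1%g) x) * rho g)%g (Q x) = b (rho g * F x)%g (Q x).
    have FE y : Q (a (1%g, k) y) = b (F y) (Q y) by exact: Q_K.
    by rewrite (bM (F _)) (bM (rho g) (F _)) -gx -!FE -gkx (act_comm aM).
  by rewrite /c -(Q_free X0x gx) mulgK.
have [s Fs] : exists s, \forall x \ae mu, F x = s.
  apply: (weakly_mixing_constant _ G_mixing Gamma_countable _ _ FG) => //.
  - move=> s; rewrite [X in measurable X](_ : _ = \bigcup_t
      ((f @^-1` [set t]) `&` (a (1%g, k) @^-1` (f @^-1` [set (s * t)%g])))).
      apply: countable_bigcup_measurable => // t.
      by apply: measurableI => //; exact: mact_preimage.
    apply/seteqP; split=> x /=.
      by move=> <-; exists (f x) => //; split=> //=; rewrite mulgVK.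
    by move=> [t _ [/= fx fkx]]; rewrite /F fkx fx mulgK.
  - by move=> g s t /mulIg/mulgI.
exists s; split.
  by apply: filterS Fs => x <-; rewrite mulgVK.
(* The constant value of [F], read at [x] and at [g x], is fixed under conjugation by [rho g]. *)
move=> g; have Fgs := ae_preimage (ma (g, 1%g)) (mua (g, 1%g)) Fs.
have [x [xs gxs xg]] : exists x, [/\ F x = s, F (a (g, 1%g) x) = s &
    F (a (g, 1%g) x) = c g (F x)].
  by apply: (@ae_ex _ _ _ mu); apply: filterS3 Fs Fgs (FG g) => x xs gxs xg.
by rewrite gxs xs /c in xg; rewrite {2}xg mulgVK.
Qed.

Hypothesis a_measurable : jointly_measurable a.

Lemma exists_untwist_act : exists dK : K -> Gamma,
  [/\ forall k l, dK (k * l)%g = (dK k * dK l)%g,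
      forall g k, (rho g * dK k = dK k * rho g)%g,
      forall k, \forall x \ae mu, f (a (1%g, k) x) = (dK k * f x)%g &
      forall s, measurable (dK @^-1` [set s] : set (borel K))].
Proof.
have /choice[dK dKP] := untwist_act.
have dKf k : \forall x \ae mu, f (a (1%g, k) x) = (dK k * f x)%g.
  by have [] := dKP k.
exists dK; split=> // [k l|g k|s]; last 1 first.
(* By Fubini: [dK k = s] exactly when the section of [N] at [k] has measure 1, and the measure of a
   section is measurable in [k]. *)
- pose N : set (borel K * X) := \bigcup_t
    (((fun q : borel K * X => a (1%g, q.1) q.2) @^-1` (f @^-1` [set (s * t)%g]))
     `&` (snd @^-1` (f @^-1` [set t]))).
  have mN : measurable N.
    apply: countable_bigcup_measurable => // t; apply: measurableI.
      by rewrite -[X in measurable X]setTI; exact: a_measurable.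
    by rewrite -[X in measurable X]setTI; exact: measurable_snd.
  have NE k : xsection N k = [set x | f (a (1%g, k) x) = (s * f x)%g].
    apply/seteqP; split=> x; rewrite /xsection /= inE.
      by move=> [t _ [/= E ft]]; rewrite ft.
    by move=> E; exists (f x).
  have -> : dK @^-1` [set s] = (fun k => mu (xsection N k)) @^-1` [set 1%E].
    apply/seteqP; split=> k /= dk.
      apply: ae_measure1; first exact: measurable_xsection.
      by rewrite NE -dk; exact: dKf.
    have /(measure1_ae (measurable_xsection (k : borel K) mN)) Nk := dk.
    have [x [fx]] : exists x, f (a (1%g, k) x) = (dK k * f x)%g /\ xsection N k x.
      by apply: (@ae_ex _ _ _ mu); apply: filterS2 (dKf k) Nk => x; split.
    by rewrite NE /= fx => /mulIg.
  rewrite -[X in measurable X]setTI.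
  exact: (measurable_fun_xsection mu mN).
- have [x [fkl fk fl]] : exists x, [/\ f (a (1%g, k * l)%g x) = (dK (k * l)%g * f x)%g,
      f (a (1%g, k) (a (1%g, l) x)) = (dK k * f (a (1%g, l) x))%g &
      f (a (1%g, l) x) = (dK l * f x)%g].
    apply: (@ae_ex _ _ _ mu).
    apply: filterS3 (dKf (k * l)%g) (dKf l)
      (ae_preimage (ma (1%g, l)) (mua (1%g, l)) (dKf k)) => x *; by split.
  have E : a (1%g, (k * l)%g) x = a (1%g, k) (a (1%g, l) x).
    by rewrite (act_pairM aM) mul1g.
  by apply: (mulIg (f x)); rewrite -fkl E fk fl mulgA.
- by have [_ ->] := dKP k.
Qed.

(** * A version equivariant at every element of K *)

Section Strictification.
Variable dK : K -> Gamma.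
Hypotheses (dKM : forall k l, dK (k * l)%g = (dK k * dK l)%g)
  (dK_rho : forall g k, (rho g * dK k = dK k * rho g)%g)
  (dKf : forall k, \forall x \ae mu, f (a (1%g, k) x) = (dK k * f x)%g)
  (mdK : forall s, measurable (dK @^-1` [set s] : set (borel K))).
Variable m : probability (borel K) R.
Hypothesis m_mulgl : forall g (C : set K),
  (m ((fun k => (g * k)%g) @^-1` C) = m C)%E.

Let dKV k : (dK k * dK k^-1 = 1)%g.
Proof. by rewrite -dKM mulgV; apply: (mulgI (dK 1%g)); rewrite -dKM !mulg1. Qed.

(** The elements [k] for which equivariance, read from the point k^-1 x, predicts the value [s] at
    [x]. Moving [x] by [l] translates this set by [l]. *)
Let S s x : set (borel K) := [set k | (dK k * f (a (1%g, k^-1) x))%g = s].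

Let MS s : set (borel K * X) := [set q | S s q.2 q.1].

Lemma measurable_invg_borel :
  measurable_fun setT ((fun k => k^-1%g) : borel K -> borel K).
Proof.
apply: (@measurability _ _ (borel K) (borel K) setT _ (@open K) erefl).
move=> _ [V oV <-]; rewrite setTI; apply: sub_sigma_algebra; apply: open_comp => // k _.
exact: invg_continuous.
Qed.

Let measurable_MS s : measurable (MS s).
Proof.
have mact : measurable_fun setT (fun q : borel K * X => a (1%g, q.1^-1%g) q.2).
  have mq : measurable_fun setT
      (fun q : borel K * X => (q.1^-1%g, q.2) : borel K * X).
    apply/measurable_fun_pair; last exact: measurable_snd.
    by apply: (measurableT_comp measurable_invg_borel); exact: measurable_fst.
  exact: (measurableT_comp (a_measurable 1%g) mq).
rewrite [X in measurable X](_ : _ = \bigcup_t ((fst @^-1` (dK @^-1` [set t])) `&`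
   ((fun q : borel K * X => a (1%g, q.1^-1%g) q.2) @^-1`
     (f @^-1` [set (t^-1 * s)%g])))).
  apply: countable_bigcup_measurable => // t; apply: measurableI.
    by rewrite -[X in measurable X]setTI; exact: measurable_fst.
  by rewrite -[X in measurable X]setTI; exact: mact.
apply/seteqP; split=> -[k x]; rewrite /MS /S /=.
  by move=> <-; exists (dK k) => //; split=> //=; rewrite mulKg.
by move=> [t _ [/= kt ->]]; rewrite kt mulVKg.
Qed.

Let ysection_MS s x : ysection (MS s) x = S s x.
Proof. by apply/seteqP; split=> k; rewrite /ysection /= inE. Qed.

Let measurable_S s x : measurable (S s x).
Proof. by rewrite -ysection_MS; exact: measurable_ysection. Qed.

Let S_translate l s x :
  S (dK l * s)%g (a (1%g, l) x) = (fun k => (l^-1 * k)%g) @^-1` S s x.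
Proof.
apply/seteqP; split=> k; rewrite /S /= (act_pairM aM) mulg1 invgM invgK dKM => E.
  by rewrite -mulgA E mulgA -{2}[l]invgK dKV mul1g.
by rewrite -E !mulgA dKV mul1g.
Qed.

(* The identity f (k x) = dK k * f x holds outside of a null set that depends on
   k. The Haar-essential value ft x of k |-> dK k * f (k^-1 x) satisfies it for
   all k on an invariant set. *)
Let X1 x := exists s, m (S s x) = 1%E.

Let ft x : Gamma := if pselect (X1 x) is left e then sval (cid e) else 1%g.

Let S_uniq s t x : m (S s x) = 1%E -> m (S t x) = 1%E -> s = t.
Proof.
move=> /(measure1_ae (measurable_S s x)) Ss.
move=> /(measure1_ae (measurable_S t x)) St.
have [k [ks kt]] : exists k, S s x k /\ S t x k.
  by apply: (@ae_ex _ _ _ m); apply: filterS2 Ss St => k; split.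
by rewrite -ks -kt.
Qed.

Let ft_eq s x : m (S s x) = 1%E <-> X1 x /\ ft x = s.
Proof.
split=> [xs|[X1x <-]]; last first.
  by rewrite /ft; case: pselect => // e; case: cid.
have X1x : X1 x by exists s.
split=> //; rewrite /ft; case: pselect => // e; case: cid => t /= xt.
exact: S_uniq xt xs.
Qed.

(** Left invariance of Haar measure turns [S_translate] into equivariance for every [l], with no
    exceptional set left. *)
Let X1_act l x : X1 x ->
  X1 (a (1%g, l) x) /\ ft (a (1%g, l) x) = (dK l * ft x)%g.
Proof.
move=> X1x; apply/ft_eq; rewrite S_translate m_mulgl.
by apply/ft_eq.
Qed.

Let measurable_ft s : measurable [set x | X1 x /\ ft x = s].
Proof.
rewrite [X in measurable X](_ : _ =
    (fun x => m (ysection (MS s) x)) @^-1` [set 1%E]).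
  rewrite -[X in measurable X]setTI.
  exact: (measurable_fun_ysection m (measurable_MS s)).
apply/seteqP; split=> x /=; first by move=> /ft_eq; rewrite ysection_MS.
by rewrite ysection_MS => /ft_eq.
Qed.

(** By Fubini, since the identity holds for each [k] at almost every [x], it holds for almost every
    [x] at almost every [k]. *)
Let ae_ft : \forall x \ae mu, X1 x /\ ft x = f x.
Proof.
pose W : set (borel K * X) := \bigcup_s
  (MS s `&` (snd @^-1` (f @^-1` [set s]))).
have mW : measurable W.
  apply: countable_bigcup_measurable => // s; apply: measurableI => //.
  by rewrite -[X in measurable X]setTI; exact: measurable_snd.
have WE q : W q <-> S (f q.2) q.2 q.1.
  split=> [[s _ [Ss /= fs]]|Sq]; first by rewrite fs.
  by exists (f q.2).
have mWC : measurable (~` W) by exact: measurableC.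
have W0 : (m \x mu)%E (~` W) = 0%E.
  rewrite /product_measure1 integral0_eq// => k _ /=.
  have := dKf k^-1%g; move=> /ae_setT_measurable[E mE [E1 EP]].
  apply: (@subset_measure0 _ _ _ _ _ (~` E)).
  - exact: measurable_xsection.
  - exact: measurableC.
  - move=> x; rewrite /xsection /= inE => nW Ex; apply: nW; apply/WE => /=.
    by rewrite /S /= (EP x Ex) mulgA dKV mul1g.
  - by rewrite [LHS]probability_setC// E1 subee.
(* Uniqueness of the product measure exchanges the order of integration. *)
have W0' : (m \x^ mu)%E (~` W) = 0%E.
  transitivity ((m \x mu)%E (~` W)) => //; apply/esym.
  apply: (@product_measure_unique _ _ _ _ R m mu (m \x^ mu)%E) => //.
  by move=> C E mC mE; exact: product_measure2E.
have mys := measurable_fun_ysection m mWC.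
have /(ae_eq_integral_abs mu measurableT mys) : (\int[mu]_x `|(m \o ysection (~` W)) x| = 0)%E.
  by rewrite -W0'; apply: eq_integral => x _; rewrite gee0_abs.
apply: filterS => x /(_ I) /= Wx; apply/ft_eq.
have -> : S (f x) x = ~` ysection (~` W) x.
  apply/seteqP; split=> k; rewrite /ysection /= inE.
    by move=> Sk; apply; exact/WE.
  by move=> /contrapT /WE.
rewrite [LHS]probability_setC; last exact: measurable_ysection.
by rewrite [X in (1 - X)%E]Wx sube0.
Qed.

Let D g : set X := [set x | [/\ X1 x, X1 (a (g, 1%g) x) &
  (ft (a (g, 1%g) x) * w g x = rho g * ft x)%g]].

Let measurable_D g : measurable (D g).
Proof.
rewrite [X in measurable X](_ : _ = \bigcup_(s : Gamma) \bigcup_(t : Gamma)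
   ([set x | X1 x /\ ft x = s] `&` a (g, 1%g) @^-1` [set x | X1 x /\ ft x = t]
     `&` w g @^-1` [set (t^-1 * (rho g * s))%g])).
  apply: countable_bigcup_measurable => // s.
  apply: countable_bigcup_measurable => // t.
  apply: measurableI; last exact: measurable_orbit_cocycle.
  by apply: measurableI => //; exact: mact_preimage.
apply/seteqP; split=> x /=.
  move=> [X1x X1gx E]; exists (ft x) => //; exists (ft (a (g, 1%g) x)) => //.
  by split=> //=; rewrite -E mulKg.
move=> [s _ [t _ [[[X1x <-] [X1gx <-]] /= E]]].
by split=> //; rewrite E mulVKg.
Qed.

Let ae_D g : \forall x \ae mu, D g x.
Proof.
apply: filterS3 ae_ft (ae_preimage (ma (g, 1%g)) (mua (g, 1%g)) ae_ft) (rhoP g).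
move=> x [X1x ftx] [X1gx ftgx] E; split=> //.
by rewrite E ftx ftgx mulgVK.
Qed.

(** Imposing the identities at all [G]-translates gives [G]-invariance and, [G] being countable,
    keeps the set conull; invariance under [K] comes from [D_K]. *)
Let X2 : set X := X0 `&` \bigcap_(h : G) \bigcap_(g : G) (a (h, 1%g) @^-1` D g).

Let X2P x : X2 x <-> X0 x /\ forall h g, D g (a (h, 1%g) x).
Proof.
by split=> -[X0x Dx]; split=> // h; [move=> g; exact: Dx | move=> _ g _; exact: Dx].
Qed.

Let P x : Y := b (ft x) (p x).

Let D_P g x : X0 x -> D g x -> P (a (g, 1%g) x) = b (rho g) (P x).
Proof.
by move=> X0x [_ _ E]; rewrite /P orbit_cocycleP// -!bM E.
Qed.

Let P_K k x : X1 x -> P (a (1%g, k) x) = b (dK k) (P x).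
Proof. by move=> /(X1_act k)[_ E]; rewrite /P E transversal_map_act -bM. Qed.

Let w_K g k x : X0 x -> w g (a (1%g, k) x) = w g x.
Proof.
move=> X0x; apply: (transversal_map_free X0x); rewrite -orbit_cocycleP//.
rewrite -{1}(transversal_map_act k x) -orbit_cocycleP; last exact/sweep_act.
by rewrite -(act_comm aM) transversal_map_act.
Qed.

(** Both sides of the identity acquire the factor [dK k], which commutes with [rho g]. *)
Let D_K g k x : X0 x -> D g x -> D g (a (1%g, k) x).
Proof.
move=> X0x [X1x X1gx E]; have [X1kx kx] := X1_act k X1x.
have [X1kgx kgx] := X1_act k X1gx.
rewrite /D /= -(act_comm aM) w_K// kx kgx; split=> //.
by rewrite -mulgA E !mulgA dK_rho.
Qed.

Let X2_act l x : X2 x -> X2 (a l x).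
Proof.
case: l => g k /X2P[X0x Dx]; apply/X2P; split; first exact/sweep_act.
move=> h g'; rewrite (act_pair aM g k) -(act_comm aM); apply: D_K.
  by do 2 apply/sweep_act.
by rewrite (act_pairM aM) mulg1.
Qed.

Let X2_P g k x : X2 x -> P (a (g, k) x) = b (rho g * dK k)%g (P x).
Proof.
move=> X2x; have /X2P[X0x /(_ 1%g)] := X2x.
rewrite [a (1%g, 1%g) x]a1 => Dx; rewrite (act_pair aM).
by rewrite P_K ?(D_P X0x (Dx g))//; [rewrite -bM dK_rho | have [] := Dx g].
Qed.

Let mu_X2 : measurable X2 /\ mu X2 = 1%E.
Proof.
have mX2 : measurable X2.
  apply: measurableI; first exact: measurable_sweep.
  do 2 (apply: countable_bigcap_measurable => // ?).
  by apply: mact_preimage.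
split=> //; apply: ae_measure1 => //.
have aeD : \forall x \ae mu, forall h, forall g, D g (a (h, 1%g) x).
  apply: ae_forall_group => // h; apply: ae_forall_group => // g.
  exact: (ae_preimage (ma (h, 1%g)) (mua (h, 1%g)) (ae_D g)).
by apply: filterS2 ae_sweep aeD => x *; apply/X2P.
Qed.

Lemma strict_of_haar : exists (fT : X -> Gamma) (X2 : set X),
  [/\ [/\ measurable X2, mu X2 = 1%E, X2 `<=` X0 & forall h x, X2 x -> X2 (a h x)],
      forall s, measurable [set x | X2 x /\ fT x = s] &
      forall g k x, X2 x -> b (fT (a (g, k) x)) (p (a (g, k) x)) =
        b (rho g * dK k)%g (b (fT x) (p x))].
Proof.
exists ft, X2; have [mX2 X21] := mu_X2; split=> [|s|//].
  by split=> //; exact: subIsetl.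
rewrite [X in measurable X](_ : _ = X2 `&` [set x | X1 x /\ ft x = s]).
  exact: measurableI.
apply/seteqP; split=> x /=; last by move=> [X2x []].
move=> [X2x xs]; split=> //; split=> //.
by have /X2P[_ /(_ 1%g 1%g)[]] := X2x; rewrite [a _ _]a1.
Qed.

End Strictification.

End Equivariance.

Lemma strict_untwist (K_compact : compact [set: K])
    (K_hausdorff : hausdorff_space K) (a_measurable : jointly_measurable a) :
  exists (delta : G * K -> Gamma) (fT : X -> Gamma) (X2 : set X),
  [/\ forall h h', delta (h * h')%g = (delta h * delta h')%g,
      closed [set k | delta (1%g, k) = 1%g] /\
        finite_set (range (fun k => delta (1%g, k))),
      [/\ measurable X2, mu X2 = 1%E, X2 `<=` X0 &
        forall h x, X2 x -> X2 (a h x)],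
      forall s, measurable [set x | X2 x /\ fT x = s] &
      forall h x, X2 x -> b (fT (a h x)) (p (a h x)) =
        b (delta h) (b (fT x) (p x))].
Proof.
have [f [rho [mf rhoM rhoP]]] := superrigid_untwist.
have [dK [dKM dK_rho dKf mdK]] := exists_untwist_act mf rhoP a_measurable.
have [m [m_mulgl m_outer]] := exists_haar_measure R K_compact K_hausdorff.
have [fT [X2 [X2P mfT fTP]]] := strict_of_haar mf rhoP a_measurable dKM dK_rho dKf mdK m_mulgl.
have rho1 : rho 1%g = 1%g.
  by apply: (mulgI (rho 1%g)); rewrite -rhoM !mulg1.
exists (fun h => rho h.1 * dK h.2)%g, fT, X2; split=> //.
- move=> [g k] [g' k'] /=; rewrite rhoM dKM !mulgA; congr (_ * _)%g.
  by rewrite -!mulgA dK_rho.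
- split.
    rewrite [X in closed X](_ : _ = dK @^-1` [set 1%g]).
      exact: (kernel_closed K_compact Gamma_countable dKM mdK m_mulgl m_outer).
    by apply/seteqP; split=> k; rewrite /= rho1 mul1g.
  rewrite [X in finite_set X](_ : _ = range dK).
    exact: (finite_range_of_measurable Gamma_countable dKM mdK m_mulgl).
  by apply: eq_imagel => k _; rewrite /= rho1 mul1g.
- by move=> [g k] x; exact: fTP.
Qed.

End Untwisting.

(** * Equivariant maps and induced actions *)

Lemma set_trivIset T I (J : set I) (D : I -> set T) :
  (forall i j x, J i -> J j -> D i x -> D j x -> i = j) -> trivIset J D.
Proof. by move=> H i j Ji Jj [x [Di Dj]]; exact: H Di Dj. Qed.

(** * Counting disjoint sets of equal measure *)

Section EqualMeasure.
Variables (R : realType) (d : measure_display) (T : measurableType d).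
Variables (mu : probability T R) (S : choiceType) (J : set S) (D : S -> set T).
Variable q : R.
Hypothesis q_gt0 : 0 < q.
Hypothesis mD : forall j, J j -> measurable (D j).
Hypothesis muD : forall j, J j -> mu (D j) = q%:E.
Hypothesis D_disjoint : forall i j x, J i -> J j -> D i x -> D j x -> i = j.

Lemma measure_equal_bigcup (B : set S) : B `<=` J -> finite_set B ->
  mu (\bigcup_(j in B) D j) = ((card_of B)%:R * q)%:E.
Proof.
move=> BJ fB; rewrite measure_fin_bigcup//.
- rewrite fsbig_finite//= big_seq (eq_bigr (fun=> q%:E)); last first.
    by move=> j; rewrite in_fset_set// inE => /BJ/muD.
  by rewrite -big_seq sumEFin big_const_seq count_predT iter_addr_0 mulr_natl.
- by apply: set_trivIset => i j x /BJ Ji /BJ Jj; exact: D_disjoint.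
- by move=> j /BJ; exact: mD.
Qed.

(** A probability space holds at most 1 / q disjoint sets of measure [q]. *)
Lemma finite_equal_measure : finite_set J.
Proof.
apply: contrapT => infJ.
have [B BJ nB] := infinite_set_fset (Num.truncn q^-1).+1 infJ.
have fB : finite_set [set` B] by exact: finite_fset.
have mB := fin_bigcup_measurable fB (fun j Bj => mD (BJ j Bj)).
have := probability_le1 mu mB.
rewrite measure_equal_bigcup// lee_fin /card_of set_fsetK -ler_pdivlMr// div1r.
rewrite leNgt => /negP; apply.
by rewrite (lt_le_trans (Num.Theory.truncnS_gt _))// ler_nat.
Qed.

Lemma card_equal_measure : mu (\bigcup_(j in J) D j) = 1%E ->
  (card_of J)%:R * q = 1.
Proof. by rewrite measure_equal_bigcup//; [case | exact: finite_equal_measure]. Qed.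

End EqualMeasure.

Lemma measure_countable_bigcup (R : realType) d (T : measurableType d)
    (mu : {measure set T -> \bar R}) (S : choiceType) (D : S -> set T) :
  countable [set: S] -> (forall s, measurable (D s)) -> trivIset setT D ->
  mu (\bigcup_s D s) = (\esum_(s in [set: S]) mu (D s))%E.
Proof.
move=> /countable_injP[f f_inj] mD tD.
pose F n := \bigcup_(s in f @^-1` [set n]) D s.
have FE s : F (f s) = D s.
  apply/seteqP; split=> [x [t /= ft Dx]|x Dx]; last by exists s.
  by rewrite -(f_inj t s)// inE.
have F0 n : ~ range f n -> F n = set0.
  by move=> nn; apply/seteqP; split=> // x [s /= sn _]; apply: nn; exists s.
have mF n : measurable (F n).
  by have [[s _ <-]|/F0 ->//] := pselect (range f n); rewrite FE.
have -> : \bigcup_s D s = \bigcup_n F n.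
  apply/seteqP; split=> [x [s _ Dx]|x [n _ [s _ Dx]]]; last by exists s.
  by exists (f s) => //; exists s.
rewrite measure_bigcup//; last first.
  apply: set_trivIset => i j x _ _ [s /= si Ds] [t /= tj Dt].
  rewrite -si -tj; congr f.
  by apply: tD => //; exists x.
rewrite nneseries_esum// set_mem_set.
rewrite (esumID (range f))//.
rewrite [X in (_ + X)%E]esum1 ?adde0; last by move=> n [_ /F0 ->]; rewrite measure0.
rewrite setTI.
rewrite (@reindex_esum R _ _ setT (range f) f (mu \o F)).
  by apply: eq_esum => s _; rewrite /= FE.
by split=> // n [s _ <-]; exists s.
Qed.

Lemma esum_scale (R : realType) (S : choiceType) (J : set S) (F : S -> \bar R)
    (c : R) : 0 < c -> (forall s, 0 <= F s)%E ->
  (\esum_(s in J) (c%:E * F s) = c%:E * \esum_(s in J) F s)%E.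
Proof.
have le (e : R) (H : S -> \bar R) : 0 < e -> (forall s, 0 <= H s)%E ->
    (\esum_(s in J) (e%:E * H s) <= e%:E * \esum_(s in J) H s)%E.
  move=> e0 H0; apply: ge_ereal_sup => _ [A AJ <-].
  rewrite -ge0_mule_fsumr//; apply: lee_wpmul2l; first by rewrite lee_fin ltW.
  by apply: ereal_sup_ubound; exists A.
move=> c0 F0; apply/eqP; rewrite eq_le le//=.
have cF0 s : (0 <= c%:E * F s)%E by rewrite mule_ge0// lee_fin ltW.
have : (0 < c^-1) by rewrite invr_gt0.
move=> /le/(_ cF0); rewrite [X in (X <= _)%E](_ : _ = \esum_(s in J) F s)%E; last first.
  by apply: eq_esum => s _; rewrite muleA -EFinM mulVf ?mul1e// gt_eqF.
by rewrite -lee_pdivlMl.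
Qed.

Lemma exists_pushforward (R : realType) d d' (T : measurableType d)
    (T' : measurableType d') (mu : probability T R) (f : T -> T') :
  measurable_fun setT f ->
  exists nu : probability T' R, (nu : set T' -> \bar R) = pushforward mu f.
Proof.
move=> mf; pose F : {mfun T >-> T'} := HB.pack f (isMeasurableFun.Build _ _ _ _ f mf).
by exists (distribution mu F).
Qed.

(** * Free equivariant maps that scale the measure locally *)

Section EquivariantMap.
Variables (R : realType) (L Gamma : groupType).
Variables (d : measure_display) (Z : measurableType d) (zeta : probability Z R).
Variables (d' : measure_display) (Y : measurableType d') (eta : probability Y R).
Variables (c : L -> Z -> Z) (theta : L -> Gamma) (b : Gamma -> Y -> Y).
Hypothesis Gamma_countable : countable [set: Gamma].
Hypotheses (c_pmp : pmp_action zeta c) (b_pmp : pmp_action eta b).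
Hypothesis b_ergodic : ergodic eta b.
Hypothesis thetaM : forall l l', theta (l * l')%g = (theta l * theta l')%g.
Variables (Z2 : set Z) (Q : Z -> Y).
Hypotheses (mZ2 : measurable Z2) (zeta_Z2 : zeta Z2 = 1%E)
  (Z2_act : forall l z, Z2 z -> Z2 (c l z)) (mQ : measurable_fun Z2 Q).
Hypothesis Q_act : forall l z, Z2 z -> Q (c l z) = b (theta l) (Q z).
Hypothesis Q_free : forall s z, Z2 z -> b s (Q z) = Q z -> s = 1%g.
Hypothesis Q_orbit : forall t z z', Z2 z -> Z2 z' -> Q z' = b t (Q z) ->
  exists l, z' = c l z.
Hypothesis c_free : forall l z, Z2 z -> c l z = z -> l = 1%g.
(** [Q] collapses the orbits of the kernel of [theta], so injectivity and scaling by [c1] can only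
    be asked on the members of a countable cover. *)
Variables (V : nat -> set Z) (c1 : R).
Hypothesis c1_gt0 : 0 < c1.
Hypotheses (mV : forall i, measurable (V i)) (bigcupV : \bigcup_i V i = Z2).
Hypothesis V_inj : forall i, {in V i &, injective Q}.
Hypothesis V_image : forall i E, measurable E -> E `<=` V i ->
  measurable (Q @` E) /\ eta (Q @` E) = (c1%:E * zeta E)%E.

Let b1 : forall y, b 1%g y = y. Proof. by case: b_pmp. Qed.
Let bM : forall s t y, b (s * t)%g y = b s (b t y). Proof. by case: b_pmp. Qed.
Let mb : forall s, measurable_fun setT (b s). Proof. by case: b_pmp. Qed.
Let etab : forall h A, measurable A -> eta (b h @^-1` A) = eta A.
Proof. by case: b_pmp. Qed.
Let c1z : forall x, c 1%g x = x. Proof. by case: c_pmp. Qed.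
Let cM : forall g h x, c (g * h)%g x = c g (c h x). Proof. by case: c_pmp. Qed.
Let mc : forall h, measurable_fun setT (c h). Proof. by case: c_pmp. Qed.
Let zetac : forall h A, measurable A -> zeta (c h @^-1` A) = zeta A.
Proof. by case: c_pmp. Qed.
Let theta1 : theta 1%g = 1%g.
Proof. by apply: (mulgI (theta 1%g)); rewrite -thetaM !mulg1. Qed.
Let thetaV l : theta l^-1%g = (theta l)^-1%g.
Proof. by apply: (mulgI (theta l)); rewrite -thetaM !mulgV. Qed.
Let bK s y : b s^-1%g (b s y) = y. Proof. by rewrite -bM mulVg. Qed.
Let bVK s y : b s (b s^-1%g y) = y. Proof. by rewrite -bM mulgV. Qed.
Let cK s y : c s^-1%g (c s y) = y. Proof. by rewrite -cM mulVg. Qed.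
Let cVK s y : c s (c s^-1%g y) = y. Proof. by rewrite -cM mulgV. Qed.

Let Q_stab s t z : Z2 z -> b s (Q z) = b t (Q z) -> s = t.
Proof.
move=> Z2z /(congr1 (b t^-1%g)); rewrite bK -bM => /(Q_free Z2z) ts.
by apply: (mulgI t^-1%g); rewrite ts mulVg.
Qed.

Let Q_orbit_theta t z z' : Z2 z -> Z2 z' -> Q z' = b t (Q z) ->
  exists2 l, z' = c l z & theta l = t.
Proof.
move=> Z2z Z2z' E; have [l lz] := Q_orbit Z2z Z2z' E; exists l => //.
by apply: (Q_stab Z2z); rewrite -E lz Q_act.
Qed.

Let b_image s E : b s @` E = b s^-1%g @^-1` E.
Proof.
apply/seteqP; split=> y /=; first by move=> [x Ex <-]; rewrite bK.
by move=> Ey; exists (b s^-1%g y) => //; rewrite bVK.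
Qed.

Let mb_image s E : measurable E -> measurable (b s @` E).
Proof. by move=> mE; rewrite b_image -[X in measurable X]setTI; exact: mb. Qed.

Let W := seqDU V.

Let W_sub i : W i `<=` V i. Proof. exact: subDsetl. Qed.

Let mW i : measurable (W i).
Proof. by apply: measurableD => //; exact: bigsetU_measurable. Qed.

Let bigcupW : \bigcup_i W i = Z2. Proof. by rewrite -seqDU_bigcup_eq. Qed.

Let W_Z2 i z : W i z -> Z2 z. Proof. by rewrite -bigcupW => Wz; exists i. Qed.

Lemma measurable_image_equivariant E : measurable E -> E `<=` Z2 -> measurable (Q @` E).
Proof.
move=> mE EZ.
have -> : Q @` E = \bigcup_i (Q @` (E `&` W i)).
  apply/seteqP; split=> [_ [z Ez <-]|y [i _ [z [Ez _] <-]]]; last by exists z.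
  by have := EZ z Ez; rewrite -bigcupW => -[i _ Wz]; exists i => //; exists z.
apply: bigcupT_measurable => i.
by have [] := @V_image i (E `&` W i); [exact: measurableI | move=> z [_ /W_sub] |].
Qed.

Lemma eta_image_equivariant E : measurable E -> E `<=` Z2 -> {in E &, injective Q} ->
  eta (Q @` E) = (c1%:E * zeta E)%E.
Proof.
move=> mE EZ Einj.
have mEW i : measurable (E `&` W i) by exact: measurableI.
have EWV i : E `&` W i `<=` V i by move=> z [_ /W_sub].
have EE : E = \bigcup_i (E `&` W i).
  by rewrite -setI_bigcupr bigcupW; exact/esym/setIidPl.
have tW : trivIset setT (fun i => E `&` W i).
  exact: trivIset_setIl (trivIset_seqDU V).
have -> : Q @` E = \bigcup_i (Q @` (E `&` W i)) by rewrite {1}EE image_bigcup.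
rewrite measure_bigcup//; last first.
- apply: set_trivIset => i j _ _ _ [z [Ez Wz] <-] [z' [Ez' Wz']].
  move=> /Einj zz'; rewrite !inE in zz'; have {zz'}E0 := zz' Ez' Ez.
  by apply: tW => //; exists z; split; rewrite -?E0; split=> //; rewrite E0.
- by move=> i _; have [] := V_image (mEW i) (EWV i).
rewrite [in RHS]EE measure_bigcup// -nneseriesZl//.
by apply: eq_eseriesr => i _; have [] := V_image (mEW i) (EWV i).
Qed.

Let mQ_preimage D : measurable D -> measurable (Z2 `&` Q @^-1` D).
Proof. by move=> mD; exact: mQ. Qed.

Let QZ2 : set Y := Q @` Z2.

Let mQZ2 : measurable QZ2. Proof. exact: measurable_image_equivariant. Qed.

Let b_pre s y : (b s @^-1` QZ2) y -> exists2 z, Z2 z & y = b s^-1%g (Q z).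
Proof. by move=> [z Z2z E]; exists z => //; rewrite E bK. Qed.

Definition equivariant_range : set Y := \bigcup_s (b s @^-1` QZ2).
Local Notation Y2 := equivariant_range.

Let mb_pre s E : measurable E -> measurable (b s @^-1` E).
Proof. by move=> mE; rewrite -[X in measurable X]setTI; exact: mb. Qed.

Let Y2P y : Y2 y <-> exists s z, Z2 z /\ y = b s^-1%g (Q z).
Proof.
split=> [[s _ /b_pre[z Z2z ->]]|[s [z [Z2z ->]]]]; first by exists s, z.
by exists s => //; exists z => //; rewrite bVK.
Qed.

Lemma measurable_equivariant_range : measurable Y2.
Proof. by apply: countable_bigcup_measurable => // s; exact: mb_pre. Qed.

Let eta_QZ2_gt0 : (0 < eta QZ2)%E.
Proof.
rewrite lt_neqAle measure_ge0 andbT eq_sym; apply/negP => /eqP QZ0.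
have V0 i : zeta (V i) = 0%E.
  have VZ : V i `<=` Z2 by move=> z Vz; rewrite -bigcupV; exists i.
  have [mQV QV] := @V_image i (V i) (mV i) (fun _ H => H).
  have : eta (Q @` V i) = 0%E.
    by apply: (subset_measure0 mQV mQZ2) => //; exact: image_subset.
  by rewrite QV => /eqP; rewrite mule_eq0 eqe gt_eqF//= => /eqP.
have : zeta (\bigcup_i V i) = 0%E.
  apply/negligibleP; first exact: bigcupT_measurable.
  by apply: negligible_bigcup => i; apply/negligibleP => //; exact: V0.
by rewrite bigcupV zeta_Z2 => /eqP; rewrite onee_eq0.
Qed.

(** The range is [Gamma]-invariant and non-null, so ergodicity of [b] applies. *)
Lemma equivariant_range_full : eta Y2 = 1%E.
Proof.
have inv t : b t @^-1` Y2 = Y2.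
  apply/seteqP; split=> y.
    move=> [s _ E]; exists (s * t)%g => //; rewrite /preimage /= bM; exact: E.
  move=> [s _ E]; exists (s * t^-1)%g => //.
  by move: E; rewrite /preimage /= -bM mulgVK.
have [|Y20|//] := b_ergodic measurable_equivariant_range.
  by move=> t; rewrite inv setYK measure0.
have : (eta QZ2 <= eta Y2)%E.
  apply: le_measure; rewrite ?inE//; first exact: measurable_equivariant_range.
  by move=> y Qy; exists 1%g => //; rewrite /preimage /= b1.
by rewrite Y20 leNgt eta_QZ2_gt0.
Qed.

(* F meets every orbit of the kernel of theta exactly once, and has the same
   image under Q as Z2. *)
Let F : set Z := \bigcup_i (W i `&`
  \bigcap_j (if (j < i)%N then ~` (Z2 `&` Q @^-1` (Q @` W j)) else setT)).

Let FP z : F z <-> exists i, W i z /\ forall j, (j < i)%N -> ~ (Q @` W j) (Q z).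
Proof.
split=> [[i _ [Wz nz]]|[i [Wz nz]]]; exists i => //.
  split=> // j ji Qz; have := nz j I; rewrite ji; apply; split=> //.
  exact: W_Z2 Wz.
by split=> // j _; case: ifP => // /nz nj [_ /nj].
Qed.

Let mF : measurable F.
Proof.
apply: bigcupT_measurable => i; apply: measurableI => //.
apply: bigcapT_measurable => j; case: ifP => // _; apply: measurableC.
apply: mQ_preimage; apply: measurable_image_equivariant => //; exact: W_Z2.
Qed.

Let F_Z2 : F `<=` Z2. Proof. by move=> z /FP[i [/W_Z2]]. Qed.

Let F_inj : {in F &, injective Q}.
Proof.
move=> z z'; rewrite !inE => /FP[i [Wz nz]] /FP[j [Wz' nz']] E.
have ij : i = j.
  case: (ltngtP i j) => // lt.
    by case: (nz' i lt); exists z.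
  by case: (nz j lt); exists z'.
by apply: (@V_inj i); rewrite ?inE//; apply: W_sub; rewrite // ij.
Qed.

Let F_image z : Z2 z -> exists2 z0, F z0 & Q z = Q z0.
Proof.
move=> Z2z; have [i _ Wz] : (\bigcup_i W i) z by rewrite bigcupW.
have ex : exists i, (Q @` W i) (Q z) by exists i; exists z.
have [[z0 Wz0 E] min] := firstP ex.
exists z0 => //; apply/FP; eexists; split; first exact: Wz0.
by move=> j ji; rewrite E => /min; rewrite leqNgt ji.
Qed.

Let zetaF_fin : zeta F \is a fin_num. Proof. exact: fin_num_measure. Qed.

Let etaQ : eta QZ2 = (c1 * fine (zeta F))%:E.
Proof.
have -> : QZ2 = Q @` F.
  apply/seteqP; split; last exact: image_subset.
  by move=> _ [z /F_image[z0 Fz0 ->] <-]; exists z0.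
by rewrite eta_image_equivariant// EFinM fineK.
Qed.

Let zetaF_gt0 : 0 < fine (zeta F).
Proof. by have := eta_QZ2_gt0; rewrite etaQ lte_fin pmulr_rgt0. Qed.

Let kernel_translate l : group_kernel theta l ->
  measurable (c l @` F) /\ zeta (c l @` F) = (fine (zeta F))%:E.
Proof.
move=> _; have -> : c l @` F = c l^-1%g @^-1` F.
  apply/seteqP; split=> y /=; first by move=> [x Fx <-]; rewrite cK.
  by move=> Fy; exists (c l^-1%g y) => //; rewrite cVK.
by split; [rewrite -[X in measurable X]setTI; exact: mc | rewrite zetac// fineK].
Qed.

(** The kernel preserves the values of [Q], and [Q] is injective on [F]; so two translates meet only
    in images of one point, and freeness identifies the group elements. *)
Let kernel_translate_disjoint l l' z : group_kernel theta l -> group_kernel theta l' ->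
  (c l @` F) z -> (c l' @` F) z -> l = l'.
Proof.
move=> Kl Kl' [x Fx <-] [x' Fx' E].
have xx' : x' = x.
  apply: F_inj; rewrite ?inE//; have := Q_act l' (F_Z2 Fx').
  by rewrite E Q_act ?Kl ?Kl' ?b1//; exact: F_Z2.
move: E; rewrite xx' => /(congr1 (c l^-1%g)); rewrite cK -cM.
move=> /(c_free (F_Z2 Fx)) ll'; apply: (mulgI l^-1%g).
by rewrite ll' mulVg.
Qed.

Lemma finite_equivariant_kernel : finite_set (group_kernel theta).
Proof.
apply: (finite_equal_measure zetaF_gt0 (mu := zeta) (D := fun l => c l @` F)).
- by move=> l /kernel_translate[].
- by move=> l /kernel_translate[].
- exact: kernel_translate_disjoint.
Qed.

(** The translates of [F] by the kernel tile [Z2], a set of measure 1. *)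
Let card_kernel : (card_of (group_kernel theta))%:R * fine (zeta F) = 1.
Proof.
apply: (card_equal_measure zetaF_gt0 (mu := zeta) (D := fun l => c l @` F)).
- by move=> l /kernel_translate[].
- by move=> l /kernel_translate[].
- exact: kernel_translate_disjoint.
rewrite [X in zeta X](_ : _ = Z2)//; apply/seteqP; split.
  by move=> _ [l _ [x /F_Z2 Z2x <-]]; exact: Z2_act.
move=> z Z2z; have [z0 Fz0 E] := F_image Z2z.
have [l lE Kl] := @Q_orbit_theta 1%g z0 z (F_Z2 Fz0) Z2z (etrans E (esym (b1 _))).
by exists l => //; exists z0.
Qed.

(** [QZ2] is invariant under the image of [theta], so its translates depend only on cosets and are
    indexed by them. *)
Let translate (C : set Gamma) : set Y := \bigcup_(s in C) (b s @^-1` QZ2).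

Let translateE s :
  translate [set (i * s)%g | i in range theta] = b s @^-1` QZ2.
Proof.
apply/seteqP; split=> y; last first.
  move=> Qy; exists s => //; exists 1%g; last by rewrite mul1g.
  by exists 1%g.
move=> [_ [_ [l _ <-] <-]] /b_pre[z Z2z ->]; exists (c l^-1%g z); first exact: Z2_act.
by rewrite Q_act// thetaV invgM bM bVK.
Qed.

Let translate_coset C : image_cosets theta C ->
  measurable (translate C) /\ eta (translate C) = (c1 * fine (zeta F))%:E.
Proof.
move=> [s _ <-]; rewrite translateE; split; first exact: mb_pre.
by rewrite etab.
Qed.

Let translate_disjoint C C' y : image_cosets theta C -> image_cosets theta C' ->
  translate C y -> translate C' y -> C = C'.
Proof.
move=> [s _ <-] [s' _ <-]; rewrite !translateE => /b_pre[z Z2z ->] [z' Z2z' E].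
have [l lE tl] := @Q_orbit_theta (s' * s^-1)%g z z' Z2z Z2z' (etrans E (esym (bM _ _ _))).
apply/seteqP; split=> _ [_ [k _ <-] <-].
  exists (theta (k * l^-1)%g); first by exists (k * l^-1)%g.
  by rewrite thetaM thetaV tl invgM invgK mulgA mulgVK.
exists (theta (k * l)%g); first by exists (k * l)%g.
by rewrite thetaM tl -!mulgA mulVg mulg1.
Qed.

Let c1F_gt0 : 0 < c1 * fine (zeta F). Proof. exact: mulr_gt0. Qed.

Lemma finite_equivariant_index : finite_set (image_cosets theta).
Proof.
apply: (finite_equal_measure c1F_gt0 (mu := eta) (D := translate)).
- by move=> C /translate_coset[].
- by move=> C /translate_coset[].
- exact: translate_disjoint.
Qed.

Let card_index : (card_of (image_cosets theta))%:R * (c1 * fine (zeta F)) = 1.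
Proof.
apply: (card_equal_measure c1F_gt0 (mu := eta) (D := translate)).
- by move=> C /translate_coset[].
- by move=> C /translate_coset[].
- exact: translate_disjoint.
rewrite -equivariant_range_full; congr (eta _); apply/seteqP; split=> y.
  by move=> [C _ [s _ Qy]]; exists s.
move=> [s _ Qy]; exists [set (i * s)%g | i in range theta]; first by exists s.
by rewrite translateE.
Qed.

(** Kernel translates of [F] tile [Z2], and coset translates of its image tile [Y]. Each count
    determines the measure of [F], which cancels. *)
Lemma equivariant_scaling :
  c1 * (card_of (image_cosets theta))%:R = (card_of (group_kernel theta))%:R.
Proof.
apply: (mulIf (lt0r_neq0 zetaF_gt0)); rewrite card_kernel.
by rewrite mulrAC mulrC card_index.
Qed.

(** * Identification with the induced action *)

Section Induction.

Local Notation O := (induced_space c theta).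
Local Notation IP := (induced_pi c theta).

Lemma induced_piP z s z' s' : IP (z, s) = IP (z', s') <->
  exists2 l, z' = c l z & s' = (theta l * s)%g.
Proof.
have P := @orbit_piP L (Z * discrete Gamma)%type
  (fun l p => (c l p.1, (theta l * p.2)%g) : (Z * discrete Gamma)%type) setT.
split=> [/P[]//|[l -> ->]].
- by move=> [x t] /=; rewrite c1z theta1 mul1g.
- by move=> l l' [x t] /=; rewrite cM thetaM mulgA.
- by move=> l _ [-> ->]; exists l.
- by apply/P => //; [move=> [x t] /=; rewrite c1z theta1 mul1g
    | move=> g h [x t] /=; rewrite cM thetaM mulgA | exists l].
Qed.

Lemma induced_actionE t z s : induced_action c theta t (IP (z, s)) = IP (z, (s * t^-1)%g).
Proof.
rewrite /induced_action; case E : (orbit_repr _) => [z' s'] /=.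
have /esym/induced_piP[l -> ->] : IP (z', s') = IP (z, s).
  by rewrite -E; exact: orbit_reprK.
by apply/esym/induced_piP; exists l; rewrite ?mulgA.
Qed.

Let U2 : set (Z * discrete Gamma)%type := [set p | Z2 p.1].
Let psi (p : (Z * discrete Gamma)%type) : Y := b (p.2 : Gamma)^-1%g (Q p.1).

(** [psi] is constant on [L]-orbits by equivariance of [Q]. Conversely [Q_orbit] recovers an element
    of [L], and freeness determines its image under [theta]. *)
Let psi_eq p p' : U2 p -> U2 p' -> psi p = psi p' <-> IP p = IP p'.
Proof.
case: p p' => [z s] [z' s'] /= Z2z Z2z'; split.
  rewrite /psi /= => /(congr1 (b s')); rewrite bVK -bM => /esym E.
  have [l lz tl] := Q_orbit_theta Z2z Z2z' E.
  by apply/induced_piP; exists l; rewrite ?tl ?mulgVK.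
move=> /induced_piP[l -> ->].
by rewrite /psi /= Q_act// -bM invgM mulgVK.
Qed.

Let U2_pi p p' : U2 p -> IP p = IP p' -> U2 p'.
Proof.
by case: p p' => [z s] [z' s'] /= Z2z /induced_piP[l -> _]; exact: Z2_act.
Qed.

Let z0_ex : exists z0, Z2 z0.
Proof.
apply: contrapT => nz; have : zeta Z2 = 0%E; last first.
  by rewrite zeta_Z2 => /eqP; rewrite onee_eq0.
by rewrite (_ : Z2 = set0) ?measure0//; apply/seteqP; split=> // z Z2z; apply: nz; exists z.
Qed.

Let z0 : Z := sval (cid z0_ex).

Let Y2_psi y : Y2 y <-> exists2 p, U2 p & y = psi p.
Proof.
split=> [/Y2P[s [z [Z2z ->]]]|[[z s] Z2z ->]]; first by exists (z, s).
by apply/Y2P; exists s, z.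
Qed.

(** The inverse of the bijection induced by [psi], independent of the chosen preimage by [psi_eq];
    the default concerns only the null complement of [Y2]. *)
Definition induced_map (y : Y) : O :=
  if pselect (exists2 p, U2 p & y = psi p) is left e
  then IP (sval (cid2 e)) else IP (z0, 1%g).

Local Notation D := induced_map.

Let D_psi p : U2 p -> D (psi p) = IP p.
Proof.
move=> U2p; rewrite /D; case: pselect => [e|[]]; last by exists p.
by case: cid2 => p' /= U2p' E; apply/esym/psi_eq.
Qed.

Let D_off y : ~ Y2 y -> D y = IP (z0, 1%g).
Proof. by move=> nY; rewrite /D; case: pselect => // e; case: nY; exact/Y2_psi. Qed.

Lemma induced_map_orbit z t : Z2 z ->
  D (b t (Q z)) = induced_action c theta t (IP (z, 1%g)).
Proof.
move=> Z2z; rewrite induced_actionE mul1g.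
by rewrite -(D_psi (p := (z, t^-1%g)))// /psi /= invgK.
Qed.

Let psi_image (U : set (Z * discrete Gamma)%type) :
  psi @` (U `&` U2) =
  \bigcup_(s : Gamma) (b s^-1%g @` (Q @` (ysection U (s : discrete Gamma) `&` Z2))).
Proof.
apply/seteqP; split=> y.
  move=> [[z s] [Uzs Z2z] <-]; exists s => //; exists (Q z) => //; exists z => //.
  by split=> //; rewrite /ysection /= inE.
move=> [s _ [_ [z [Uz Z2z] <-] <-]]; exists (z, s) => //; split=> //.
by move: Uz; rewrite /ysection /= inE.
Qed.

Let m_section (U : set (Z * discrete Gamma)%type) (s : discrete Gamma) :
  measurable U -> measurable (ysection U s `&` Z2).
Proof. by move=> mU; apply: measurableI => //; exact: measurable_ysection. Qed.

Let mpsi_section (U : set (Z * discrete Gamma)%type) (s : Gamma) :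
  measurable U -> measurable (b s^-1%g @` (Q @` (ysection U (s : discrete Gamma) `&` Z2))).
Proof.
move=> mU; apply: mb_image; apply: measurable_image_equivariant; last exact: subIsetr.
exact: m_section.
Qed.

Let measurable_psi_image (U : set (Z * discrete Gamma)%type) : measurable U ->
  measurable (psi @` (U `&` U2)).
Proof.
move=> mU; rewrite psi_image; apply: countable_bigcup_measurable => // s.
exact: mpsi_section.
Qed.

Let D_preimage (B : set O) : D @^-1` B =
  (psi @` (IP @^-1` B `&` U2)) `|` (if `[< B (IP (z0, 1%g)) >] then ~` Y2 else set0).
Proof.
apply/seteqP; split=> y /=.
  have [Yy|nYy] := pselect (Y2 y).
    have [p U2p ->] := (Y2_psi y).1 Yy.
    by rewrite D_psi// => Bp; left; exists p.
  by rewrite D_off// => Bz; right; rewrite asboolT.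
move=> [[p [Bp U2p] <-]|]; first by rewrite D_psi.
by case: asboolP => // Bz nY; rewrite D_off.
Qed.

Lemma measurable_induced_map : measurable_fun setT D.
Proof.
move=> _ B mB; rewrite setTI D_preimage; apply: measurableU.
  exact: measurable_psi_image.
by case: ifP => // _; apply: measurableC; exact: measurable_equivariant_range.
Qed.

Let eta_Y2C : eta (~` Y2) = 0%E.
Proof.
by rewrite probability_setC ?equivariant_range_full ?subee//;
  exact: measurable_equivariant_range.
Qed.

(** On a partial fundamental domain [psi] is injective up to a null set. It maps the slice over each
    [s] to a translate of an image under [Q], of measure [c1] times that of the slice; the slices
    are summed over [Gamma]. *)
Lemma induced_map_quotient_measure (U : set (Z * discrete Gamma)%type) :
  measurable U -> {in U &, injective IP} ->
  eta (D @^-1` (IP @` U)) = (c1%:E * product_counting zeta U)%E.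
Proof.
move=> mU Uinj; rewrite D_preimage.
have -> : IP @^-1` (IP @` U) `&` U2 = IP @^-1` (IP @` (U `&` U2)).
  apply/seteqP; split=> p /=.
    by move=> [[u Uu E] U2p]; exists u => //; split=> //; exact: U2_pi U2p (esym E).
  by move=> [u [Uu U2u] E]; split; [exists u | exact: U2_pi U2u E].
have -> : psi @` (IP @^-1` (IP @` (U `&` U2))) = psi @` (U `&` U2).
  apply/seteqP; split=> y [p].
    move=> [u [Uu U2u] E] <-; exists u => //.
    by apply/psi_eq => //; exact: U2_pi U2u E.
  by move=> UU2p <-; exists p => //; exists p.
(* The default value of [induced_map] adds at most the null complement of [Y2]. *)
rewrite measureU0//; [|exact: measurable_psi_image| |]; last 2 first.
- by case: ifP => // _; apply: measurableC; exact: measurable_equivariant_range.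
- by case: ifP => _; rewrite ?measure0//; exact: eta_Y2C.
rewrite psi_image measure_countable_bigcup//; last 2 first.
- by move=> s; exact: mpsi_section.
- apply: set_trivIset => s t y _ _.
  move=> [_ [z [Uz Z2z] <-] <-] [_ [z' [Uz' Z2z'] <-] E].
  have /psi_eq : psi (z, s) = psi (z', t) by rewrite /psi /= E.
  move=> /(_ Z2z Z2z') /Uinj.
  by move: Uz Uz'; rewrite /ysection /= => Uz Uz' /(_ Uz Uz')[].
rewrite /product_counting -esum_scale//; apply: eq_esum => s _.
rewrite b_image invgK [LHS]etab; last first.
  by apply: measurable_image_equivariant; [exact: m_section | exact: subIsetr].
rewrite eta_image_equivariant; [| exact: m_section | exact: subIsetr |].
  congr (_ * _)%E; rewrite (_ : [set z | U (z, s)] = ysection U (s : discrete Gamma)).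
    rewrite [RHS](measureDI zeta (measurable_ysection (s : discrete Gamma) mU) mZ2).
    rewrite [X in (X + _)%E](_ : _ = 0%E) ?add0e//.
    apply: (@subset_measure0 _ _ _ zeta _ (~` Z2)).
    - by apply: measurableD => //; exact: measurable_ysection.
    - exact: measurableC.
    - by move=> z [].
    - by rewrite [LHS]probability_setC// zeta_Z2 subee.
  by apply/seteqP; split=> z; rewrite /ysection /= inE.
move=> z z'; rewrite !inE => -[Uz Z2z] [Uz' Z2z'] E.
have /psi_eq : psi (z, s) = psi (z', s) by rewrite /psi /= E.
move=> /(_ Z2z Z2z') /Uinj.
by move: Uz Uz'; rewrite /ysection /= => Uz Uz' /(_ Uz Uz')[].
Qed.

Let section_measurable (E : Gamma -> set Z) : (forall s, measurable (E s)) ->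
  measurable [set p : (Z * discrete Gamma)%type | E p.2 p.1].
Proof.
move=> mE; rewrite [X in measurable X](_ : _ =
    \bigcup_(s : Gamma) (E s `*` [set (s : discrete Gamma)])).
  by apply: countable_bigcup_measurable => // s; exact: measurableX.
apply/seteqP; split=> -[z s] /=; first by move=> Ez; exists s.
by move=> [t _ [/= Ez ->]].
Qed.

Let y0 : Y := Q z0.

(** [U2] is a union of [L]-orbits, so the test does not depend on the representative. *)
Definition induced_map_inv (o : O) : Y :=
  if pselect (Z2 (orbit_repr o).1) then psi (orbit_repr o) else y0.

Let E_inv p : U2 p -> induced_map_inv (IP p) = psi p.
Proof.
move=> U2p; have E : IP (orbit_repr (IP p)) = IP p by exact: orbit_reprK.
have U2r : U2 (orbit_repr (IP p)) by exact: U2_pi U2p (esym E).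
by rewrite /induced_map_inv; case: pselect => //= _; exact/psi_eq.
Qed.

Let E_inv_off p : ~ U2 p -> induced_map_inv (IP p) = y0.
Proof.
move=> nU2p; have E : IP (orbit_repr (IP p)) = IP p by exact: orbit_reprK.
rewrite /induced_map_inv; case: pselect => // U2r; case: nU2p.
exact: U2_pi U2r E.
Qed.

Lemma measurable_induced_map_inv : measurable_fun setT induced_map_inv.
Proof.
move=> _ B mB; rewrite setTI.
change (measurable (IP @^-1` (induced_map_inv @^-1` B))).
rewrite [X in measurable X](_ : _ = [set p : (Z * discrete Gamma)%type |
    ((Z2 `&` Q @^-1` (b (p.2 : Gamma)^-1%g @^-1` B)) `|`
     (if `[< B y0 >] then ~` Z2 else set0)) p.1]).
  apply: (@section_measurable (fun s => (Z2 `&` Q @^-1` (b s^-1%g @^-1` B)) `|`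
     (if `[< B y0 >] then ~` Z2 else set0))) => s.
  apply: measurableU; first exact/mQ_preimage/mb_pre.
  by case: ifP => // _; exact: measurableC.
apply/seteqP; split=> p /=.
  have [U2p|nU2p] := pselect (U2 p); first by rewrite E_inv//; left.
  by rewrite E_inv_off// => By; right; rewrite asboolT.
move=> [[U2p Bp]|]; first by rewrite E_inv.
by case: asboolP => // By nU2p; rewrite E_inv_off.
Qed.

Let Y2_ae : \forall y \ae eta, Y2 y.
Proof. exact: measure1_ae measurable_equivariant_range equivariant_range_full. Qed.

Lemma induced_map_conjugation (nu : set O -> \bar R) :
  nu = pushforward eta D ->
  conjugation eta nu b (induced_action c theta) D.
Proof.
move=> ->; split.
- exact: measurable_induced_map.
- by [].
- exists induced_map_inv; split; first exact: measurable_induced_map_inv.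
    by apply: filterS Y2_ae => y /Y2_psi[p U2p ->]; rewrite D_psi// E_inv.
  exists [set o | ~ Z2 (orbit_repr o).1]; split.
  + change (measurable (IP @^-1` [set o | ~ Z2 (orbit_repr o).1])).
    rewrite [X in measurable X](_ : _ =
        [set p : (Z * discrete Gamma)%type | (~` Z2) p.1]).
      apply: (@section_measurable (fun=> ~` Z2)) => _; exact: measurableC.
    apply/seteqP; split=> p /= np; have E : IP (orbit_repr (IP p)) = IP p
      by exact: orbit_reprK.
      by move=> U2p; apply: np; exact: U2_pi U2p (esym E).
    by move=> U2r; apply: np; exact: U2_pi U2r E.
  + rewrite /pushforward; apply: (@subset_measure0 _ _ _ eta _ (~` Y2)).
    * rewrite D_preimage; apply: measurableU.
        rewrite (_ : _ `&` _ = set0) ?image_set0//.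
        apply/seteqP; split=> // p [/= np U2p]; apply: np.
        by apply: U2_pi U2p _; exact/esym/orbit_reprK.
      by case: ifP => // _; apply: measurableC; exact: measurable_equivariant_range.
    * by apply: measurableC; exact: measurable_equivariant_range.
    * move=> y /= np /Y2_psi[p U2p E]; apply: np; rewrite E D_psi//.
      by apply: U2_pi U2p _; exact/esym/orbit_reprK.
    * exact: eta_Y2C.
  + move=> o /= nD; apply: contrapT => /contrapT Z2o; apply: nD.
    by rewrite -{1}(orbit_reprK o) E_inv// D_psi//; exact: orbit_reprK.
- move=> t; apply: filterS Y2_ae => y /Y2_psi[[z s] Z2z ->].
  rewrite D_psi// induced_actionE -(D_psi (p := (z, (s * t^-1)%g)))//.
  by rewrite /psi /= invgM invgK bM.
Qed.

End Induction.

Lemma equivariant_map_induction :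
  [/\ finite_set (image_cosets theta), finite_set (group_kernel theta),
      c1 * (card_of (image_cosets theta))%:R = (card_of (group_kernel theta))%:R &
      exists (nu : probability (induced_space c theta) R)
             (D : Y -> induced_space c theta),
        [/\ normalized_quotient_measure zeta c theta nu,
            conjugation eta nu b (induced_action c theta) D &
            forall z t, Z2 z -> D (b t (Q z)) =
              induced_action c theta t (induced_pi c theta (z, 1%g))]].
Proof.
split; [exact: finite_equivariant_index | exact: finite_equivariant_kernel |
  exact: equivariant_scaling |].
have [nu nuE] := exists_pushforward eta measurable_induced_map.
exists nu, induced_map; split.
- exists c1 => // U mU Uinj; rewrite nuE.
  exact: induced_map_quotient_measure.
- exact: induced_map_conjugation.
- by move=> z t; exact: induced_map_orbit.
Qed.

End EquivariantMap.

Lemma card_of_gt0 (T : choiceType) (A : set T) x : finite_set A -> A x ->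
  (0 < card_of A)%N.
Proof.
move=> fA Ax; rewrite /card_of cardfs_gt0; apply/eqP => A0.
have : x \in fset_set A by rewrite in_fset_set ?inE.
by rewrite A0 inE.
Qed.

(** * The equivariant map on X^K1 *)

Section EquivariantQuotient.
Variables (R : realType) (G : groupType) (K : topGroupType).
Variables (d : measure_display) (X : measurableType d) (mu : probability X R).
Variables (a : G * K -> X -> X) (Gamma : groupType).
Variables (d' : measure_display) (Y : measurableType d') (eta : probability Y R).
Variable b : Gamma -> Y -> Y.
Hypotheses (a_pmp : pmp_action mu a) (b_pmp : pmp_action eta b).
Hypothesis b_ergodic : ergodic eta b.
Hypothesis Gamma_countable : countable [set: Gamma].
Variables (Ah : set X) (ph : X -> Y).
Hypotheses (mAh : measurable Ah)
  (AhK : forall k x, Ah x -> Ah (a (1%g, k) x))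
  (mph : measurable_fun Ah ph)
  (phK : forall k x, ph (a (1%g, k) x) = ph x)
  (ph_free : forall x s, Ah x -> b s (ph x) = ph x -> s = 1%g)
  (Ah_free : forall x g, Ah x -> (exists k, a (g, k) x = x) -> g = 1%g)
  (ph_orbit : forall x x', Ah x -> Ah x' ->
    (exists t, ph x' = b t (ph x)) <-> (exists h, x' = a h x))
  (ph_fiber : forall x x', Ah x -> Ah x' -> ph x = ph x' ->
    exists k, x' = a (1%g, k) x).
Variable c0 : R.
Hypothesis c0_gt0 : 0 < c0.
Hypothesis ph_image : forall E, measurable E -> E `<=` Ah ->
  (forall k x, E x -> E (a (1%g, k) x)) ->
  measurable (ph @` E) /\ eta (ph @` E) = (c0%:E * mu E)%E.
Variable en : nat -> G.
Variables (delta : G * K -> Gamma) (fT : X -> Gamma) (X2 : set X).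
Hypothesis deltaM : forall h h', delta (h * h')%g = (delta h * delta h')%g.
Hypotheses (mX2 : measurable X2) (mu_X2 : mu X2 = 1%E)
  (X2_sweep : X2 `<=` sweep a Ah en) (X2_act : forall h x, X2 x -> X2 (a h x)).
Hypothesis mfT : forall s, measurable [set x | X2 x /\ fT x = s].

Local Notation p := (transversal_map a Ah ph en).
Let P x : Y := b (fT x) (p x).

Hypothesis P_act : forall h x, X2 x -> P (a h x) = b (delta h) (P x).
Variable K1 : normal_subgroup K.
Hypothesis K1P : forall k, normal_set K1 k <-> delta (1%g, k) = 1%g.
Hypothesis finite_K0 : finite_set [set: quotient_group K1].

Let a1 : forall x, a 1%g x = x. Proof. by case: a_pmp. Qed.
Let aM : forall g h x, a (g * h)%g x = a g (a h x). Proof. by case: a_pmp. Qed.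
Let ma : forall h, measurable_fun setT (a h). Proof. by case: a_pmp. Qed.
Let mua : forall h A, measurable A -> mu (a h @^-1` A) = mu A.
Proof. by case: a_pmp. Qed.
Let b1 : forall y, b 1%g y = y. Proof. by case: b_pmp. Qed.
Let bM : forall s t y, b (s * t)%g y = b s (b t y). Proof. by case: b_pmp. Qed.
Let mb : forall s, measurable_fun setT (b s). Proof. by case: b_pmp. Qed.
Let etab : forall h A, measurable A -> eta (b h @^-1` A) = eta A.
Proof. by case: b_pmp. Qed.
Let bK s y : b s^-1%g (b s y) = y. Proof. by rewrite -bM mulVg. Qed.
Let bVK s y : b s (b s^-1%g y) = y. Proof. by rewrite -bM mulgV. Qed.
Let aK h x : a h^-1%g (a h x) = x. Proof. by rewrite -aM mulVg. Qed.
Let aVK h x : a h (a h^-1%g x) = x. Proof. by rewrite -aM mulgV. Qed.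
Let delta1 : delta 1%g = 1%g.
Proof. by apply: (mulgI (delta 1%g)); rewrite -deltaM !mulg1. Qed.
Let deltaV l : delta l^-1%g = (delta l)^-1%g.
Proof. by apply: (mulgI (delta l)); rewrite -deltaM !mulgV. Qed.

Local Notation Z := (fixed_quotient a K1).
Local Notation q := (fixed_pi a K1).
Local Notation L := (G * quotient_group K1)%type.
Local Notation c := (fixed_quotient_action a K1).

(** Independent of the representative because [delta] is trivial on [K1]. *)
Definition quotient_hom (l : L) : Gamma := delta (l.1, coset_repr l.2).
Local Notation theta := quotient_hom.

Let delta_coset g k l : coset_pi K1 k = coset_pi K1 l -> delta (g, k) = delta (g, l).
Proof.
move=> /coset_piP/K1P kl; have -> : (g, l) = ((g, k) * (1, k^-1 * l))%g.
  by congr pair; rewrite /= ?mulg1 ?mulVKg.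
by rewrite deltaM kl mulg1.
Qed.

Lemma quotient_homE g k : theta (g, coset_pi K1 k) = delta (g, k).
Proof. by apply: delta_coset; rewrite /= coset_reprK. Qed.

Lemma quotient_homM l l' : theta (l * l')%g = (theta l * theta l')%g.
Proof.
case: l l' => [g C] [g' C']; rewrite -(coset_reprK C) -(coset_reprK C').
rewrite [((_, _) * _)%g](_ : _ = (g * g', coset_pi K1 (coset_repr C * coset_repr C'))%g).
  by rewrite !quotient_homE -deltaM.
by rewrite coset_piM.
Qed.

Lemma quotient_hom_inj C : theta (1%g, C) = 1%g -> C = 1%g.
Proof.
rewrite -(coset_reprK C) quotient_homE => /K1P Kk; apply/coset_piP.
by rewrite mulg1; exact: normalV.
Qed.

Let q_eq x y : q x = q y <-> exists2 k, normal_set K1 k & y = a (1%g, k) x.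
Proof. exact: fixed_piP (@normal1 _ K1) (@normalM _ K1) (@normalV _ K1) _ _. Qed.

Let q_repr z : q (fixed_repr z) = z. Proof. exact: orbit_reprK. Qed.

Let cE g k x : c (g, coset_pi K1 k) (q x) = q (a (g, k) x).
Proof. exact: fixed_quotient_actionE. Qed.

Let cE' l x : c l (q x) = q (a (l.1, coset_repr l.2) x).
Proof. by case: l => g C; rewrite -cE coset_reprK. Qed.

Let P_K1 k x : X2 x -> normal_set K1 k -> P (a (1%g, k) x) = P x.
Proof. by move=> X2x /K1P k1; rewrite P_act// k1 b1. Qed.

Let P_free s t x : X2 x -> b s (P x) = b t (P x) -> s = t.
Proof.
move=> /X2_sweep X0x; rewrite /P -!bM.
by move=> /(transversal_map_free b_pmp ph_free X0x)/mulIg.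
Qed.

(** The transversal map is [K]-invariant, so the factor [delta (1, k)] in the equivariance of [P]
    must come from [fT]; freeness cancels the common point. *)
Let fT_act k x : X2 x -> fT (a (1%g, k) x) = (delta (1%g, k) * fT x)%g.
Proof.
move=> X2x; have := P_act (1%g, k) X2x.
rewrite /P -bM (transversal_map_act a_pmp AhK phK).
exact: (transversal_map_free b_pmp ph_free (X2_sweep X2x)).
Qed.

Let Z2 : set Z := [set z | X2 (fixed_repr z)].
Let Q (z : Z) : Y := P (fixed_repr z).

Let X2E h x : X2 (a h x) <-> X2 x.
Proof. by split=> [/(X2_act h^-1%g)|]; [rewrite aK | exact: X2_act]. Qed.

Let q_X2 x : X2 (fixed_repr (q x)) <-> X2 x.
Proof. by have /q_eq[k _ ->] := esym (q_repr (q x)); exact: X2E. Qed.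

Let Q_q x : X2 x -> Q (q x) = P x.
Proof.
by move=> X2x; have /q_eq[k Kk E] := esym (q_repr (q x)); rewrite /Q E P_K1.
Qed.

Let measurable_Z (E : set Z) : measurable (q @^-1` E) -> measurable E.
Proof. by []. Qed.

Let mZ2 : measurable Z2.
Proof.
by apply: measurable_Z; rewrite (_ : _ @^-1` _ = X2)//; apply/seteqP; split=> x /q_X2.
Qed.

Let mQ : measurable_fun Z2 Q.
Proof.
move=> _ D mD; apply: measurable_Z.
rewrite [X in measurable X](_ : _ =
   \bigcup_s ([set x | X2 x /\ fT x = s] `&` (X2 `&` p @^-1` (b s @^-1` D)))).
  apply: countable_bigcup_measurable => // s; apply: measurableI => //.
  have := measurable_transversal_map a_pmp mAh mph (en := en).
  move=> /(measurable_funS (measurable_sweep a_pmp mAh en) X2_sweep); apply => //.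
  by rewrite -[X in measurable X]setTI; exact: mb.
apply/seteqP; split=> x /=.
  by move=> [/q_X2 X2x]; rewrite Q_q// => Dx; exists (fT x).
by move=> [s _ [[X2x <-] [_ Dx]]]; split; [exact/q_X2 | rewrite Q_q].
Qed.

(** [fixed_measure] is a bare set function; [zeta] is the same function bundled as a probability. *)
Variable zeta : probability Z R.
Hypothesis zetaE : (zeta : set Z -> \bar R) = fixed_measure mu a K1.

Let zeta_Z2 : zeta Z2 = 1%E.
Proof.
rewrite zetaE /fixed_measure /pushforward -mu_X2; congr (mu _).
by apply/seteqP; split=> x /q_X2.
Qed.

Let c_pmp : pmp_action zeta c.
Proof.
have mc h : measurable_fun setT (c h).
  move=> _ E mE; rewrite setTI; apply: measurable_Z.
  rewrite (_ : _ @^-1` _ = a (h.1, coset_repr h.2) @^-1` (q @^-1` E)).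
    exact: mact_preimage a_pmp _ _ mE.
  by apply/seteqP; split=> x /=; rewrite cE'.
split=> //.
- by move=> z; rewrite -(q_repr z) cE a1.
- move=> [g C] [g' C'] z.
  rewrite -(q_repr z) -(coset_reprK C) -(coset_reprK C').
  rewrite [((_, _) * _)%g](_ : _ = (g * g', coset_pi K1 (coset_repr C * coset_repr C'))%g).
    by rewrite (cE g' (coset_repr C')) !cE (act_pairM aM).
  by rewrite coset_piM.
- move=> h E mE; rewrite zetaE /fixed_measure /pushforward.
  rewrite -[RHS](mua (h.1, coset_repr h.2) mE); congr (mu _).
  by apply/seteqP; split=> x /=; rewrite cE'.
Qed.

Let Z2_act l z : Z2 z -> Z2 (c l z).
Proof. by rewrite -(q_repr z) cE' => /q_X2 X2x; exact/q_X2/X2_act. Qed.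

Let Q_act l z : Z2 z -> Q (c l z) = b (theta l) (Q z).
Proof.
rewrite -(q_repr z) cE' => /q_X2 X2x.
by rewrite Q_q ?Q_q ?P_act//; exact: X2_act.
Qed.

Let Q_free s z : Z2 z -> b s (Q z) = Q z -> s = 1%g.
Proof. by move=> Z2z; rewrite -{2}[Q z]b1; exact: P_free. Qed.

Let Q_orbit t z z' : Z2 z -> Z2 z' -> Q z' = b t (Q z) -> exists l, z' = c l z.
Proof.
rewrite -(q_repr z) -(q_repr z'); set x := fixed_repr z; set x' := fixed_repr z'.
move=> /q_X2 X2x /q_X2 X2x'; rewrite !Q_q// => E.
have [|h ->] := (transversal_map_orbit a_pmp ph_orbit (X2_sweep X2x) (X2_sweep X2x')).1.
  exists ((fT x')^-1 * (t * fT x))%g.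
  by rewrite !bM -[b (fT x) _]/(P x) -E /P bK.
by case: h => g k; exists (g, coset_pi K1 k); rewrite cE.
Qed.

Let X2_free g k x : X2 x -> a (g, k) x = x -> g = 1%g.
Proof.
move=> /X2_sweep/visit_timeP; set h := en _ => Ahx E.
have H : a (h * g * h^-1, k)%g (a (h, 1%g) x) = a (h, 1%g) x.
  by rewrite (act_pairM aM) mulgVK mulg1 -{2}E (act_pairM aM) mul1g.
have := Ah_free Ahx (ex_intro _ k H) => /(congr1 (fun y => h^-1 * y * h)%g).
by rewrite mulg1 mulVg !mulgA mulVg mul1g mulgVK.
Qed.

(** A stabilizing pair fixes a point of X up to [K1]. Freeness of [G] on X^K gives [g = 1], and
    freeness of [b] at [P x] then puts the remaining element of [K] in the kernel of [delta]. *)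
Let c_free l z : Z2 z -> c l z = z -> l = 1%g.
Proof.
case: l => g C; rewrite -(coset_reprK C) -(q_repr z); move: (coset_repr C) => k.
move: (fixed_repr z) => x /q_X2 X2x; rewrite cE => /q_eq[n Kn].
rewrite (act_pairM aM) mul1g => E.
have g1 := X2_free X2x (esym E); rewrite g1 in E *.
have nk : delta (1%g, (n * k)%g) = 1%g.
  by apply: (P_free X2x); rewrite -P_act// -E b1.
congr pair; apply/coset_piP; rewrite mulg1; apply: normalV; apply/K1P.
move: nk; rewrite [(_, _)](_ : _ = (1, n) * (1, k))%g ?deltaM; last by rewrite -[RHS]/(_, _) mulg1.
by move/K1P: Kn => ->; rewrite mul1g.
Qed.
Variable enS : nat -> Gamma.
Hypothesis enSP : forall s, exists n, enS n = s.

(** Both the twist and the visiting element are fixed here, so [P] is [ph] composed with one element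
    of [G] and one of [Gamma]. *)
Let piece (s : Gamma) (i : nat) : set X :=
  [set x | X2 x /\ fT x = s] `&` [set x | sweep a Ah en x /\ visit_time a Ah en x = i].

Let m_piece s i : measurable (piece s i).
Proof. by apply: measurableI; [exact: mfT | exact: (measurable_visit a_pmp mAh en i)]. Qed.

Let piece_act s i k x : normal_set K1 k -> piece s i x -> piece s i (a (1%g, k) x).
Proof.
move=> Kk [[X2x fx] [_ vx]]; split; split.
- exact: X2_act.
- by rewrite fT_act// fx; move/K1P: Kk => ->; rewrite mul1g.
- by apply: X2_sweep; exact: X2_act.
- by rewrite (visit_time_act a_pmp AhK).
Qed.

Let piece_visit s i x : piece s i x -> Ah (a (en i, 1%g) x).
Proof. by move=> [_ [/visit_timeP + <-]]. Qed.

Let piece_P s i x : piece s i x -> P x = b s (ph (a (en i, 1%g) x)).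
Proof. by move=> [[_ <-] [_ <-]]. Qed.

(** The two points differ by some [k] in [K]. As [fT] takes the same value at both, [delta (1, k)]
    is trivial and [k] lies in [K1]. *)
Let piece_fiber s i x x' : piece s i x -> piece s i x' ->
  ph (a (en i, 1%g) x) = ph (a (en i, 1%g) x') -> q x = q x'.
Proof.
move=> px px' /(ph_fiber (piece_visit px) (piece_visit px'))[k].
rewrite (act_comm aM) => /(act_inj a_pmp) x'E; apply/q_eq; exists k => //.
case: px px' => [[X2x fx] _] [[_ fx'] _]; apply/K1P.
by apply: (mulIg (fT x)); rewrite -fT_act// -x'E fx' fx mul1g.
Qed.

(** The default repeats a piece, which is harmless since the sets [V n] serve only as a cover. *)
Let code (n : nat) : nat * nat := odflt (0%N, 0%N) (choice.unpickle n).

Let V n : set Z := [set z | piece (enS (code n).1) (code n).2 (fixed_repr z)].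

Let V_q n x : V n (q x) <-> piece (enS (code n).1) (code n).2 x.
Proof.
have /q_eq[k Kk E] := esym (q_repr (q x)); rewrite /V /= E.
split=> [H|]; last exact: piece_act.
have := piece_act (normalV Kk) H.
by rewrite (act_pairM aM) mulVg mul1g [a _ _]a1.
Qed.

Let mV n : measurable (V n).
Proof.
apply: measurable_Z; rewrite (_ : _ @^-1` _ = piece (enS (code n).1) (code n).2)//.
by apply/seteqP; split=> x /V_q.
Qed.

Let bigcupV : \bigcup_n V n = Z2.
Proof.
apply/seteqP; split=> [z [n _ [[]]]//|z Z2z].
have [m mz] := enSP (fT (fixed_repr z)).
exists (choice.pickle (m, visit_time a Ah en (fixed_repr z))) => //.
rewrite /V /code /= choice.pickleK /= mz; split=> //; split=> //.
exact: X2_sweep.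
Qed.

Let V_inj n : {in V n &, injective Q}.
Proof.
move=> z z'; rewrite !inE -(q_repr z) -(q_repr z').
move=> /V_q px /V_q px'; rewrite !Q_q; [|by case: px' => -[]|by case: px => -[]].
rewrite (piece_P px) (piece_P px') => /(congr1 (b (enS (code n).1)^-1%g)).
by rewrite !bK; exact: (piece_fiber px px').
Qed.

Let card_K0 : nat := card_of [set: quotient_group K1].

(** [ph_image] speaks of [K]-invariant sets, so a [K1]-invariant set is replaced by its
    [K]-saturation. In a piece this is a disjoint union over [K0], since distinct cosets change [fT]
    by distinct values of [delta]. *)
Let piece_translate s i E : measurable E -> E `<=` piece s i ->
  (forall k x, normal_set K1 k -> E x -> E (a (1%g, k) x)) ->
  let KE := \bigcup_(C : quotient_group K1) (a (1%g, coset_repr C) @^-1` E) in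
  [/\ measurable KE, mu KE = ((card_K0)%:R%:E * mu E)%E &
    forall x, KE x <-> exists k, E (a (1%g, k) x)].
Proof.
move=> mE Ep EK KE.
have mD (C : quotient_group K1) : measurable (a (1%g, coset_repr C) @^-1` E).
  exact: mact_preimage a_pmp _ _ mE.
have muE : mu E = (fine (mu E))%:E by rewrite fineK// fin_num_measure.
split.
- exact: fin_bigcup_measurable.
- rewrite [LHS](@measure_equal_bigcup _ _ _ mu _ setT _ (fine (mu E)))//.
  + by rewrite EFinM -muE.
  + by move=> C _; rewrite -[RHS]muE; exact: mua.
  move=> C C' x _ _; rewrite /= => Ex Ex'.
  have [[X2x fx] _] := Ep _ Ex; have [[X2x' fx'] _] := Ep _ Ex'.
  have {}X2x : X2 x by exact/X2E/X2x.
  rewrite -(coset_reprK C) -(coset_reprK C'); apply/coset_piP/K1P.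
  rewrite [(_, _)](_ : _ = (1, coset_repr C)^-1 * (1, coset_repr C'))%g; last first.
    by apply: injective_projections; rewrite /= ?invg1 ?mulg1.
  rewrite deltaM deltaV; apply: (mulgI (delta (1%g, coset_repr C))).
  rewrite mulVKg mulg1; apply: (mulIg (fT x)).
  by rewrite -!fT_act// fx fx'.
- move=> x; split=> [[C _ Ex]|[k Ek]]; first by exists (coset_repr C).
  exists (coset_pi K1 k) => //=.
  have /coset_piP Kn : coset_pi K1 k = coset_pi K1 (coset_repr (coset_pi K1 k)).
    by rewrite coset_reprK.
  move: (normalJ k Kn); rewrite mulVKg => /EK/(_ Ek).
  by rewrite (act_pairM aM) mul1g mulgVK.
Qed.

Let act_image h E : a h @` E = a h^-1%g @^-1` E.
Proof.
apply/seteqP; split=> y /=; first by move=> [x Ex <-]; rewrite aK.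
by move=> Ey; exists (a h^-1%g y) => //; rewrite aVK.
Qed.

(** [E] and its [K]-saturation have the same image, but the saturation, on which [ph] scales by
    [c0], has [card_K0] times the measure. *)
Let c1 : R := card_K0%:R * c0.

Let V_image n E : measurable E -> E `<=` V n ->
  measurable (Q @` E) /\ eta (Q @` E) = (c1%:E * zeta E)%E.
Proof.
move=> mE EV; set s := enS (code n).1; set i := (code n).2.
have mqE : measurable (q @^-1` E) by exact: mE.
have Ep : q @^-1` E `<=` piece s i by move=> x /EV/V_q.
have EK k x : normal_set K1 k -> E (q x) -> E (q (a (1%g, k) x)).
  by move=> Kk; rewrite (_ : q (a _ _) = q x)//; apply/esym/q_eq; exists k.
have [mKE muKE KEP] := piece_translate mqE Ep EK.
move: mKE muKE KEP; set KE := \bigcup_C _ => mKE muKE KEP.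
have KEK k x : KE x -> KE (a (1%g, k) x).
  move=> /KEP[l Ex]; apply/KEP; exists (l * k^-1)%g.
  by rewrite (act_pairM aM) mul1g mulgVK.
have EKE : q @^-1` E `<=` KE.
  by move=> x Ex; apply/KEP; exists 1%g; rewrite [a _ _]a1.
have mT : measurable (a (en i, 1%g) @` KE).
  by rewrite act_image; exact: mact_preimage a_pmp _ _ mKE.
have [||mph' etaph] := @ph_image (a (en i, 1%g) @` KE) mT.
- move=> _ [x /KEP[k /Ep/piece_visit H] <-].
  by move: H; rewrite -(act_comm aM) => /(AhKE a_pmp AhK).
- move=> k _ [x KEx <-]; exists (a (1%g, k) x); first exact: KEK.
  by rewrite (act_comm aM).
have QE : Q @` E = b s^-1%g @^-1` (ph @` (a (en i, 1%g) @` KE)).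
  apply/seteqP; split=> y.
    move=> [z Ez <-]; rewrite -(q_repr z) in Ez *; set x := fixed_repr z in Ez *.
    have px := Ep _ Ez; exists (a (en i, 1%g) x); first by exists x => //; exact: EKE.
    by rewrite Q_q ?(piece_P px) ?bK//; case: px => -[].
  move=> [_ [x /KEP[k Ex] <-] E']; exists (q (a (1%g, k) x)) => //.
  have px := Ep _ Ex; rewrite Q_q; last by case: px => -[].
  by rewrite (piece_P px) -(act_comm aM) phK E' bVK.
rewrite QE; split; first by rewrite -[X in measurable X]setTI; exact: mb.
rewrite [LHS]etab// etaph [X in (_ * X)%E](_ : _ = mu KE); last first.
  by rewrite act_image; exact: mua.
by rewrite muKE zetaE /fixed_measure /pushforward muleA -EFinM /c1 mulrC.
Qed.

Let c1_gt0 : 0 < c1.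
Proof.
by rewrite mulr_gt0// ltr0n; exact: (card_of_gt0 (x := 1%g : quotient_group K1)).
Qed.

Lemma equivariant_quotient_induction :
  [/\ finite_set (image_cosets theta), finite_set (group_kernel theta),
      card_K0%:R * c0 * (card_of (image_cosets theta))%:R =
        (card_of (group_kernel theta))%:R &
      exists (nu : probability (induced_space c theta) R)
             (D : Y -> induced_space c theta),
        [/\ normalized_quotient_measure zeta c theta nu,
            conjugation eta nu b (induced_action c theta) D &
            forall x t, X2 x -> D (b t (P x)) =
              induced_action c theta t (induced_pi c theta (q x, 1%g))]].
Proof.
have [fI fK cE1 [nu [D [nuP DP DQ]]]] := equivariant_map_induction Gamma_countable
  c_pmp b_pmp b_ergodic quotient_homM mZ2 zeta_Z2 Z2_act mQ Q_act Q_free Q_orbit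
  c_free c1_gt0 mV bigcupV V_inj V_image.
split=> //; exists nu, D; split=> // x t X2x.
by rewrite -DQ; [rewrite Q_q | exact/q_X2].
Qed.

End EquivariantQuotient.

Section HomKernel.
Variables (K Gamma : groupType) (f : K -> Gamma).
Hypothesis fM : forall k l, f (k * l)%g = (f k * f l)%g.

Let f1 : f 1%g = 1%g.
Proof. by apply: (mulgI (f 1%g)); rewrite -fM !mulg1. Qed.
Let fV l : f l^-1%g = (f l)^-1%g.
Proof. by apply: (mulgI (f l)); rewrite -fM !mulgV. Qed.

Program Definition hom_kernel : normal_subgroup K :=
  @NormalSubgroup K [set k | f k = 1%g] f1 _ _ _.
Next Obligation. by move=> h k /= fh fk; rewrite fM fh fk mul1g. Qed.
Next Obligation. by move=> h /= fh; rewrite fV fh invg1. Qed.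
Next Obligation. by move=> h k /= fh; rewrite !fM fh fV mulg1 mulgV. Qed.

Lemma finite_hom_quotient : finite_set (range f) ->
  finite_set [set: quotient_group hom_kernel].
Proof.
move=> fin; pose F (C : quotient_group hom_kernel) := f (coset_repr C).
rewrite (_ : [set: _] = F @^-1` range f); last first.
  by apply/seteqP; split=> // C _; exists (coset_repr C).
apply: finite_preimage => // C D _ _ FCD.
rewrite -(coset_reprK C) -(coset_reprK D); apply/coset_piP.
by rewrite /= fM fV [f _]FCD mulVg.
Qed.

End HomKernel.

Theorem theorem4p1 (R : realType)
  (G : groupType) (K : topGroupType)
  (d : measure_display) (X : measurableType d) (mu : probability X R)
  (a : G * K -> X -> X)
  (G_countable : countable [set: G])
  (K_compact : compact [set: K])
  (K_hausdorff : hausdorff_space K)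
  (K_second_countable : @second_countable K)
  (X_standard : standard_borel R X)
  (a_pmp : pmp_action mu a)
  (a_measurable : jointly_measurable a)
  (G_free : essentially_free mu (fun g => a (g, 1%g)))
  (G_mixing : weakly_mixing mu (fun g => a (g, 1%g)))
  (G_superrigid : cocycle_superrigid mu (fun g => a (g, 1%g)))
  (GK_free : essentially_free (fixed_measure mu a [set: K])
               (fixed_action a [set: K]))
  (Gamma : groupType)
  (d' : measure_display) (Y : measurableType d') (eta : probability Y R)
  (b : Gamma -> Y -> Y)
  (Gamma_countable : countable [set: Gamma])
  (Y_standard : standard_borel R Y)
  (b_pmp : pmp_action eta b)
  (b_free : essentially_free eta b)
  (b_ergodic : ergodic eta b)
  (A : set (fixed_quotient a [set: K])) (B : set Y)
  (pi : fixed_quotient a [set: K] -> Y)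
  (pi_soe : stable_orbit_equivalence (fixed_measure mu a [set: K]) eta
              (fixed_action a [set: K]) b A B pi) :
  exists K1 : normal_subgroup K,
    [/\ closed (K1 : set K),
        finite_set [set: quotient_group K1] &
        exists theta : {multiplicative (G * quotient_group K1)%type -> Gamma},
          [/\ finite_set (image_cosets theta),
              finite_set (group_kernel theta),
              (forall k : quotient_group K1, theta (1%g, k) = 1%g -> k = 1%g) &
              exists (nu : probability
                        (induced_space (fixed_quotient_action a K1) theta) R)
                     (Delta : Y ->
                        induced_space (fixed_quotient_action a K1) theta),
                [/\ normalized_quotient_measure (fixed_measure mu a K1)
                      (fixed_quotient_action a K1) theta nu,
                    conjugation eta nu b
                      (induced_action (fixed_quotient_action a K1) theta) Delta,
                    (\forall x \ae fixed_measure mu a K1, A (fixed_map x) ->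
                      exists t : Gamma,
                        Delta (pi (fixed_map x)) =
                        induced_action (fixed_quotient_action a K1) theta t
                          (induced_pi (fixed_quotient_action a K1) theta
                             (x, 1%g))) &
                    compression (fixed_measure mu a [set: K]) eta A B =
                    ((card_of [set: quotient_group K1]
                      * card_of (image_cosets theta))%N%:R
                     / (card_of (group_kernel theta))%:R)%R]]].
Proof.
have [Ah [ph [[mAh Ah_gt0 AhA0 AhA AhK] [mph phE] [ph_free Ah_free]
  [ph_orbit ph_fiber] ph_image]]] :=
  lifted_equivalence a_pmp GK_free Y_standard b_free pi_soe.
have [[mA mB A_gt0 B_gt0] _ _ _] := pi_soe.
have [a1 aM ma _] := a_pmp.
have phK k x : ph (a (1%g, k) x) = ph x.
  by rewrite !phE; congr pi; apply/esym/fixed_piT => //; exists k.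
have [en enP] := countable_enum G_countable.
have [enS enSP] := countable_enum Gamma_countable.
have [delta [fT [X2 [deltaM [kernel_closed finite_range]
  [mX2 mu_X2 X2_sweep X2_act] mfT P_act]]]] :=
  strict_untwist a_pmp G_mixing G_superrigid Gamma_countable G_countable
    Y_standard b_pmp mAh Ah_gt0 AhK mph phK ph_free ph_orbit enP
    K_compact K_hausdorff a_measurable.
pose rA := fine (fixed_measure mu a setT A); pose rB := fine (eta B).
have AE : fixed_measure mu a setT A = rA%:E.
  by rewrite fineK// fin_num_measure//; exact: mA.
have BE : eta B = rB%:E by rewrite fineK// fin_num_measure.
have rA_gt0 : 0 < rA by rewrite -lte_fin -AE.
have rB_gt0 : 0 < rB by rewrite -lte_fin -BE.
(* The inverse of the compression constant: [pi] multiplies measures by eta(B) / zeta(A). *)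
pose c0 := rB / rA.
have c0_gt0 : 0 < c0 by rewrite divr_gt0.
have ph_image0 E : measurable E -> E `<=` Ah ->
    (forall k x, E x -> E (a (1%g, k) x)) ->
    measurable (ph @` E) /\ eta (ph @` E) = (c0%:E * mu E)%E.
  move=> mE EA EK; have [mphE] := ph_image E mE EA EK.
  have -> : eta (ph @` E) = (fine (eta (ph @` E)))%:E by rewrite fineK// fin_num_measure.
  have -> : mu E = (fine (mu E))%:E by rewrite fineK// fin_num_measure.
  rewrite AE BE -!EFinM => -[H]; split=> //; congr EFin.
  by rewrite /c0 mulrC mulrA -H mulfK// gt_eqF.
have dKM k l : delta (1%g, (k * l)%g) = (delta (1%g, k) * delta (1%g, l))%g.
  by rewrite -deltaM; congr delta; apply: injective_projections; rewrite /= ?mulg1.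
pose K1 := hom_kernel dKM.
have K1P k : normal_set K1 k <-> delta (1%g, k) = 1%g by [].
have finite_K0 : finite_set [set: quotient_group K1] by exact: finite_hom_quotient.
have [zeta zetaE] := exists_pushforward mu (@measurable_fixed_pi G K _ X a K1).
have [fI fK scaling [nu [Delta [nuP DeltaP DeltaQ]]]] :=
  equivariant_quotient_induction a_pmp b_pmp b_ergodic Gamma_countable mAh AhK mph
    phK ph_free Ah_free ph_orbit ph_fiber c0_gt0 ph_image0 deltaM mX2 mu_X2
    X2_sweep X2_act mfT P_act K1P finite_K0 zetaE enSP.
exists K1; split=> //.
pose theta : {multiplicative (G * quotient_group K1)%type -> Gamma} :=
  HB.pack (@quotient_hom G K Gamma delta K1)
    (monoid.isMultiplicative.Build _ _ _ (quotient_homM deltaM K1P)).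
exists theta; split=> //; first exact: quotient_hom_inj.
exists nu, Delta; split=> //.
- by rewrite -[X in normalized_quotient_measure X]zetaE.
(* The identity can fail only outside of [X2] or above the null part of [A] lost in passing to [Ah].
   Both sets are [K]-invariant, so they can be tested on representatives. *)
- pose D := fixed_pi a setT @^-1` A `\` Ah.
  have mD : measurable D by apply: measurableD => //; exact: mA.
  have act_repr x : exists k, fixed_repr (fixed_pi a K1 x) = a (1%g, k) x.
    have [k _ ->] := fixed_reprP a1 aM (@normal1 _ K1) (@normalM _ K1) (@normalV _ K1) x.
    by exists k.
  have X2K k x : X2 (a (1%g, k) x) <-> X2 x.
    split=> [/(X2_act (1, k)^-1%g)|]; last exact: X2_act.
    by rewrite -aM mulVg a1.
  have DK k x : D (a (1%g, k) x) <-> D x.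
    have qk : fixed_pi a setT (a (1%g, k) x) = fixed_pi a setT x.
      by apply/esym/fixed_piT => //; exists k.
    by rewrite /D /= qk; split=> -[Ax nAh]; split=> // /(AhKE a_pmp AhK).
  exists [set z | ~ X2 (fixed_repr z) \/ D (fixed_repr z)].
  have preE : fixed_pi a K1 @^-1` [set z | ~ X2 (fixed_repr z) \/ D (fixed_repr z)]
      = ~` X2 `|` D.
    by apply/seteqP; split=> x /=; have [k ->] := act_repr x; rewrite X2K DK.
  split.
  + change (measurable (fixed_pi a K1 @^-1`
      [set z | ~ X2 (fixed_repr z) \/ D (fixed_repr z)])).
    by rewrite preE; apply: measurableU => //; exact: measurableC.
  + rewrite /fixed_measure /pushforward preE; apply: null_set_setU => //.
      exact: measurableC.
    by rewrite [LHS]probability_setC// mu_X2 subee.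
  move=> z nz; apply: contrapT => /not_orP[/contrapT X2x nD]; apply: nz => Az.
  set x := fixed_repr z in X2x nD.
  have Ahx : Ah x by apply: contrapT => nAh; apply: nD; split.
  have Ahx' := visit_timeP (X2_sweep _ X2x).
  have [b1 bM _ _] := b_pmp.
  have [t tE] := (ph_orbit _ _ Ahx Ahx').2 (ex_intro _ _ erefl).
  (* The strict map takes [x] to [fT x * t] applied to [ph x]; this element undoes it. *)
  exists (t^-1 * (fT x)^-1)%g.
  have := DeltaQ x (t^-1 * (fT x)^-1)%g X2x.
  rewrite [fixed_pi a K1 x](_ : _ = z); last exact: orbit_reprK.
  move=> <-; congr Delta; rewrite -[LHS]phE -/x.
  by rewrite -bM mulgVK /transversal_map tE -bM mulVg b1.
- have theta1 : theta 1%g = 1%g.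
    by apply: (mulgI (theta 1%g)); rewrite -(quotient_homM deltaM K1P) !mulg1.
  have := card_of_gt0 fK theta1; rewrite -(ltr0n R) -scaling natrM => kcr_gt0.
  (* The compression constant is the inverse of [c0], which [scaling] relates to the three
     cardinals. *)
  have : rA / rB * (rB / rA) = 1 by rewrite mulrA divfK ?divff// gt_eqF.
  rewrite /compression -[fine _]/rA -[fine (eta B)]/rB => cc0.
  apply: (mulIf (lt0r_neq0 kcr_gt0)); rewrite divfK ?gt_eqF//.
  by rewrite mulrA (mulrCA (rA / rB)) [X in _ * X * _]cc0 mulr1.
Qed.
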